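(* Suppose that $\omega$ is a state of the Toeplitz algebra $\mathcal{T}(\mathbb{N})=C^*(S)$. Then there is a ground state $\psi_\omega$ of $(C^*(G,P),\alpha)$ such that for all $x,y\in P$ \[ \psi_\omega(T_xT_y^* )= \begin{cases} 0&\text{if $\theta(x)\neq 0$ or $\theta(y)\neq 0$}\\ \omega(S^sS^{*t})&\text{if $x=b^s$ and $y=b^t$ (with $s,t\in\mathbb{N}$).} \end{cases} \] The state $\psi_\omega$ is a KMS$_\infty$ state if and only if $\omega$ factors through the quotient map $q:\mathcal{T}(\mathbb{N})\to C(\mathbb{T})$. The map $\omega\mapsto \psi_\omega$ is an affine isomorphism of the state space of $\mathcal{T}(\mathbb{N})$ onto the compact convex set of ground states of $(C^*(G,P),\alpha)$.
   Context: Fix positive integers $c,d$. $G=\mathrm{BS}(c,d)=\langle a,b: ab^c=b^da\rangle$ is the Baumslag-Solitar group, $P$ is the submonoid of $G$ generated by $a$ and $b$, and $\theta:G\to\mathbb{Z}$ is the homomorphism with $\theta(a)=1$, $\theta(b)=0$. $\mathbb{N}=\{0,1,2,\dots\}$. Order: for $g,h\in G$, $g\leq h$ means $g^{-1}h\in P$. It is known (Spielberg) that $(G,P)$ is quasi-lattice ordered: $P\cap P^{-1}=\{e\}$, and every pair $g,h\in G$ with a common upper bound in $P$ has a least upper bound $g\vee h$ in $P$. Write $g\vee h<\infty$ if a common upper bound in $P$ exists and $g\vee h=\infty$ otherwise. A Nica-covariant representation of $P$ is a map $x\mapsto S_x$ of $P$ into the isometries of a unital $C^*$-algebra with $S_e=1$,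 $S_xS_y=S_{xy}$, and $S_xS_x^*S_yS_y^*=S_{x\vee y}S_{x\vee y}^*$ if $x\vee y<\infty$ and $=0$ if $x\vee y=\infty$. $C^*(G,P)$ is the $C^*$-algebra generated by a universal Nica-covariant representation $T:P\to C^*(G,P)$; it is the closed linear span of $\{T_xT_y^*:x,y\in P\}$. The dynamics $\alpha:\mathbb{R}\to\mathrm{Aut}\,C^*(G,P)$ is given by $\alpha_t(T_x)=e^{it\theta(x)}T_x$. For $\beta\in\mathbb{R}\setminus\{0\}$, a state $\psi$ of $C^*(G,P)$ is a KMS$_\beta$ state if and only if $\psi((T_xT_y^* )(T_pT_q^* ))=e^{-\beta(\theta(x)-\theta(y))}\psi((T_pT_q^* )(T_xT_y^* ))$ for all $x,y,p,q\in P$. A KMS$_\infty$ state is a weak* limit of a sequence of KMS$_{\beta_n}$ states with $\beta_n\to\infty$. A state $\phi$ is a ground state if for all $\alpha$-analytic elements $X,Y$ the entire function $z\mapsto\phi(X\alpha_z(Y))$ is bounded on the upper half-plane $\operatorname{Im} z>0$. $\mathcal{T}(\mathbb{N})=C^*(S)$ is the classical Toeplitz algebra generated by the unilateral shift $S$ on $\ell^2(\mathbb{N})$, and $q:\mathcal{T}(\mathbb{N})\to C(\mathbb{T})$ is the canonical quotient map taking $S$ to the function $z\mapsto z$. *)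

(* Defs.v *)
From HB Require Import structures.
From mathcomp Require Import all_boot all_order all_algebra complex.
From mathcomp Require Import all_classical all_reals all_analysis.

Set Implicit Arguments.
Unset Strict Implicit.
Unset Printing Implicit Defensive.

Import Order.TTheory GRing.Theory Num.Theory.
Import numFieldNormedType.Exports.

Local Open Scope classical_set_scope.
Local Open Scope quotient_scope.
Local Open Scope ring_scope.
Local Open Scope complex_scope.

(* The topology and norm of a numFieldType are only found by unification for
   abstract fields and for K^o, so they are copied to the concrete field R[i]. *)
HB.instance Definition _ (R : realType) := PseudoPointedMetric.copy R[i] R[i]^o.
HB.instance Definition _ (R : realType) := NormedModule.copy R[i] R[i]^o.

Section BaumslagSolitar.
Variables c d : nat.

(* The letter (g, s) stands for the generator a if g = true and b otherwise,
   inverted if s = true. *)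
Definition bs_word := seq (bool * bool).

Definition bs_winv (w : bs_word) : bs_word :=
  rev [seq (l.1, ~~ l.2) | l <- w].

(* The congruence on words whose quotient is < a, b : a b^c = b^d a >. *)
Inductive bs_cong : bs_word -> bs_word -> Prop :=
| bs_refl u : bs_cong u u
| bs_sym u v : bs_cong u v -> bs_cong v u
| bs_trans v u w : bs_cong u v -> bs_cong v w -> bs_cong u w
| bs_cat u u' v v' : bs_cong u u' -> bs_cong v v' -> bs_cong (u ++ v) (u' ++ v')
| bs_cancel g s : bs_cong [:: (g, s); (g, ~~ s)] [::]
| bs_relator : bs_cong ((true, false) :: nseq c (false, false))
                       (rcons (nseq d (false, false)) (true, false)).

Definition bs_congb (u v : bs_word) : bool := `[< bs_cong u v >].

Fact bs_congb_refl : reflexive bs_congb.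
Proof. by move=> u; apply/asboolP; exact: bs_refl. Qed.

Fact bs_congb_sym : symmetric bs_congb.
Proof. by move=> u v; apply/asboolP/asboolP => /bs_sym. Qed.

Fact bs_congb_trans : transitive bs_congb.
Proof.
move=> v u w /asboolP uv /asboolP vw.
by apply/asboolP; exact: bs_trans uv vw.
Qed.

Canonical bs_equiv := EquivRel bs_congb bs_congb_refl bs_congb_sym bs_congb_trans.

Definition BS := {eq_quot bs_equiv}.

HB.instance Definition _ := EqQuotient.on BS.
HB.instance Definition _ := Choice.on BS.

Lemma bs_congP (u v : bs_word) : bs_cong u v <-> \pi_BS u = \pi_BS v.
Proof.
split; first by move=> uv; apply/eqquotP/asboolP.
by move=> /eqquotP/asboolP.
Qed.

Lemma bs_repr (u : bs_word) : bs_cong (repr (\pi_BS u)) u.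
Proof. by apply/bs_congP; rewrite reprK. Qed.

Definition bs_one : BS := \pi_BS [::].
Definition bs_mul (x y : BS) : BS := \pi_BS (repr x ++ repr y).
Definition bs_inv (x : BS) : BS := \pi_BS (bs_winv (repr x)).

Lemma bs_mulE (u v : bs_word) : bs_mul (\pi_BS u) (\pi_BS v) = \pi_BS (u ++ v).
Proof. by apply/bs_congP; apply: bs_cat; exact: bs_repr. Qed.

Lemma bs_winv_cat (u v : bs_word) : bs_winv (u ++ v) = bs_winv v ++ bs_winv u.
Proof. by rewrite /bs_winv map_cat rev_cat. Qed.

Lemma bs_winvK : involutive bs_winv.
Proof.
move=> u; rewrite /bs_winv map_rev revK -map_comp map_id_in // => -[g s] _ /=.
by rewrite negbK.
Qed.

Lemma bs_cong_winvr (u : bs_word) : bs_cong (u ++ bs_winv u) [::].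
Proof.
elim: u => [|[g s] u IH]; first exact: bs_refl.
rewrite -cat1s bs_winv_cat -!catA.
apply: (@bs_trans ([:: (g, s)] ++ bs_winv [:: (g, s)])); last exact: bs_cancel.
apply: bs_cat; first exact: bs_refl.
by rewrite catA -[X in bs_cong _ X]cat0s; apply: bs_cat => //; exact: bs_refl.
Qed.

Lemma bs_cong_winvl (u : bs_word) : bs_cong (bs_winv u ++ u) [::].
Proof. by rewrite -{2}(bs_winvK u); exact: bs_cong_winvr. Qed.

Fact bs_mulA : associative bs_mul.
Proof.
elim/quotW=> u; elim/quotW=> v; elim/quotW=> w.
by rewrite (bs_mulE u v) (bs_mulE v w) (bs_mulE u (v ++ w)) bs_mulE catA.
Qed.

Fact bs_mul1g : left_id bs_one bs_mul.
Proof. by elim/quotW=> u; rewrite bs_mulE. Qed.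

Fact bs_mulg1 : right_id bs_one bs_mul.
Proof. by elim/quotW=> u; rewrite bs_mulE cats0. Qed.

Fact bs_mulVg : left_inverse bs_one bs_inv bs_mul.
Proof.
move=> x; rewrite -[X in bs_mul _ X]reprK bs_mulE.
by apply/bs_congP; exact: bs_cong_winvl.
Qed.

Fact bs_mulgV : right_inverse bs_one bs_inv bs_mul.
Proof.
move=> x; rewrite -[X in bs_mul X _]reprK bs_mulE.
by apply/bs_congP; exact: bs_cong_winvr.
Qed.

HB.instance Definition _ :=
  isGroup.Build BS bs_mulA bs_mul1g bs_mulg1 bs_mulVg bs_mulgV.

Definition bs_a : BS := \pi_BS [:: (true, false)].
Definition bs_b : BS := \pi_BS [:: (false, false)].

Lemma bs_bX (n : nat) : (bs_b ^+ n)%g = \pi_BS (nseq n (false, false)).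
Proof.
elim: n => [//|n IH]; rewrite expgS IH.
exact: (bs_mulE [:: (false, false)]).
Qed.

Lemma bs_rel : (bs_a * bs_b ^+ c = bs_b ^+ d * bs_a)%g.
Proof.
rewrite !bs_bX [LHS]bs_mulE [RHS]bs_mulE; apply/bs_congP.
by rewrite cats1; exact: bs_relator.
Qed.

Definition bs_wtheta (w : bs_word) : int :=
  \sum_(l <- w) (if l.1 then (-1) ^+ l.2 else 0).

Definition bs_theta (x : BS) : int := bs_wtheta (repr x).

Lemma bs_wtheta_cong (u v : bs_word) :
  bs_cong u v -> bs_wtheta u = bs_wtheta v.
Proof.
elim=> {u v} [//|//|v u w _ -> //|u u' v v' _ Eu _ Ev|g s|].
- by rewrite /bs_wtheta !big_cat /= -/(bs_wtheta _) Eu -/(bs_wtheta v) Ev.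
- rewrite /bs_wtheta !big_cons !big_nil /=.
  by case: g; case: s; rewrite // ?expr0 ?expr1.
- have E n : bs_wtheta (nseq n (false, false)) = 0.
    by rewrite /bs_wtheta big_nseq /=; elim: n => //= n ->; rewrite addr0.
  rewrite /bs_wtheta -cats1 big_cons big_cat big_cons big_nil /=.
  by rewrite -!/(bs_wtheta _) !E addr0 add0r.
Qed.

Lemma bs_thetaM (x y : BS) : bs_theta (x * y)%g = bs_theta x + bs_theta y.
Proof.
rewrite /bs_theta (bs_wtheta_cong (bs_repr _)).
by rewrite /bs_wtheta big_cat.
Qed.

Lemma bs_theta_a : bs_theta bs_a = 1.
Proof.
by rewrite /bs_theta (bs_wtheta_cong (bs_repr _)) /bs_wtheta big_seq1.
Qed.

Lemma bs_theta_b : bs_theta bs_b = 0.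
Proof.
by rewrite /bs_theta (bs_wtheta_cong (bs_repr _)) /bs_wtheta big_seq1.
Qed.

Inductive bs_pos : BS -> Prop :=
| bs_pos1 : bs_pos 1%g
| bs_posa : bs_pos bs_a
| bs_posb : bs_pos bs_b
| bs_posM x y : bs_pos x -> bs_pos y -> bs_pos (x * y)%g.

End BaumslagSolitar.

Section QuasiLattice.
Variables (G : groupType) (P : set G).

Definition qle (g h : G) : Prop := P (g^-1 * h)%g.

Definition common_ub (x y z : G) : Prop := [/\ P z, qle x z & qle y z].

Definition is_join (x y z : G) : Prop :=
  common_ub x y z /\ forall w, common_ub x y w -> qle z w.

End QuasiLattice.

Declare Scope cstar_scope.
Delimit Scope cstar_scope with cstar.
Local Open Scope cstar_scope.

Reserved Notation "X ** Y" (at level 40, left associativity).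

(* The product and unit are own operations: the hierarchy has no common
   structure between rings and normed modules except number domains, so the
   join of algType and completeNormedModType cannot be declared. *)
HB.mixin Record isCStarAlgebra (R : realType) A
    & CompleteNormedModule R[i] A := {
  cmul : A -> A -> A;
  cone : A;
  adj : A -> A;
  cmulA : associative cmul;
  cmul1l : left_id cone cmul;
  cmul1r : right_id cone cmul;
  cmul_linearl : forall Y : A, linear (cmul^~ Y);
  cmul_linearr : forall X : A, linear (cmul X);
  adj_antilinear : forall (z : R[i]) (X Y : A),
    adj (z *: X + Y) = z^* *: adj X + adj Y;
  adjM : forall X Y : A, adj (cmul X Y) = cmul (adj Y) (adj X);
  adjK : involutive adj;
  cstar_normM : forall X Y : A, `|cmul X Y| <= `|X| * `|Y|;
  cstar_norm : forall X : A, `|cmul (adj X) X| = `|X| ^+ 2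
}.

#[short(type="cstarAlgType")]
HB.structure Definition CStarAlgebra (R : realType) :=
  {A of isCStarAlgebra R A & CompleteNormedModule R[i] A}.

Notation "X ** Y" := (cmul X Y) : cstar_scope.

Section CStar.
Variable R : realType.
Implicit Types A B : cstarAlgType R.

Definition cpow A (X : A) (n : nat) : A := iter n (cmul X) cone.

Record star_hom A B (f : A -> B) : Prop := StarHom {
  star_hom_linear : linear f;
  star_homM : {morph f : X Y / X ** Y};
  star_hom1 : f cone = cone;
  star_hom_adj : {morph f : X / adj X}
}.

Definition cstar_subalgebra A (B : set A) : Prop :=
  [/\ B cone,
      forall (z : R[i]) X Y, B X -> B Y -> B (z *: X + Y),
      forall X Y, B X -> B Y -> B (X ** Y),
      forall X, B X -> B (adj X) & closed B].

Definition generates A (E : set A) : Prop :=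
  forall B : set A, cstar_subalgebra B -> E `<=` B -> B = setT.

Definition is_state A (phi : A -> R[i]) : Prop :=
  [/\ scalar phi, forall X, 0 <= phi (adj X ** X) & phi cone = 1].

(* The weak* topology on states is the topology of pointwise convergence. *)
Definition states A : set {ptws A -> R[i]} := [set phi | is_state phi].

End CStar.

Section SemigroupAlgebra.
Variables (R : realType) (G : groupType) (P : set G).

(* A representation of P is a function on G of which only the values on P
   matter. *)
Record nica_covariant (B : cstarAlgType R) (S : G -> B) : Prop := NicaCovariant {
  nica_isometry : forall x, P x -> adj (S x) ** S x = cone;
  nica1 : S 1%g = cone;
  nicaM : forall x y, P x -> P y -> S (x * y)%g = S x ** S y;
  nica_join : forall x y z, P x -> P y -> is_join P x y z ->
    (S x ** adj (S x)) ** (S y ** adj (S y)) = S z ** adj (S z);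
  nica_disjoint : forall x y, P x -> P y -> (forall z, ~ common_ub P x y z) ->
    (S x ** adj (S x)) ** (S y ** adj (S y)) = 0
}.

Record is_semigroup_algebra (A : cstarAlgType R) (T : G -> A) : Prop :=
  IsSemigroupAlgebra {
  sgalg_nica : nica_covariant T;
  sgalg_gen : generates (T @` P);
  sgalg_univ : forall (B : cstarAlgType R) (S : G -> B), nica_covariant S ->
    exists pi : A -> B, star_hom pi /\ forall x, P x -> pi (T x) = S x
}.

End SemigroupAlgebra.

Section Dynamics.
Variables (R : realType) (G : groupType) (P : set G) (theta : G -> int).
Variables (A : cstarAlgType R) (T : G -> A).

Definition cis (t : R) : R[i] := cos t +i* sin t.

Record is_dynamics (alpha : R -> A -> A) : Prop := IsDynamics {
  dyn_star_hom : forall t, star_hom (alpha t);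
  dyn0 : forall X, alpha 0 X = X;
  dynD : forall s t X, alpha (s + t) X = alpha s (alpha t X);
  dyn_continuous : forall X, continuous (fun t => alpha t X);
  dyn_gen : forall t x, P x -> alpha t (T x) = cis (t * (theta x)%:~R) *: T x
}.

Definition is_kms (beta : R) (psi : A -> R[i]) : Prop :=
  is_state psi /\
  forall x y p q, P x -> P y -> P p -> P q ->
    psi ((T x ** adj (T y)) ** (T p ** adj (T q))) =
    (expR (- beta * (theta x - theta y)%:~R))%:C *
      psi ((T p ** adj (T q)) ** (T x ** adj (T y))).

Definition is_kms_infty (psi : A -> R[i]) : Prop :=
  exists (beta : nat -> R) (psi_ : nat -> A -> R[i]),
    [/\ forall n, beta n != 0,
        forall n, is_kms (beta n) (psi_ n),
        beta @ \oo --> +oo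
      & psi_ @ \oo --> (psi : {ptws A -> R[i]})].

Variable alpha : R -> A -> A.

(* f is the (unique) entire extension z |-> alpha_z(Y) of t |-> alpha_t(Y). *)
Definition entire_orbit (Y : A) (f : R[i] -> A) : Prop :=
  (forall z, derivable f z 1) /\ forall t : R, f t%:C = alpha t Y.

Definition analytic (X : A) : Prop := exists f, entire_orbit X f.

Definition is_ground (phi : A -> R[i]) : Prop :=
  is_state phi /\
  forall X Y f, analytic X -> entire_orbit Y f ->
    exists M : R, forall z, 0 < complex.Im z -> `|phi (X ** f z)| <= M%:C.

Definition ground_states : set {ptws A -> R[i]} := [set phi | is_ground phi].

End Dynamics.

Section Toeplitz.
Variable R : realType.

Definition ell2 : set (nat -> R[i]) :=
  [set x : nat -> R[i] | cvgn (series (fun n => `|x n| ^+ 2))].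

Definition ell2_dot (x y : nat -> R[i]) : R[i] :=
  limn (series (fun n => x n * (y n)^*)).

Definition unilateral_shift (x : nat -> R[i]) : nat -> R[i] :=
  fun n => if n is m.+1 then x m else 0.

(* A faithful unital *-representation of A by bounded operators on ell2; the
   operator of X is the restriction of pi X to ell2. *)
Record faithful_ell2_rep (A : cstarAlgType R)
    (pi : A -> (nat -> R[i]) -> (nat -> R[i])) : Prop := FaithfulEll2Rep {
  rep_ell2 : forall X x, ell2 x -> ell2 (pi X x);
  rep_linear : forall X z x y, ell2 x -> ell2 y ->
    pi X (z *: x + y) = z *: pi X x + pi X y;
  rep_bounded : forall X, exists M : R, forall x, ell2 x ->
    ell2_dot (pi X x) (pi X x) <= M%:C * ell2_dot x x;
  repD : forall z X Y x, ell2 x -> pi (z *: X + Y) x = z *: pi X x + pi Y x;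
  repM : forall X Y x, ell2 x -> pi (X ** Y) x = pi X (pi Y x);
  rep1 : forall x, ell2 x -> pi cone x = x;
  rep_adj : forall X x y, ell2 x -> ell2 y ->
    ell2_dot (pi X x) y = ell2_dot x (pi (adj X) y);
  rep_faithful : forall X, (forall x, ell2 x -> pi X x = 0) -> X = 0
}.

(* (A, S) is, up to isomorphism, the C*-algebra of operators on ell2 generated
   by the unilateral shift. *)
Definition is_toeplitz (A : cstarAlgType R) (S : A) : Prop :=
  generates [set S] /\
  exists pi, faithful_ell2_rep pi /\
    forall x, ell2 x -> pi S x = unilateral_shift x.

Definition circle : set R[i] := [set z | `|z| = 1].

Definition circle_functions := continuousType circle R[i].

(* The operations of C(T) are the pointwise ones; these conditions determine q
   since S generates A. *)
Record is_symbol_map (A : cstarAlgType R) (S : A)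
    (q : A -> circle_functions) : Prop := IsSymbolMap {
  symbol_linear : forall a X Y z, q (a *: X + Y) z = a * q X z + q Y z;
  symbol1 : forall z, q cone z = 1;
  symbolM : forall X Y z, q (X ** Y) z = q X z * q Y z;
  symbol_adj : forall X z, q (adj X) z = (q X z)^*;
  symbol_gen : forall z, q S z = \val z
}.

End Toeplitz.

(* When q is the symbol map, which is onto, a g as below is automatically a state
   if f is one. *)
Definition factors_through (X Y Z : Type) (q : X -> Y) (f : X -> Z) : Prop :=
  exists g : Y -> Z, f = g \o q.

Section Affine.
Variable R : realType.

Definition mix (X : Type) (s : R) (f g : X -> R[i]) : X -> R[i] :=
  fun x => s%:C * f x + (1 - s)%:C * g x.

Definition functional_convex (X : Type) (K : set (X -> R[i])) : Prop :=
  forall f g (s : R), K f -> K g -> 0 <= s <= 1 -> K (mix s f g).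

(* An isomorphism of convex sets of functionals with their weak* topologies:
   an affine homeomorphism of K onto L. *)
Definition affine_isomorphism (X Y : Type)
    (K : set {ptws X -> R[i]}) (L : set {ptws Y -> R[i]})
    (F : {ptws X -> R[i]} -> {ptws Y -> R[i]}) : Prop :=
  [/\ set_bij K L F,
      forall f g (s : R), K f -> K g -> 0 <= s <= 1 ->
        F (mix s f g) = mix s (F f) (F g),
      {within K, continuous F}
    & exists H : {ptws Y -> R[i]} -> {ptws X -> R[i]},
        {within L, continuous H} /\ {in K, cancel F H}].

End Affine.

(* Main.v *)
(* The ground states turn out to be the states psi that vanish on T_x T_y^* unless
   theta x = theta y = 0. If psi is such a state and X is homogeneous of degree -k,
   then psi (X alpha_z(Y)) = e^(i k z) psi (X Y), by the identity theorem; for k < 0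
   the right-hand side is 0, and components of different degrees are orthogonal,
   so Cauchy-Schwarz bounds psi (X alpha_z(Y)) on the upper half-plane. Conversely
   the orbit of T_y^* grows exponentially there when theta y > 0.

   Such a state is determined by its values on T_b^s T_b^*^t, and states of the
   Toeplitz algebra by their values on S^s S^*^t. To move a state phi of an algebra
   D with an isometry V to an algebra E with matrix coefficients F m n, one takes a
   cluster point, as N grows, of the functionals
     \sum_(m, n) phi (x_m^* x_n) F m n,   x_n = (1 - V V^* ) V^*^n for n < N,
   corrected by the same sum for the vectors N^(-1/2) V^(N-i) V^*^N, i < N. Applied
   in both directions, with coefficients from the regular representation of P and
   from the shift, this gives the bijection of states.

   A state omega of the Toeplitz algebra factors through the symbol map if and only
   if omega (S^n S^*^n) = 1 for all n, which is inherited from the KMS condition. In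
   that case omega is a limit of Fejer means, which are convex combinations of point
   evaluations of the symbol at the 2N-th roots of unity, and psi = psi_omega is a
   limit of KMS states: with phi_0 = psi and
     phi_(k+1) (X) = \sum_(i < d) phi_k (T_(b^i a)^* X T_(b^i a)),
   the normalized sums of e^(- beta k) phi_k have cluster points which are KMS_beta
   states, and these tend to psi as beta grows. *)
Require Import Defs.
From HB Require Import structures.
From mathcomp Require Import all_boot all_order all_algebra complex.
From mathcomp Require Import all_classical all_reals all_analysis.
From mathcomp Require Import cyclic separable cyclotomic.
From mathcomp Require Import ring lra zify.

Set Implicit Arguments.
Unset Strict Implicit.
Unset Printing Implicit Defensive.

Import Order.TTheory GRing.Theory Num.Theory.
Import numFieldNormedType.Exports.

(** Behind the transfer of states lies the Wold decomposition of V. The vectors x_n account for the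
    part on which V is a shift, through a telescoping sum; the correcting vectors account for the
    part on which V is unitary, where averaging over N of them leaves a boundary error of order 1 /
    N. The functionals are positive because a Gram matrix over D is paired with a Gram matrix over
    E. Coefficients over the semigroup algebra require a concrete representation: P is enumerated,
    bounded matrices are shown to form a C*-algebra, and the universal property is applied to the
    regular representation in it. Computations in BS(c, d) rest on an action of the group on an
    explicit set, which separates the powers of b and reads off, modulo d, the power of b in front
    of the first a. This yields the join of b and a and the disjointness of a and b^s a for 0 < s <
    d; by these two relations every product T_y^* T_p either vanishes or takes the form T_u
    T_v^*. *)

Local Open Scope classical_set_scope.
Local Open Scope ring_scope.
Local Open Scope complex_scope.
Local Open Scope cstar_scope.

(** * Limits of complex numbers *)

Section ComplexTopology.
Variable R : realType.
Local Notation C := R[i].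
Implicit Types (z w : C).

Lemma ReD z w : complex.Re (z + w) = complex.Re z + complex.Re w.
Proof. by case: z w => [a b] []. Qed.

Lemma ImD z w : complex.Im (z + w) = complex.Im z + complex.Im w.
Proof. by case: z w => [a b] []. Qed.

Lemma ReB z w : complex.Re (z - w) = complex.Re z - complex.Re w.
Proof. by case: z w => [a b] []. Qed.

Lemma ImB z w : complex.Im (z - w) = complex.Im z - complex.Im w.
Proof. by case: z w => [a b] []. Qed.

Lemma normc_ge_Im z : `|complex.Im z|%:C <= `|z|.
Proof.
rewrite normc_def lecR -[leLHS]sqrtr_sqr ler_wsqrtr//.
by rewrite lerDr sqr_ge0.
Qed.

Lemma normc_le_ReIm z : `|z| <= (`|complex.Re z| + `|complex.Im z|)%:C.
Proof.
rewrite {1}[z]complexE (le_trans (ler_normD _ _))//.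
rewrite normrM [X in _ + X * _](_ : _ = 1) ?mul1r; last first.
  by rewrite normc_def /= expr0n /= add0r expr1n sqrtr1.
by rewrite !normc_def /= expr0n /= !addr0 !sqrtr_sqr rmorphD.
Qed.

Lemma cvg_complexP T (F : set_system T) {FF : Filter F} (f : T -> C) z :
  f @ F --> z <-> ((fun t => complex.Re (f t)) @ F --> complex.Re z) /\
                  ((fun t => complex.Im (f t)) @ F --> complex.Im z).
Proof.
split=> [fz|[fR fI]].
  split; apply/cvgrPdist_lt => e e0; have := e0; rewrite -ltcR => e0';
    move/cvgrPdist_lt: fz => /(_ _ e0'); apply: filterS => t;
    rewrite -ltcR; apply: le_lt_trans.
    by rewrite -ReB; exact: normc_ge_Re.
  by rewrite -ImB; exact: normc_ge_Im.
apply/cvgrPdist_lt => e; rewrite ltcE /= => /andP[/eqP Ie e0].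
have eE : e = (complex.Re e)%:C by case: e Ie {e0} => a b /= ->.
have e20 : 0 < complex.Re e / 2 by rewrite divr_gt0.
move/cvgrPdist_lt: fR => /(_ _ e20) fR; move/cvgrPdist_lt: fI => /(_ _ e20) fI.
near=> t.
have tR : `|complex.Re z - complex.Re (f t)| < complex.Re e / 2.
  by near: t; exact: fR.
have tI : `|complex.Im z - complex.Im (f t)| < complex.Re e / 2.
  by near: t; exact: fI.
apply: le_lt_trans (normc_le_ReIm _) _.
by rewrite eE [complex.Re e]splitr ltcR ltrD// ?ReB ?ImB.
Unshelve. all: by end_near. Qed.

Lemma continuous_Re : continuous (@complex.Re R).
Proof. move=> z; have : id @ z --> z by exact: cvg_id.
by move/cvg_complexP => [].
Qed.

Lemma continuous_Im : continuous (@complex.Im R).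
Proof. move=> z; have : id @ z --> z by exact: cvg_id.
by move/cvg_complexP => [].
Qed.

Lemma complex_complete (F : set_system C) : ProperFilter F -> cauchy F -> cvg F.
Proof.
move=> FF /cauchy_ballP Fc.
have cR : cvg (@complex.Re R @ F).
  apply: cauchy_cvg; apply/cauchy_ballP => e e0.
  have := Fc e%:C; rewrite ltcR => /(_ e0) [[A B] [/= FA FB] AB].
  exists (@complex.Re R @` A, @complex.Re R @` B) => /=.
    by split; [apply: filterS FA|apply: filterS FB] => z ?; exists z.
  move=> [_ _] [/= [z Az <-] [w Bw <-]].
  rewrite /ball /= -ltcR -ReB (le_lt_trans (normc_ge_Re _))//.
  exact: (AB (z, w)).
have cI : cvg (@complex.Im R @ F).
  apply: cauchy_cvg; apply/cauchy_ballP => e e0.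
  have := Fc e%:C; rewrite ltcR => /(_ e0) [[A B] [/= FA FB] AB].
  exists (@complex.Im R @` A, @complex.Im R @` B) => /=.
    by split; [apply: filterS FA|apply: filterS FB] => z ?; exists z.
  move=> [_ _] [/= [z Az <-] [w Bw <-]].
  rewrite /ball /= -ltcR -ImB (le_lt_trans (normc_ge_Im _))//.
  exact: (AB (z, w)).
apply/cvg_ex; exists (lim (@complex.Re R @ F) +i* lim (@complex.Im R @ F)).
suff : id @ F --> lim (@complex.Re R @ F) +i* lim (@complex.Im R @ F) by [].
by apply/cvg_complexP; split; [exact: cR|exact: cI].
Qed.

HB.instance Definition _ := Uniform_isComplete.Build C complex_complete.


Lemma closed_complex_ge0 : closed [set z : C | 0 <= z].
Proof.
have -> : [set z : C | 0 <= z] =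
    (@complex.Im R @^-1` [set 0]) `&` (@complex.Re R @^-1` [set x | 0 <= x]).
  apply/seteqP; split=> z /=; rewrite lecE /=; first by case/andP => /eqP ->.
  by case=> -> ->; rewrite eqxx.
apply: closedI; apply: preimage_closed.
- by move=> z _; exact: continuous_Im.
- exact: closed_eq.
- by move=> z _; exact: continuous_Re.
- exact: closed_ge.
Qed.

Lemma cvg_complex_ge0 T (F : set_system T) {FF : ProperFilter F} (f : T -> C) z :
  f @ F --> z -> (\forall t \near F, 0 <= f t) -> 0 <= z.
Proof.
move=> fz f0.
exact: (@closed_cvg _ _ F FF f (fun z => 0 <= z) closed_complex_ge0 f0 z fz).
Qed.

Section LimitOperations.
Variables (T : Type) (F : set_system T) (FF : Filter F).
Variables (f g : T -> C) (z w : C).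
Hypotheses (fz : f @ F --> z) (gw : g @ F --> w).

Lemma cvg_complexD : (fun t => f t + g t) @ F --> z + w.
Proof. exact: (cvgD fz gw). Qed.

Lemma cvg_complexB : (fun t => f t - g t) @ F --> z - w.
Proof. exact: (cvgB fz gw). Qed.

Lemma cvg_complexM : (fun t => f t * g t) @ F --> z * w.
Proof. exact: (cvgM fz gw). Qed.

Lemma cvg_complex_norm : (fun t => `|f t|) @ F --> `|z|.
Proof. exact: (cvg_norm fz). Qed.

Lemma cvg_complex_conj : (fun t => (f t)^*) @ F --> z^*.
Proof.
move/cvg_complexP: fz => [fR fI]; apply/cvg_complexP; split.
  have -> : (fun t => complex.Re (f t)^*) = (fun t => complex.Re (f t)).
    by apply/funext => t; case: (f t).
  by move: fR; case: (z).
have -> : (fun t => complex.Im (f t)^*) = (fun t => - complex.Im (f t)).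
  by apply/funext => t; case: (f t).
have -> : complex.Im z^* = - complex.Im z by case: (z).
exact: (cvgN fI).
Qed.

End LimitOperations.

Lemma cvg_complex_le T (F : set_system T) {FF : ProperFilter F}
    (f g : T -> C) z w :
  f @ F --> z -> g @ F --> w -> (\forall t \near F, f t <= g t) -> z <= w.
Proof.
move=> fz gw fg; rewrite -subr_ge0.
apply: (cvg_complex_ge0 (cvg_complexB _ gw fz)).
by apply: filterS fg => t; rewrite subr_ge0.
Qed.

Lemma closed_disc (r : C) : closed [set z : C | `|z| <= r].
Proof.
have -> : [set z : C | `|z| <= r] = (fun z => r - `|z|) @^-1` [set z | 0 <= z].
  by apply/seteqP; split=> z /=; rewrite subr_ge0.
apply: preimage_closed closed_complex_ge0 => z _ /=.
have cn : `|x| @[x --> z] --> `|z| by exact: norm_continuous.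
exact: (cvg_complexB _ (cvg_cst r) cn).
Qed.

Lemma compact_disc (r : C) : compact [set z : C | `|z| <= r].
Proof.
have [r0|r0] := boolP (0 <= r); last first.
  have -> : [set z : C | `|z| <= r] = set0.
    rewrite -subset0 => z /= /(le_trans (normr_ge0 _)).
    by rewrite (negbTE r0).
  exact: compact0.
pose s := complex.Re r.
have rE : r = s%:C by apply/esym/RRe_real/ger0_real.
have cK : compact (`[- s, s] `*` `[- s, s])%classic.
  by apply: compact_setX; exact: segment_compact.
have cf : continuous (fun p : R * R => p.1 +i* p.2).
  move=> p; apply/cvg_complexP; split; [exact: cvg_fst|exact: cvg_snd].
have fK := continuous_compact (continuous_subspaceT cf) cK.
apply: (subclosed_compact _ fK).
  exact: closed_disc.
move=> z; rewrite /= rE => zs; exists (complex.Re z, complex.Im z); last by case: z {zs}.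
split; rewrite /= in_itv /= -ler_norml -lecR (le_trans _ zs)//.
  exact: normc_ge_Re.
exact: normc_ge_Im.
Qed.

End ComplexTopology.
Arguments cvg_complexD {R T F FF f g z w}.
Arguments cvg_complexB {R T F FF f g z w}.
Arguments cvg_complexM {R T F FF f g z w}.
Arguments cvg_complex_norm {R T F FF f z}.
Arguments cvg_complex_conj {R T F FF f z}.

(** * Goursat's lemma and the identity theorem *)

Section Primitive.
Variable R : realType.
Implicit Types (f u q U Q : R -> R) (a e s t x : R).

(** The primitive is an integral starting at a, so it is controlled only to the right of a; in what
    follows a is a bound to the left of and below all rectangles. *)
Lemma exists_primitive a f : continuous f ->
  exists F, forall x, a < x -> is_derive x (1 : R) F (f x).
Proof.
move=> cf; exists (fun x => \int[lebesgue_measure]_(t in `[a, x]) f t) => x ax.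
have xx : x < x + 1 by rewrite ltrDl.
have fi : (@lebesgue_measure R).-integrable `[a, x + 1] (EFin \o f).
  apply: continuous_compact_integrable; first exact: segment_compact.
  exact: continuous_subspaceT.
have [df <-] := continuous_FTC1_closed xx fi ax (cf x).
by rewrite derive1E; apply/derivableP.
Qed.

(** The mean value theorem for [U - Q] replaces the estimate of an integral of [u - q]. *)
Lemma primitive_dist a u U q Q e s t : a < s -> s <= t ->
  (forall x, a < x -> is_derive x (1 : R) U (u x)) ->
  (forall x, is_derive x (1 : R) Q (q x)) ->
  (forall x, s <= x <= t -> `|u x - q x| <= e) ->
  `|(U t - U s) - (Q t - Q s)| <= e * (t - s).
Proof.
move=> as_ st dU dQ uq.
have dUQ x : a < x -> is_derive x (1 : R) (U - Q) (u x - q x).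
  by move=> ax; have := dU _ ax; have := dQ x => ? ?; exact: is_deriveB.
have cUQ : {within `[s, t], continuous (U - Q)}.
  apply: derivable_within_continuous => x; rewrite in_itv /= => /andP[sx _].
  by have [] := dUQ x (lt_le_trans as_ sx).
have [|x xst E] := MVT_segment st _ cUQ (df := fun x => u x - q x).
  move=> x; rewrite in_itv /= => /andP[sx _].
  by apply: dUQ; exact: lt_trans sx.
have -> : U t - U s - (Q t - Q s) = (U - Q) t - (U - Q) s.
  by rewrite !fctE; ring.
rewrite E normrM [X in _ * X]ger0_norm ?subr_ge0// ler_wpM2r ?subr_ge0//.
exact: uq.
Qed.

Lemma primitive_ge a u U e s t : a < s -> s <= t ->
  (forall x, a < x -> is_derive x (1 : R) U (u x)) ->
  (forall x, s <= x <= t -> e <= u x) -> e * (t - s) <= U t - U s.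
Proof.
move=> as_ st dU eu.
have cU : {within `[s, t], continuous U}.
  apply: derivable_within_continuous => x; rewrite in_itv /= => /andP[sx _].
  by have [] := dU x (lt_le_trans as_ sx).
have [|x xst ->] := MVT_segment st _ cU (df := u).
  move=> x; rewrite in_itv /= => /andP[sx _].
  by apply: dU; exact: lt_trans sx.
by rewrite ler_wpM2r ?subr_ge0//; exact: eu.
Qed.

End Primitive.

Section Contour.
Variable R : realType.
Local Notation C := R[i].
Variables (K : C -> C) (a : R) (H V : R -> R -> R).
Hypothesis dH : forall y x, a < x -> is_derive x (1 : R) (H y) (complex.Im (K (x +i* y))).
Hypothesis dV : forall x y, a < y -> is_derive y (1 : R) (V x) (complex.Re (K (x +i* y))).

(* The imaginary part of the integral of K along the boundary of
   [x1, x2] x [y1, y2], where H and V are primitives of Im K and Re K along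
   horizontal and vertical lines. *)
Definition contour (x1 x2 y1 y2 : R) : R :=
  (H y1 x2 - H y1 x1) - (H y2 x2 - H y2 x1) +
  ((V x2 y2 - V x2 y1) - (V x1 y2 - V x1 y1)).

(** An affine function has a quadratic primitive and contributes 0 to the contour; the remainder
    contributes at most e times the perimeter. *)
Lemma contour_affine_le (b c : C) (e x1 x2 y1 y2 : R) :
  a < x1 -> x1 <= x2 -> a < y1 -> y1 <= y2 ->
  (forall x y, x1 <= x <= x2 -> y1 <= y <= y2 ->
    `|K (x +i* y) - (b + c * (x +i* y))| <= e%:C) ->
  `|contour x1 x2 y1 y2| <= e * (2 * ((x2 - x1) + (y2 - y1))).
Proof.
case: b c => [br bi] [cr ci] ax x12 ay y12 Kbc.
have hH y : y1 <= y <= y2 -> `|(H y x2 - H y x1) - ((bi + cr * y) * (x2 - x1) +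
    ci * (x2 ^+ 2 - x1 ^+ 2) / 2)| <= e * (x2 - x1).
  move=> yy.
  pose Q x := (bi + cr * y) * x + ci * x ^+ 2 / 2.
  have := @primitive_dist R a _ _ (fun x => bi + cr * y + ci * x) Q e _ _ ax x12 (dH y).
  rewrite (_ : Q x2 - Q x1 = (bi + cr * y) * (x2 - x1) +
    ci * (x2 ^+ 2 - x1 ^+ 2) / 2); last by rewrite /Q; field.
  apply=> //.
    move=> x; apply: is_derive_eq; rewrite ?scaler0 /GRing.scale /=; field => //.
  move=> x xx; rewrite -lecR (le_trans _ (Kbc x y xx yy))//.
  apply: le_trans (normc_ge_Im _).
  by rewrite ImB [complex.Im (_ + _)]/= lecR le_eqVlt; apply/orP; left; apply/eqP;
   congr (`|_ - _|); ring.
have hV x : x1 <= x <= x2 -> `|(V x y2 - V x y1) - ((br + cr * x) * (y2 - y1) -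
    ci * (y2 ^+ 2 - y1 ^+ 2) / 2)| <= e * (y2 - y1).
  move=> xx.
  pose Q y := (br + cr * x) * y - ci * y ^+ 2 / 2.
  have := @primitive_dist R a _ _ (fun y => br + cr * x - ci * y) Q e _ _ ay y12 (dV x).
  rewrite (_ : Q y2 - Q y1 = (br + cr * x) * (y2 - y1) -
    ci * (y2 ^+ 2 - y1 ^+ 2) / 2); last by rewrite /Q; field.
  apply=> //.
    move=> y; apply: is_derive_eq; rewrite ?scaler0 /GRing.scale /=; field => //.
  move=> y yy; rewrite -lecR (le_trans _ (Kbc x y xx yy))//.
  apply: le_trans (normc_ge_Re _).
  by rewrite ReB [complex.Re (_ + _)]/= lecR le_eqVlt; apply/orP; left; apply/eqP;
   congr (`|_ - _|); ring.
have h1 := hH y1; have h2 := hH y2; have h3 := hV x1; have h4 := hV x2.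
rewrite !lexx !x12 !y12 in h1 h2 h3 h4.
move/(_ isT): h1; rewrite ler_norml => /andP[h1 h1'].
move/(_ isT): h2; rewrite ler_norml => /andP[h2 h2'].
move/(_ isT): h3; rewrite ler_norml => /andP[h3 h3'].
move/(_ isT): h4; rewrite ler_norml => /andP[h4 h4'].
by rewrite ler_norml /contour; apply/andP; split; lra.
Qed.

Lemma contour_splitx x1 x x2 y1 y2 :
  contour x1 x2 y1 y2 = contour x1 x y1 y2 + contour x x2 y1 y2.
Proof. by rewrite /contour; ring. Qed.

Lemma contour_splity x1 x2 y1 y y2 :
  contour x1 x2 y1 y2 = contour x1 x2 y1 y + contour x1 x2 y y2.
Proof. by rewrite /contour; ring. Qed.

End Contour.

(** The intervals [x n, x n + w / 2^n] are nested, and the supremum of their left ends lies in all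
    of them. *)
Lemma nested_halving (R : realType) (x : nat -> R) (w : R) :
  (forall n, x n <= x n.+1 <= x n + w / 2 ^+ n.+1) ->
  exists l, forall n, x n <= l <= x n + w / 2 ^+ n.
Proof.
move=> xS.
have half n : w / 2 ^+ n = w / 2 ^+ n.+1 + w / 2 ^+ n.+1.
  by rewrite exprS invfM mulrCA mulrC; field; rewrite expf_neq0.
have ub n m : x m <= x n + w / 2 ^+ n.
  have incr p q : x p <= x (p + q)%N.
    elim: q => [|q IH]; first by rewrite addn0.
    by rewrite addnS (le_trans IH)//; case/andP: (xS (p + q)%N).
  have decr p q : x (p + q)%N + w / 2 ^+ (p + q) <= x p + w / 2 ^+ p.
    elim: q => [|q IH]; first by rewrite addn0.
    rewrite addnS (le_trans _ IH)// [in leRHS]half.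
    by case/andP: (xS (p + q)%N) => _ h; rewrite addrA lerD2r.
  have w0 p : 0 <= w / 2 ^+ p.
    by rewrite half addr_ge0//; case/andP: (xS p) => h1 h2; lra.
  have [nm|/ltnW mn] := leqP n m.
    rewrite -(subnKC nm) (le_trans _ (decr n (m - n)%N))//.
    by rewrite lerDl.
  rewrite -(subnKC mn) (le_trans (incr m (n - m)%N))//.
  by rewrite lerDl.
have xsup : has_sup (range x).
  by split; [exists (x 0); exists 0|exists (x 0 + w / 2 ^+ 0) => _ [m _ <-]].
exists (sup (range x)) => n; apply/andP; split.
  by apply: ub_le_sup; [case: xsup|exists n].
by apply: ge_sup; [case: xsup|move=> _ [m _ <-]].
Qed.

Section Goursat.
Variable R : realType.
Local Notation C := R[i].
Variables (K : C -> C) (a : R) (H V : R -> R -> R).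
Hypothesis dH : forall y x, a < x -> is_derive x (1 : R) (H y) (complex.Im (K (x +i* y))).
Hypothesis dV : forall x y, a < y -> is_derive y (1 : R) (V x) (complex.Re (K (x +i* y))).
Local Notation contour := (contour H V).

(** Quartering: one of four subrectangles keeps at least a quarter of the integral. At the common
    point of the nested rectangles K is affine up to e times the distance, so the n-th integral is
    at most e times diameter times perimeter, again of order 4^-n, which is a contradiction for
    small e. *)
Lemma goursat (x1 x2 y1 y2 : R) : a < x1 -> x1 < x2 -> a < y1 -> y1 < y2 ->
  (forall x y, x1 <= x <= x2 -> y1 <= y <= y2 ->
    exists c : C, forall e : R, 0 < e -> exists2 r : R, 0 < r & forall z : C,
      `|z - (x +i* y)| < r%:C ->
      `|K z - K (x +i* y) - c * (z - (x +i* y))| <= e%:C * `|z - (x +i* y)|) ->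
  contour x1 x2 y1 y2 = 0.
Proof.
move=> ax x12 ay y12 dK; apply/eqP/negPn/negP => /[dup] In0.
rewrite -normr_gt0; set I := `|_| => I0.
pose w := x2 - x1; pose h := y2 - y1.
have w0 : 0 < w by rewrite subr_gt0.
have h0 : 0 < h by rewrite subr_gt0.
(* Here p is the lower left corner of a rectangle of the n-th generation. *)
pose P n (p : R * R) := I / 4 ^+ n <=
  `|contour p.1 (p.1 + w / 2 ^+ n) p.2 (p.2 + h / 2 ^+ n)|.
have half (u : R) n : u / 2 ^+ n = u / 2 ^+ n.+1 + u / 2 ^+ n.+1.
  by rewrite exprS invfM; field; rewrite expf_neq0.
have step (np : nat * (R * R)) : exists p' : R * R, P np.1 np.2 ->
    [/\ P np.1.+1 p', np.2.1 <= p'.1 <= np.2.1 + w / 2 ^+ np.1.+1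
      & np.2.2 <= p'.2 <= np.2.2 + h / 2 ^+ np.1.+1].
  case: np => n [x y] /=; have [Pn|] := pselect (P n (x, y)); last by exists (x, y).
  move: Pn; rewrite {1}/P /= (half w n) (half h n).
  set w' := w / _; set h' := h / _; rewrite !addrA.
  have w'0 : 0 < w' by rewrite divr_gt0// exprn_gt0.
  have h'0 : 0 < h' by rewrite divr_gt0// exprn_gt0.
  rewrite (contour_splitx _ _ x (x + w')).
  rewrite (contour_splity _ _ x _ y (y + h')) (contour_splity _ _ (x + w') _ y (y + h')).
  set c1 := contour _ _ _ _; set c2 := contour _ _ _ _.
  set c3 := contour _ _ _ _; set c4 := contour _ _ _ _ => Ic.
  have I4 : I / 4 ^+ n = 4 * (I / 4 ^+ n.+1).
    by rewrite exprS invfM; field; rewrite expf_neq0.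
  have : [|| I / 4 ^+ n.+1 <= `|c1|, I / 4 ^+ n.+1 <= `|c2|,
      I / 4 ^+ n.+1 <= `|c3| | I / 4 ^+ n.+1 <= `|c4|].
    apply: contraT; rewrite !negb_or -!ltNge => /and4P[l1 l2 l3 l4].
    have := ler_normD (c1 + c2) (c3 + c4); have := ler_normD c1 c2.
    by have := ler_normD c3 c4; lra.
  case/or4P => Q; [exists (x, y)|exists (x, y + h')|exists (x + w', y)|
    exists (x + w', y + h')] => _; split; rewrite /P /= -/w' -/h' //;
    apply/andP; split; lra.
have [g gP] := choice step.
pose s := fix s n := if n is m.+1 then g (m, s m) else (x1, y1).
have sP n : P n (s n).
  elim: n => [|n IH]; last by have [] := gP (n, s n) IH.
  by rewrite /P /= !expr0 !divr1 /w /h ![_ + (_ - _)]addrC !subrK.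
have [l lP] : exists l, forall n, (s n).1 <= l <= (s n).1 + w / 2 ^+ n.
  by apply: nested_halving => n; have [] := gP (n, s n) (sP n).
have [m mP] : exists l, forall n, (s n).2 <= l <= (s n).2 + h / 2 ^+ n.
  by apply: nested_halving => n; have [] := gP (n, s n) (sP n).
have s1 n : x1 <= (s n).1 /\ (s n).1 + w / 2 ^+ n <= x2.
  elim: n => [|n [IH1 IH2]]; first by rewrite /= expr0 divr1 /w; split; lra.
  have [_ /andP[q1 q2] _] := gP (n, s n) (sP n).
  by move: IH2; rewrite half -/(s n.+1) => IH2; split; [exact: le_trans q1|lra].
have s2 n : y1 <= (s n).2 /\ (s n).2 + h / 2 ^+ n <= y2.
  elim: n => [|n [IH1 IH2]]; first by rewrite /= expr0 divr1 /h; split; lra.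
  have [_ _ /andP[q1 q2]] := gP (n, s n) (sP n).
  by move: IH2; rewrite half -/(s n.+1) => IH2; split; [exact: le_trans q1|lra].
have lx : x1 <= l <= x2.
  have := lP 0; rewrite /= expr0 divr1 => /andP[? ?].
  by apply/andP; split=> //; have wE : w = x2 - x1 by []; lra.
have my : y1 <= m <= y2.
  have := mP 0; rewrite /= expr0 divr1 => /andP[? ?].
  by apply/andP; split=> //; have hE : h = y2 - y1 by []; lra.
have [c cP] := dK _ _ lx my.
have wh0 : 0 < (w + h) ^+ 2 by rewrite exprn_gt0// addr_gt0.
(* With this e the bound of [contour_affine_le] on the n-th rectangle is half of I / 4^n. *)
pose e := I / (4 * (w + h) ^+ 2).
have e0 : 0 < e by rewrite divr_gt0// mulr_gt0.
have [r r0 rP] := cP e e0.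
have [n nr] : exists n, (w + h) / 2 ^+ n < r.
  have : (fun n => (w + h) * (1 / 2) ^+ n) @ \oo --> (0 : R).
    by apply: cvg_geometric; rewrite ger0_norm ?divr_ge0//; lra.
  move/cvgrPdist_lt => /(_ r r0)[n _ /(_ n (leqnn n)) /=].
  rewrite sub0r normrN expr_div_n expr1n mul1r => nr; exists n.
  exact: le_lt_trans (ler_norm _) nr.
have wn0 : 0 < w / 2 ^+ n by rewrite divr_gt0// exprn_gt0.
have hn0 : 0 < h / 2 ^+ n by rewrite divr_gt0// exprn_gt0.
have wh x y : (s n).1 <= x <= (s n).1 + w / 2 ^+ n ->
    (s n).2 <= y <= (s n).2 + h / 2 ^+ n ->
    `|(x +i* y) - (l +i* m)| <= ((w + h) / 2 ^+ n)%:C.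
  move=> /andP[? ?] /andP[? ?].
  apply: le_trans (normc_le_ReIm _) _; rewrite lecR /= mulrDl.
  case/andP: (lP n) => ? ?; case/andP: (mP n) => ? ?.
  by apply: lerD; rewrite ler_norml; apply/andP; split; lra.
have := @contour_affine_le R K a H V dH dV (K (l +i* m) - c * (l +i* m)) c
  (e * ((w + h) / 2 ^+ n)) (s n).1 ((s n).1 + w / 2 ^+ n)
  (s n).2 ((s n).2 + h / 2 ^+ n).
move=> /(_ (lt_le_trans ax (s1 n).1)); rewrite lerDl (ltW wn0) => /(_ isT).
move=> /(_ (lt_le_trans ay (s2 n).1)); rewrite lerDl (ltW hn0) => /(_ isT).
have e' : e * ((w + h) / 2 ^+ n) *
    (2 * ((s n).1 + w / 2 ^+ n - (s n).1 + ((s n).2 + h / 2 ^+ n - (s n).2))) =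
    I / 4 ^+ n / 2.
  rewrite /e (_ : 4 ^+ n = 2 ^+ n * 2 ^+ n); last by rewrite -exprMn; congr (_ ^+ _); ring.
  by field; rewrite expf_neq0//= addrC -(addrC w) gt_eqF// addr_gt0.
rewrite e' leNgt => /(_ _) /negP; apply.
  move=> x y xx yy.
  have := rP (x +i* y); rewrite (le_lt_trans (wh x y xx yy)) ?ltcR// => /(_ isT).
  rewrite (_ : _ - _ - _ = K (x +i* y) - (K (l +i* m) - c * (l +i* m) + c * (x +i* y))).
    move/le_trans; apply; rewrite [leRHS]rmorphM ler_wpM2l//; first by rewrite lecR ltW.
    exact: wh.
  by ring.
apply: lt_le_trans (sP n).
by rewrite ltr_pdivrMr// ltr_pMr ?ltr1n// divr_gt0// exprn_gt0.
Qed.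

End Goursat.

Lemma continuous_dist (K : numFieldType) (V W : normedModType K) (f : V -> W) x :
  (forall e, 0 < e -> exists2 r, 0 < r &
    forall z, `|z - x| < r -> `|f z - f x| <= e) -> {for x, continuous f}.
Proof.
move=> fP; apply/cvgrPdist_le => e /fP[r r0 rP].
have := nbhsx_ballx x r r0; rewrite -ball_normE.
by apply: filterS => z; rewrite /= distrC [X in _ -> X <= _]distrC; exact: rP.
Qed.

Section Approximation.
Variable K : numFieldType.
Implicit Types (f : K -> K) (c p z : K).

(** The increments along the direction 1 run through all of K, so [derivable f p 1] is
    differentiability in one variable over K; for complex numbers this is holomorphy. *)
Lemma derivable_approx f p : derivable f p 1 -> forall e, 0 < e ->
  exists2 r, 0 < r & forall z, `|z - p| < r ->
    `|f z - f p - 'D_1 f p * (z - p)| <= e * `|z - p|.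
Proof.
move=> fp e e0.
have /cvgrPdist_le /(_ _ e0) := fp.
rewrite near_withinE => -[d /= d0 dP].
exists d => // z zpd.
have [->|zp] := eqVneq z p; first by rewrite !subrr mulr0 subr0 normr0 mulr0.
have zp0 : z - p != 0 by rewrite subr_eq0.
have := dP (z - p); rewrite /= sub0r normrN => /(_ zpd zp0) h.
rewrite -ler_pdivrMr ?normr_gt0// -normf_div mulrBl mulfK//.
rewrite distrC (le_trans _ h)// le_eqVlt; apply/orP; left.
apply/eqP; congr (`|_ - _|).
by rewrite /GRing.scale /= mulr1 subrK mulrC.
Qed.

Lemma approx_continuous f p c :
  (exists2 r, 0 < r & forall z, `|z - p| < r ->
    `|f z - f p - c * (z - p)| <= `|z - p|) -> {for p, continuous f}.
Proof.
move=> [r r0 rP]; apply: continuous_dist => e e0.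
have c0 : 0 < 1 + `|c| by rewrite ltr_pwDl.
exists (Num.min r (e / (1 + `|c|))).
  by rewrite /Order.min; case: ifP => // _; rewrite divr_gt0.
move=> z zr; have [zr1 zr2] : `|z - p| < r /\ `|z - p| < e / (1 + `|c|).
  have cmp : r >=< e / (1 + `|c|).
    by apply: real_comparable; rewrite gtr0_real// divr_gt0.
  by apply/andP; rewrite -comparable_lt_min.
rewrite -(subrK (c * (z - p)) (f z - f p)).
rewrite (le_trans (ler_normD _ _))//.
rewrite ltr_pdivlMr// mulrC mulrDl mul1r in zr2.
by apply: le_trans (ltW zr2); rewrite normrM lerD2r rP.
Qed.

End Approximation.

Section Identity.
Variable R : realType.
Local Notation C := R[i].
Implicit Types (f g G : C -> C) (p z w : C).

Lemma gt0_complexE (e : C) : 0 < e -> e = (complex.Re e)%:C.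
Proof. by move=> e0; apply/esym/RRe_real/gtr0_real. Qed.

(** If G 0 = -1, then K z = (G z + 1) / z has a removable singularity at 0, so its contour over the
    square vanishes. But K z = 1 / z on the boundary, whose contour is positive (it would be 2
    pi). *)
Lemma square_center G (r : R) : 0 < r -> (forall z, derivable G z 1) ->
  (forall x y, `|x| <= r -> `|y| <= r -> `|x| = r \/ `|y| = r -> G (x +i* y) = 0) ->
  G 0 != -1.
Proof.
move=> r0 dG Gr; apply/negP => /eqP G0.
pose K z := if z == 0 then 'D_1 G 0 else (G z + 1) / z.
have aK p : p != 0 -> exists c, forall e : R, 0 < e ->
  exists2 s : R, 0 < s & forall z, `|z - p| < s%:C ->
    `|K z - K p - c * (z - p)| <= e%:C * `|z - p|.
  move=> p0; exists ('D_1 ((G \+ cst 1) \* (fun z => z^-1)) p) => e e0.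
  have dp : derivable ((G \+ cst 1) \* (fun z => z^-1)) p 1.
    apply: derivableM; first by apply: derivableD => //; exact: derivable_cst.
    by apply: derivableV => //; exact: derivable_id.
  have [s' s'0 sP'] := derivable_approx dp (e := e%:C) ltac:(by rewrite ltcR).
  pose s := complex.Re s'; have s'E : s' = s%:C by exact: gt0_complexE.
  have s0 : 0 < s by rewrite -ltcR -s'E.
  have sP := sP'; rewrite s'E in sP.
  have np : `|p| = (complex.Re `|p|)%:C by apply/esym/RRe_real/normr_real.
  exists (Num.min s (complex.Re `|p|)).
    by rewrite lt_min s0 -ltcR -np normr_gt0.
  move=> z zs.
  have zs' : `|z - p| < s%:C by rewrite (lt_le_trans zs)// lecR ge_min lexx.
  have zp : `|z - p| < `|p|.
    by rewrite (lt_le_trans zs)// np lecR ge_min lexx orbT.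
  have z0 : z != 0.
    by apply: contraTneq zp => ->; rewrite sub0r normrN ltxx.
  by rewrite /K (negbTE z0) (negbTE p0); exact: sP.
have aK0 : forall e : R, 0 < e -> exists2 s : R, 0 < s & forall z, `|z| < s%:C ->
    `|K z - K 0| <= e%:C.
  move=> e e0; have [s' s'0 sP] := derivable_approx (dG 0) (e := e%:C) ltac:(by rewrite ltcR).
  have s'E := gt0_complexE s'0.
  exists (complex.Re s'); first by rewrite -ltcR -s'E.
  move=> z; rewrite -s'E => zs; rewrite /K eqxx.
  have [_|z0] := eqVneq z 0; first by rewrite subrr normr0 lecR ltW.
  have := sP z; rewrite subr0 => /(_ zs); rewrite G0 opprK.
  rewrite -ler_pdivrMr ?normr_gt0// -normf_div.
  by rewrite mulrBl mulfK.
have cK : continuous K.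
  move=> p; have [->|p0] := eqVneq p 0; last first.
    have [c /(_ 1 ltr01) [s s0 sP]] := aK p p0.
    apply: (@approx_continuous _ K p c); exists s%:C; rewrite ?ltcR// => z /sP.
    by rewrite mul1r.
  apply: continuous_dist => e e0.
  have [|s s0 sP] := aK0 (complex.Re e); first by rewrite -ltcR -gt0_complexE.
  by exists s%:C; rewrite ?ltcR// => z; rewrite subr0 [e]gt0_complexE//; exact: sP.
pose a := - (r + 1).
have cline (f : R -> C) : (forall t, f x @[x --> t] --> f t) ->
    continuous (fun t => complex.Re (K (f t))) /\
    continuous (fun t => complex.Im (K (f t))).
  move=> cf; have cKf : continuous (K \o f).
    by move=> t; exact: (@continuous_comp _ _ _ f K t (cf t) (cK (f t))).
  split=> t.
    exact: (@continuous_comp _ _ _ (K \o f) _ t (cKf t) (@continuous_Re R _)).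
  exact: (@continuous_comp _ _ _ (K \o f) _ t (cKf t) (@continuous_Im R _)).
have exH y : exists h : R -> R, forall x, a < x ->
    is_derive x (1 : R) h (complex.Im (K (x +i* y))).
  apply: exists_primitive; apply: (cline (fun x => x +i* y) _).2 => t.
  by apply/cvg_complexP; split; [exact: cvg_id|exact: cvg_cst].
have exV x : exists h : R -> R, forall y, a < y ->
    is_derive y (1 : R) h (complex.Re (K (x +i* y))).
  apply: exists_primitive; apply: (cline (fun y => x +i* y) _).1 => t.
  by apply/cvg_complexP; split; [exact: cvg_cst|exact: cvg_id].
have [H dH] := choice exH; have [V dV] := choice exV.
have ar : a < - r by rewrite /a; lra.
have [s s0 sP] := aK0 1 ltr01.
pose M := complex.Re `|K 0| + 1.
(* Goursat's lemma removes the four rectangles around the small square, as they avoid 0; on the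
   small square, of perimeter 8 d, K differs from K 0 by at most 1. *)
have small d : 0 < d -> d < r -> d < s / 2 ->
    `|contour H V (- r) r (- r) r| <= 8 * d.
  move=> d0 dr ds.
  have zero x1 x2 y1 y2 : - r <= x1 -> x1 < x2 -> - r <= y1 -> y1 < y2 ->
      [|| 0 < x1, x2 < 0, 0 < y1 | y2 < 0] -> contour H V x1 x2 y1 y2 = 0.
    move=> rx x12 ry y12 z0; apply: (goursat dH dV) => //.
    - exact: lt_le_trans rx.
    - exact: lt_le_trans ry.
    - move=> x y /andP[? ?] /andP[? ?]; apply: aK.
      rewrite eq_complex /= negb_and; apply/orP.
      by case/or4P: z0 => z0; [left|left|right|right]; apply/eqP; lra.
  have -> : contour H V (- r) r (- r) r = contour H V (- d) d (- d) d.
    have E1 := contour_splity H V (- r) r (- r) (- d) r.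
    have E2 := contour_splity H V (- r) r (- d) d r.
    have E3 := contour_splitx H V (- r) (- d) r (- d) d.
    have E4 := contour_splitx H V (- d) d r (- d) d.
    have Z1 : contour H V (- r) r (- r) (- d) = 0 by apply: zero; lra.
    have Z2 : contour H V (- r) r d r = 0 by apply: zero; lra.
    have Z3 : contour H V (- r) (- d) (- d) d = 0 by apply: zero; lra.
    have Z4 : contour H V d r (- d) d = 0 by apply: zero; lra.
    by rewrite E1 E2 E3 E4 Z1 Z2 Z3 Z4 !addr0 !add0r.
  have := @contour_affine_le R K a H V dH dV (K 0) 0 1 (- d) d (- d) d.
  have -> : 1 * (2 * (d - - d + (d - - d))) = 8 * d by ring.
  apply; [lra..|] => x y xd yd; rewrite mul0r addr0; apply: sP.
  apply: le_lt_trans (normc_le_ReIm _) _; rewrite ltcR /=.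
  have xd' : `|x| <= d by rewrite ler_norml.
  have yd' : `|y| <= d by rewrite ler_norml.
  by lra.
have I0 : contour H V (- r) r (- r) r = 0.
  apply/eqP; rewrite -normr_eq0 eq_le normr_ge0 andbT.
  apply/ler_addgt0Pr => e e0; rewrite add0r.
  pose d := Num.min (Num.min (r / 2) (s / 4)) (e / 8).
  have d0 : 0 < d by rewrite !lt_min; apply/andP; split; [apply/andP; split|]; lra.
  have d1 : d <= r / 2 by rewrite /d !ge_min lexx.
  have d2 : d <= s / 4 by rewrite /d !ge_min lexx orbT.
  have d3 : d <= e / 8 by rewrite /d !ge_min lexx orbT.
  by apply: le_trans (small d d0 _ _) _; lra.
have KE x y : `|x| <= r -> `|y| <= r -> `|x| = r \/ `|y| = r ->
    K (x +i* y) = (x / (x ^+ 2 + y ^+ 2)) +i* (- y / (x ^+ 2 + y ^+ 2)).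
  move=> xr yr xyr; rewrite /K ifN; last first.
    rewrite eq_complex /= negb_and; apply/orP.
    by case: xyr => h; [left|right]; rewrite -normr_gt0 h.
  by rewrite Gr// add0r mul1r mulNr.
(* This is the integrand of 1 / z on a side; a side has length 2 r, so each of the four contributes
   at least 1. *)
have ge_part t : - r <= t <= r -> (2 * r)^-1 <= r / (r ^+ 2 + t ^+ 2).
  move=> /andP[t1 t2]; rewrite -[leLHS]mul1r ler_pdivrMr ?mulr_gt0//.
  rewrite mulrAC ler_pdivlMr ?mul1r; last first.
    by rewrite ltr_pwDl ?exprn_gt0// sqr_ge0.
  by nra.
have nr : `|r| = r by rewrite gtr0_norm.
have nrN : `|- r| = r by rewrite normrN.
have half : (2 * r)^-1 * (r - - r) = 1 by field; rewrite gt_eqF.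
have rr : - r <= r by lra.
have hb : 1 <= H (- r) r - H (- r) (- r).
  rewrite -half; apply: (primitive_ge ar rr (dH (- r))) => x xr.
  rewrite KE ?nrN//; [|by rewrite ler_norml|by right].
  by rewrite /= opprK sqrrN addrC ge_part.
have ht : 1 <= - (H r r - H r (- r)).
  have := @primitive_ge R a (fun x => - complex.Im (K (x +i* r))) (- H r) (2 * r)^-1 _ _ ar rr.
  rewrite half !fctE -opprD; apply.
    by move=> x ax; have := dH r x ax => ?; exact: is_deriveN.
  move=> x xr; rewrite KE ?nr//; [|by rewrite ler_norml|by right].
  by rewrite /= mulNr opprK addrC ge_part.
have hr : 1 <= V r r - V r (- r).
  rewrite -half; apply: (primitive_ge ar rr (dV r)) => y yr.
  rewrite KE ?nr//; [|by rewrite ler_norml|by left].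
  by rewrite /= ge_part.
have hl : 1 <= - (V (- r) r - V (- r) (- r)).
  have := @primitive_ge R a (fun y => - complex.Re (K (- r +i* y))) (- V (- r)) (2 * r)^-1 _ _ ar rr.
  rewrite half !fctE -opprD; apply.
    by move=> y ay; have := dV (- r) y ay => ?; exact: is_deriveN.
  move=> y yr; rewrite KE ?nrN//; [|by rewrite ler_norml|by left].
  by rewrite /= mulNr opprK sqrrN ge_part.
by move: I0; rewrite /contour; lra.
Qed.

(* The product of the four rotations of g about w vanishes on the boundary of
   the square centred at w with one side on the real line. *)
Lemma identity_theorem g : (forall z, derivable g z 1) ->
  (forall x : R, g x%:C = 0) -> forall w, g w = 0.
Proof.
move=> dg g0 w.
have [w0|w0] := eqVneq (complex.Im w) 0.
  by case: w w0 => u v /= ->; exact: g0.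
apply/eqP/negPn/negP => gw.
have dgc (c z : C) : derivable (fun z => g (w + c * z)) z 1.
  apply/derivable1_diffP; apply: (@differentiable_comp _ _ _ _ (fun z => w + c * z) g).
    apply/derivable1_diffP; apply: derivableD; first exact: derivable_cst.
    by apply: derivableM; [exact: derivable_cst|exact: derivable_id].
  by apply/derivable1_diffP.
pose i : C := 0 +i* 1.
pose G z := - (g w ^+ 4)^-1 *
  ((g (w + 1 * z) * g (w + i * z)) * (g (w + -1 * z) * g (w + - i * z))).
have r0 : 0 < `|complex.Im w| by rewrite normr_gt0.
have dG z : derivable G z 1.
  by apply: derivableM; [exact: derivable_cst|apply: derivableM; apply: derivableM].
have Gr x y : `|x| <= `|complex.Im w| -> `|y| <= `|complex.Im w| ->
    `|x| = `|complex.Im w| \/ `|y| = `|complex.Im w| -> G (x +i* y) = 0.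
  move=> _ _ xyw.
  have gIm z : complex.Im z = 0 -> g z = 0 by case: z => u v /= ->; exact: g0.
  suff : [|| g (w + 1 * (x +i* y)) == 0, g (w + i * (x +i* y)) == 0,
      g (w + -1 * (x +i* y)) == 0 | g (w + - i * (x +i* y)) == 0].
    by rewrite /G; case/or4P => /eqP ->; rewrite ?(mul0r, mulr0).
  case: w xyw {w0 gw r0 dgc G dG} => u v /= xyw.
  have [xv|xv|yv|yv] : [\/ x = v, x = - v, y = v | y = - v].
  - case: xyw => /eqP; rewrite eqr_norm2 => /orP[] /eqP ->;
    [exact: Or41|exact: Or42|exact: Or43|exact: Or44].
  - by apply/or4P/Or44/eqP/gIm; rewrite /= xv; ring.
  - by apply/or4P/Or42/eqP/gIm; rewrite /= xv; ring.
  - by apply/or4P/Or43/eqP/gIm; rewrite /= yv; ring.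
  - by apply/or4P/Or41/eqP/gIm; rewrite /= yv; ring.
have := square_center r0 dG Gr; rewrite /G !mulr0 !addr0 mulNr.
rewrite (_ : g w * g w * (g w * g w) = g w ^+ 4); last by ring.
by rewrite mulVf ?eqxx// expf_neq0.
Qed.

End Identity.

(** * Positive functionals on C*-algebras *)

Lemma ge0_complexE (R : realType) (e : R[i]) : 0 <= e -> e = (complex.Re e)%:C.
Proof. by move=> e0; apply/esym/RRe_real/ger0_real. Qed.

Lemma real_complexD (R : realType) (u v : R) : (u + v)%:C = u%:C + v%:C.
Proof. exact: rmorphD. Qed.

Lemma real_complexM (R : realType) (u v : R) : (u * v)%:C = u%:C * v%:C.
Proof. exact: rmorphM. Qed.

Lemma cauchy_seq_cvg (K : numFieldType) (V : completeNormedModType K) (u : nat -> V) :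
  (forall e : K, 0 < e -> exists N, forall n m, (N <= n)%N -> (N <= m)%N ->
    `|u n - u m| < e) -> cvg (u @ \oo).
Proof.
move=> uc; apply/cauchy_cvgP/cauchy_ballP => e /uc[N NP].
exists ([set u n | n in [set n | (N <= n)%N]], [set u n | n in [set n | (N <= n)%N]]).
  by split; exists N => // n Nn; exists n.
by move=> [_ _] [/= [n Nn <-] [m Nm <-]]; rewrite -ball_normE; exact: NP.
Qed.

Section CStarTheory.
Variables (R : realType) (A : cstarAlgType R).
Local Notation C := R[i].
Implicit Types (X Y Z W : A) (z w : C).

Lemma cmulDl X Y Z : (X + Y) ** Z = X ** Z + Y ** Z.
Proof. by have := cmul_linearl Z 1 X Y; rewrite !scale1r. Qed.
Lemma cmulDr X Y Z : X ** (Y + Z) = X ** Y + X ** Z.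
Proof. by have := cmul_linearr X 1 Y Z; rewrite !scale1r. Qed.
Lemma cmul0r X : 0 ** X = 0.
Proof. by apply: (@addrI _ (0 ** X)); rewrite -cmulDl !addr0. Qed.
Lemma cmulr0 X : X ** 0 = 0.
Proof. by apply: (@addrI _ (X ** 0)); rewrite -cmulDr !addr0. Qed.
Lemma cmulZl z X Y : (z *: X) ** Y = z *: (X ** Y).
Proof. by have := cmul_linearl Y z X 0; rewrite cmul0r !addr0. Qed.
Lemma cmulZr z X Y : X ** (z *: Y) = z *: (X ** Y).
Proof. by have := cmul_linearr X z Y 0; rewrite cmulr0 !addr0. Qed.
Lemma cmulNl X Y : (- X) ** Y = - (X ** Y).
Proof. by rewrite -scaleN1r cmulZl scaleN1r. Qed.
Lemma cmulNr X Y : X ** (- Y) = - (X ** Y).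
Proof. by rewrite -scaleN1r cmulZr scaleN1r. Qed.
Lemma cmulBl X Y Z : (X - Y) ** Z = X ** Z - Y ** Z.
Proof. by rewrite cmulDl cmulNl. Qed.
Lemma cmulBr X Y Z : X ** (Y - Z) = X ** Y - X ** Z.
Proof. by rewrite cmulDr cmulNr. Qed.
Lemma cmul_suml I (r : seq I) (P : pred I) (F : I -> A) Y :
  (\sum_(i <- r | P i) F i) ** Y = \sum_(i <- r | P i) (F i ** Y).
Proof. by elim/big_rec2: _ => [|i x y _ <-]; rewrite ?cmul0r ?cmulDl. Qed.
Lemma cmul_sumr I (r : seq I) (P : pred I) (F : I -> A) Y :
  Y ** (\sum_(i <- r | P i) F i) = \sum_(i <- r | P i) (Y ** F i).
Proof. by elim/big_rec2: _ => [|i x y _ <-]; rewrite ?cmulr0 ?cmulDr. Qed.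

Lemma adjD X Y : adj (X + Y) = adj X + adj Y.
Proof. by have := adj_antilinear 1 X Y; rewrite rmorph1 !scale1r. Qed.
Lemma adj_zero : adj (0 : A) = 0.
Proof. by apply: (@addrI _ (adj 0)); rewrite -adjD !addr0. Qed.
Lemma adjZ z X : adj (z *: X) = conjc z *: adj X.
Proof. by have := adj_antilinear z X 0; rewrite adj_zero !addr0. Qed.
Lemma adjN X : adj (- X) = - adj X.
Proof. by rewrite -scaleN1r adjZ rmorphN1 scaleN1r. Qed.
Lemma adjB X Y : adj (X - Y) = adj X - adj Y.
Proof. by rewrite adjD adjN. Qed.
Lemma adj_sum I (r : seq I) (P : pred I) (F : I -> A) :
  adj (\sum_(i <- r | P i) F i) = \sum_(i <- r | P i) adj (F i).
Proof. by elim/big_rec2: _ => [|i x y _ <-]; rewrite ?adj_zero ?adjD. Qed.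
Lemma adj_cone : adj (cone : A) = cone.
Proof.
by have := adjM (cone : A) (adj cone); rewrite adjK !cmul1l adjK => /esym.
Qed.

Lemma norm_adj X : `|adj X| = `|X|.
Proof.
have le Y : `|Y| <= `|adj Y|.
  have [->|Y0] := eqVneq Y 0; first by rewrite adj_zero.
  rewrite -(ler_pM2r (_ : 0 < `|Y|)) ?normr_gt0// -expr2 -cstar_norm.
  exact: cstar_normM.
by apply/le_anti; rewrite le [X in _ <= `|X|](esym (adjK X)) le.
Qed.

Lemma norm_cone : `|cone : A| <= 1.
Proof.
have := cstar_norm (cone : A); rewrite adj_cone cmul1l => h.
have [->|c0] := eqVneq `|cone : A| 0; first by rewrite ler01.
by rewrite -(ler_pM2r (_ : 0 < `|cone : A|)) ?lt_neqAle ?normr_ge0 1?eq_sym ?c0// -expr2 -h mul1r.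
Qed.

Lemma cpowS X n : cpow X n.+1 = X ** cpow X n. Proof. by []. Qed.

Lemma cpowSr X n : cpow X n.+1 = cpow X n ** X.
Proof.
elim: n => [|n IH]; first by rewrite /cpow /= cmul1l cmul1r.
by rewrite [LHS]cpowS {1}IH cmulA -cpowS.
Qed.

Lemma cpowD X m n : cpow X (m + n) = cpow X m ** cpow X n.
Proof.
elim: m => [|m IH]; first by rewrite add0n cmul1l.
by rewrite addSn !cpowS IH cmulA.
Qed.

Lemma adj_cpow X n : adj (cpow X n) = cpow (adj X) n.
Proof.
elim: n => [|n IH]; first exact: adj_cone.
by rewrite cpowSr adjM IH -cpowS.
Qed.

Lemma cvg_cmul T (F : set_system T) {FF : Filter F} (f g : T -> A) X Y :
  f @ F --> X -> g @ F --> Y -> (fun t => f t ** g t) @ F --> X ** Y.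
Proof.
move=> fX gY; apply/cvgrPdist_le => e e0.
pose s := `|X| + `|Y| + 1.
have s0 : 0 < s by rewrite ltr_wpDl// addr_ge0.
have es0 : 0 < e / s by rewrite divr_gt0.
move/cvgrPdist_lt: gY => /(_ _ es0); move/cvgrPdist_lt: fX => fX.
apply: filterS3 (fX _ es0) (fX _ ltr01) => t fe f1 ge.
have -> : X ** Y - f t ** g t = (X - f t) ** Y + f t ** (Y - g t).
  by rewrite cmulBl cmulBr addrA subrK.
rewrite (le_trans (ler_normD _ _))//.
have ft : `|f t| <= `|X| + 1.
  rewrite -[f t](subrK X) addrC (le_trans (ler_normD _ _))// lerD2l.
  by rewrite distrC ltW.
rewrite (@le_trans _ _ (e / s * `|Y| + (`|X| + 1) * (e / s)))//.
  apply: lerD; apply: le_trans (cstar_normM _ _) _.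
    by rewrite ler_wpM2r// ltW.
  by apply: ler_pM => //; exact: ltW.
rewrite mulrC -mulrDl addrCA addrA mulrC divfK//.
by rewrite gt_eqF.
Qed.

Lemma cvg_adj T (F : set_system T) {FF : Filter F} (f : T -> A) X :
  f @ F --> X -> (fun t => adj (f t)) @ F --> adj X.
Proof.
move=> fX; apply/cvgrPdist_lt => e e0.
move/cvgrPdist_lt: fX => /(_ _ e0); apply: filterS => t.
by rewrite -adjB norm_adj.
Qed.

(* The fixed point v of v |-> (W + v^2) / 2 satisfies (1 - v)^2 = 1 - W. *)
Lemma cstar_sqrt W : adj W = W -> `|W| < 1 -> exists Y, adj Y ** Y = cone - W.
Proof.
move=> Wsa W1; set w := `|W| in W1.
have w0 : 0 <= w by rewrite /w.
pose v := fix v n := if n is m.+1 then 2^-1 *: (W + v m ** v m) else 0 : A.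
have h2 : `|2^-1 : C| = 2^-1 by rewrite ger0_norm// invr_ge0.
have vw n : `|v n| <= w.
  elim: n => [|n IH]; first by rewrite normr0.
  rewrite /= normrZ h2 ler_pdivrMl// (le_trans (ler_normD _ _))//.
  rewrite mulrDl mul1r lerD// (le_trans (cstar_normM _ _))//.
  by rewrite -[leRHS]mulr1 ler_pM// (le_trans IH)// ltW.
have vsa n : adj (v n) = v n.
  elim: n => [|n IH]; first exact: adj_zero.
  rewrite /= adjZ adjD adjM Wsa IH; congr (_ *: _).
  by rewrite fmorphV rmorph_nat.
have vd n : `|v n.+1 - v n| <= w ^+ n.
  elim: n => [|n IH].
    rewrite expr0 /= subr0 cmul0r addr0 normrZ h2 ler_pdivrMl// mulr1.
    by rewrite (le_trans (ltW W1))// ler1n.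
  have -> : v n.+2 - v n.+1 = 2^-1 *: (v n.+1 ** (v n.+1 - v n) + (v n.+1 - v n) ** v n).
    rewrite cmulBr cmulBl addrA subrK -scalerBr; congr (_ *: _).
    by rewrite opprD addrACA subrr add0r.
  rewrite normrZ h2 ler_pdivrMl// exprS mulrDl mul1r.
  rewrite (le_trans (ler_normD _ _))// lerD//.
    by rewrite (le_trans (cstar_normM _ _))// ler_pM.
  by rewrite (le_trans (cstar_normM _ _))// mulrC ler_pM.
have vd' n m : `|v (n + m)%N - v n| <= w ^+ n / (1 - w).
  rewrite ler_pdivlMr ?subr_gt0//.
  have : `|v (n + m)%N - v n| * (1 - w) <= w ^+ n * (1 - w ^+ m).
    elim: m => [|m IH]; first by rewrite addn0 subrr normr0 mul0r expr0 subrr mulr0.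
    rewrite addnS -[v _ - v n](subrKA (v (n + m)%N)).
    have h : `|v (n + m).+1 - v (n + m)%N| * (1 - w) <= w ^+ (n + m) * (1 - w).
      by rewrite ler_wpM2r// subr_ge0 ltW.
    have := lerD h IH; rewrite -mulrDl => h'.
    rewrite (le_trans _ (le_trans h' _))//.
      by apply: ler_wpM2r; [rewrite subr_ge0 ltW|exact: ler_normD].
    by rewrite exprD exprS le_eqVlt; apply/orP; left; apply/eqP; ring.
  move/le_trans; apply; rewrite -[leRHS]mulr1 ler_wpM2l ?exprn_ge0//.
  by rewrite gerBl exprn_ge0.
have wR : w = (complex.Re w)%:C by exact: ge0_complexE.
have wcvg (e : C) : 0 < e -> exists N, forall n, (N <= n)%N -> w ^+ n < e.
  move=> e0; have eE := ge0_complexE (ltW e0).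
  have : (fun n => 1 * (complex.Re w) ^+ n) @ \oo --> (0 : R).
    by apply: cvg_geometric; rewrite ger0_norm -?ltcR -?lecR -?wR.
  have e0' : 0 < complex.Re e by rewrite -ltcR -eE.
  move/cvgrPdist_lt => /(_ _ e0')[N _ NP]; exists N => n /NP /=.
  rewrite sub0r normrN mul1r -ltcR -eE; apply: le_lt_trans.
  by rewrite wR -rmorphXn lecR ler_norm.
have cv : cvg (v @ \oo).
  apply: cauchy_seq_cvg => e e0.
  have e20 : 0 < e * (1 - w) / 2 by rewrite !mulr_gt0 ?subr_gt0 ?invr_gt0.
  have [N NP] := wcvg _ e20; exists N => n m Nn Nm.
  have vN k : (N <= k)%N -> `|v k - v N| < e / 2.
    move=> Nk; rewrite -(subnKC Nk) (le_lt_trans (vd' _ _))//.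
    by rewrite ltr_pdivrMr ?subr_gt0// mulrAC NP.
  rewrite -(subrKA (v N)) (le_lt_trans (ler_normD _ _))// [e]splitr ltrD ?vN//.
  by rewrite distrC vN.
pose V := lim (v @ \oo).
have vV : v @ \oo --> V by [].
have vSV : (fun n => v n.+1) @ \oo --> V by have := vV; rewrite -(cvg_shiftS v).
have V2 : V = 2^-1 *: (W + V ** V).
  apply: (cvg_unique (@norm_hausdorff _ _) vSV).
  exact: (cvgZl_tmp (k := 2^-1) (cvgD (cvg_cst W) (cvg_cmul vV vV))).
have Vsa : adj V = V.
  apply: (cvg_unique (@norm_hausdorff _ _) (cvg_adj vV)).
  by rewrite (_ : (fun t => adj (v t)) = v)//; apply/funext.
exists (cone - V); rewrite adjB adj_cone Vsa cmulBl cmul1l cmulBr cmul1r.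
have : 2 *: V = W + V ** V by rewrite {1}V2 scalerA mulfV ?scale1r// pnatr_eq0.
rewrite scaler_nat mulr2n => VV.
by rewrite -addrA -opprD addrA VV addrK.
Qed.

End CStarTheory.

Section PositiveFunctionals.
Variables (R : realType) (A : cstarAlgType R).
Local Notation C := R[i].
Implicit Types (X Y Z W : A) (z w : C).

Definition positive_functional (phi : A -> C) : Prop :=
  scalar phi /\ forall X, 0 <= phi (adj X ** X).

Lemma state_positive phi : is_state phi -> positive_functional phi.
Proof. by case. Qed.

Section Theory.
Variable phi : A -> C.
Hypothesis phiP : positive_functional phi.

Lemma pfunZD z X Y : phi (z *: X + Y) = z * phi X + phi Y.
Proof. exact: phiP.1. Qed.
Lemma pfunD X Y : phi (X + Y) = phi X + phi Y.
Proof. by rewrite -[X in phi (X + _)]scale1r pfunZD mul1r. Qed.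
Lemma pfun0 : phi 0 = 0.
Proof. by apply: (@addrI _ (phi 0)); rewrite -pfunD !addr0. Qed.
Lemma pfunZ z X : phi (z *: X) = z * phi X.
Proof. by rewrite -[X in phi X]addr0 pfunZD pfun0 addr0. Qed.
Lemma pfunN X : phi (- X) = - phi X.
Proof. by rewrite -scaleN1r pfunZ mulN1r. Qed.
Lemma pfunB X Y : phi (X - Y) = phi X - phi Y.
Proof. by rewrite pfunD pfunN. Qed.
Lemma pfun_sum I (r : seq I) (P : pred I) (F : I -> A) :
  phi (\sum_(i <- r | P i) F i) = \sum_(i <- r | P i) phi (F i).
Proof. by elim/big_rec2: _ => [|i x y _ <-]; rewrite ?pfun0 ?pfunD. Qed.
Lemma pfun_ge0 X : 0 <= phi (adj X ** X).
Proof. exact: phiP.2. Qed.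
Lemma pfun_ge0' X : 0 <= phi (X ** adj X).
Proof. by have := pfun_ge0 (adj X); rewrite adjK. Qed.
Lemma pfun1_ge0 : 0 <= phi cone.
Proof. by have := pfun_ge0 cone; rewrite adj_cone cmul1l. Qed.

(** The value of phi on (X + z)^* (X + z) is real for every scalar z; z = 1 compares the imaginary
    parts and z = i the real parts. *)
Lemma pfun_adj X : phi (adj X) = conjc (phi X).
Proof.
have E z : complex.Im (z * phi (adj X) + conjc z * phi X) = 0.
  have := pfun_ge0 (X + z *: cone).
  rewrite adjD adjZ adj_cone cmulDl !cmulDr !(cmulZl, cmulZr) !cmul1l cmul1r !pfunD.
  rewrite !pfunZ addrA => h.
  have h1 := ger0_Im (pfun_ge0 X).
  have h3 : complex.Im (conjc z * (z * phi cone)) = 0.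
    by apply: ger0_Im; rewrite mulrA mulr_ge0 ?pfun1_ge0// mulrC mulcJ_ge0.
  by have := ger0_Im h; rewrite !ImD h1 h3 add0r addr0.
have := E 1; have := E (0 +i* 1).
case: (phi X) => a b; case: (phi (adj X)) => a' b' /= h1 h2.
by apply/eqP; rewrite eq_complex /=; apply/andP; split; apply/eqP; lra.
Qed.

Lemma pfun_cauchy_schwarz X Y :
  `|phi (adj Y ** X)| ^+ 2 <= phi (adj X ** X) * phi (adj Y ** Y).
Proof.
set b := phi (adj Y ** X); set a := phi (adj X ** X).
set c := phi (adj Y ** Y).
have bc : phi (adj X ** Y) = conjc b by rewrite -pfun_adj adjM adjK.
have E z : 0 <= a + (z * conjc b + conjc z * b) + conjc z * z * c.
  have := pfun_ge0 (X + z *: Y).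
  rewrite adjD adjZ cmulDl !cmulDr !(cmulZl, cmulZr) !pfunD !pfunZ bc.
  by rewrite -/a -/b -/c !addrA -!mulrA.
have a0 : 0 <= a by exact: pfun_ge0.
have c0 : 0 <= c by exact: pfun_ge0.
have cc : conjc c = c by rewrite [c]ge0_complexE// conjc_real.
have bb : `|b| ^+ 2 = conjc b * b by rewrite sqr_normc mulrC.
have [cE|cN0] := eqVneq c 0.
  rewrite cE mulr0 le_eqVlt; apply/orP; left; apply/negPn/negP => nb.
  have b0 : 0 < `|b| ^+ 2 by rewrite lt_neqAle eq_sym nb exprn_ge0.
  (* For c = 0 the quadratic form is affine along multiples of b, and this t makes it equal to - (a
     + 2) < 0. *)
  have [t t0 tb] : exists2 t, 0 <= t & t * (conjc b * b) = a + 1.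
    exists ((a + 1) / `|b| ^+ 2); first by rewrite divr_ge0 ?addr_ge0// ltW.
    by rewrite -bb divfK// gt_eqF.
  have tt : conjc t = t by rewrite [t]ge0_complexE// conjc_real.
  have := E (- t * b); rewrite cE mulr0 addr0.
  have -> : conjc (- t * b) = - t * conjc b by rewrite rmorphM rmorphN /= tt.
  have -> : a + (- t * b * conjc b + - t * conjc b * b) = - (a + 2).
    have -> : a + 2 = 2 * (a + 1) - a by ring.
    by rewrite -tb; ring.
  by rewrite oppr_ge0 real_leNgt ?rpred0 ?ger0_real ?addr_ge0// ltr_wpDl.
have c0' : 0 < c by rewrite lt_neqAle eq_sym cN0.
have := E (- (b / c)); rewrite rmorphN fmorph_div /= cc.
have -> : a + (- (b / c) * conjc b + - (conjc b / c) * b) + - (conjc b / c) * - (b / c) * c =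
    a - conjc b * b / c.
  by field.
by rewrite -bb subr_ge0 ler_pdivrMr.
Qed.

Lemma pfun_null_adj X Y : phi (adj Y ** Y) = 0 -> phi (adj Y ** X) = 0.
Proof.
move=> Y0; have := pfun_cauchy_schwarz X Y; rewrite Y0 mulr0 => h.
by apply/eqP; rewrite -normr_eq0 -sqrf_eq0 eq_le h exprn_ge0.
Qed.

Lemma pfun_null X Y : phi (adj Y ** Y) = 0 -> phi (X ** Y) = 0.
Proof.
move=> /(pfun_null_adj (adj X)) h.
by rewrite -[_ ** _]adjK pfun_adj adjM h conjc0.
Qed.

(** For r > |X|^2 the element 1 - X^* X / r is of the form Y^* Y by [cstar_sqrt], and positivity
    gives the bound with r instead of |X|^2; the strict inequality is removed at the end. *)
Lemma pfun_sqr_le X : phi (adj X ** X) <= phi cone * `|X| ^+ 2.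
Proof.
suff h (r : C) : `|X| ^+ 2 < r -> phi (adj X ** X) <= phi cone * r.
  rewrite -subr_ge0; set s := _ - _.
  have sr : s \is Num.real.
    by rewrite realB// ger0_real// ?pfun_ge0// mulr_ge0 ?pfun1_ge0// exprn_ge0.
  rewrite real_leNgt// ?rpred0//; apply/negP => s0.
  have p1 : 0 < phi cone + 1 by rewrite ltr_wpDl ?pfun1_ge0.
  (* The gap s is negative; dividing it by phi 1 + 1 makes r exceed |X|^2 by so little that phi 1 *
     r still falls short of phi (X^* X). *)
  have := h (`|X| ^+ 2 - s / (phi cone + 1)).
  rewrite ltrDl oppr_gt0 pmulr_llt0 ?invr_gt0// => /(_ s0).
  rewrite mulrBr -subr_ge0 addrAC -/s subr_ge0 => h'.
  have : phi cone * (s / (phi cone + 1)) > s.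
    rewrite mulrCA ltr_nMr// ltr_pdivrMr// mul1r.
    by rewrite ltrDl.
  by move=> /(le_lt_trans h'); rewrite ltxx.
move=> Xr; have r0 : 0 < r by rewrite (le_lt_trans _ Xr)// exprn_ge0.
have rr : conjc r^-1 = r^-1.
  by rewrite [r^-1]ge0_complexE ?conjc_real// invr_ge0 ltW.
have Wsa : adj (r^-1 *: (adj X ** X)) = r^-1 *: (adj X ** X).
  by rewrite adjZ rr adjM adjK.
have W1 : `|r^-1 *: (adj X ** X)| < 1.
  by rewrite normrZ cstar_norm gtr0_norm ?invr_gt0// ltr_pdivrMl// mulr1.
have [Y YE] := cstar_sqrt Wsa W1.
have := pfun_ge0 Y; rewrite YE pfunB pfunZ subr_ge0.
by rewrite ler_pdivrMl// mulrC.
Qed.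

Lemma pfun_bounded X : `|phi X| <= phi cone * `|X|.
Proof.
have p0 := pfun1_ge0.
rewrite -(@ler_pXn2r _ 2)// ?nnegrE ?mulr_ge0//.
have := pfun_cauchy_schwarz X cone; rewrite adj_cone !cmul1l => /le_trans; apply.
by rewrite exprMn expr2 mulrC -mulrA ler_wpM2l// pfun_sqr_le.
Qed.

End Theory.

Lemma state_bounded phi X : is_state phi -> `|phi X| <= `|X|.
Proof.
move=> phiP; have := pfun_bounded (state_positive phiP) X.
by case: phiP => _ _ ->; rewrite mul1r.
Qed.

Lemma state_limit T (F : set_system T) {FF : ProperFilter F} (f : T -> A -> C)
    (phi : A -> C) :
  (\forall t \near F, is_state (f t)) ->
  (forall X, (fun t => f t X) @ F --> phi X) -> is_state phi.
Proof.
move=> fs fphi; split.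
- move=> z X Y; apply: (cvg_unique (@norm_hausdorff _ C) (fphi _)).
  have h : (fun t => z * f t X + f t Y) @ F --> z * phi X + phi Y.
    exact: (cvg_complexD (cvg_complexM (cvg_cst z) (fphi X)) (fphi Y)).
  apply: (cvg_trans _ h); apply: near_eq_cvg.
  by apply: filterS fs => t [lin _ _]; rewrite lin.
- move=> X; apply: (cvg_complex_ge0 (fphi _)).
  by apply: filterS fs => t [_ h _]; exact: h.
- apply: (cvg_unique (@norm_hausdorff _ C) (fphi _)).
  have h : (fun=> 1 : C) @ F --> (1 : C) by exact: cvg_cst.
  apply: (cvg_trans _ h); apply: near_eq_cvg.
  by apply: filterS fs => t [_ _ ->].
Qed.

(** Banach-Alaoglu: states lie in the product of the discs of radius |X|, which is compact by
    Tychonoff, and the second hypothesis is closedness under pointwise limits. *)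
Lemma compact_set_of_states (L : set {ptws A -> C}) :
  (forall phi, L phi -> is_state phi) ->
  (forall (F : set_system {ptws A -> C}) (FF : ProperFilter F) (phi : A -> C),
    F L -> (forall X, (fun f : {ptws A -> C} => f X) @ F --> phi X) -> L phi) ->
  compact L.
Proof.
move=> Ls Llim; rewrite compact_ultra => F FU FL.
have := @tychonoff A (fun _ => C) (fun X => [set z : C | `|z| <= `|X|])
  (fun X => @compact_disc R `|X|).
rewrite compact_ultra => /(_ F FU) [|phi [_ Fphi]].
  by apply: filterS FL => phi /Ls phis X /=; exact: state_bounded.
have Fphi' X : (fun f : {ptws A -> C} => f X) @ F --> phi X.
  have h := (@proj_continuous _ (fun _ => C) X phi). exact: (cvg_comp _ _ Fphi h).
by exists phi; split=> //; exact: Llim Fphi'.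
Qed.

(** An ultrafilter finer than [\oo] plays the role of a convergent subsequence, which need not exist
    in a weak* compact set. Every limit along [\oo] remains a limit along it. *)
Lemma states_cluster (psi : nat -> A -> C) : (forall n, is_state (psi n)) ->
  exists (F : set_system nat) (phi : A -> C), [/\ ProperFilter F, \oo `<=` F,
    is_state phi & forall X, (fun n => psi n X) @ F --> phi X].
Proof.
move=> psis; have cs : compact (@states R A).
  apply: compact_set_of_states => // F FF phi Fs Fphi.
  exact: (state_limit (f := fun g : {ptws A -> C} => g) Fs Fphi).
have [F [FU FS]] := @ultraFilterLemma _ \oo _.
have FP : ProperFilter F by case: FU.
have psiU : UltraFilter ((psi : nat -> {ptws A -> C}) @ F).
  apply: Build_UltraFilter => G GP; rewrite eqEsubset => sub; split=> // S GS.
  have [//|nS] := in_ultra_setVsetC (psi @^-1` S) FU.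
  have : G (~` S) by exact: sub.
  move=> /(filterI GS); rewrite setICr => G0.
  by have /(_ G0) := @filter_not_empty _ G GP.
move: cs; rewrite compact_ultra => /(_ _ psiU) [|phi [phis psiphi]].
  by apply: FS; exists 0 => // n _; exact: psis.
exists F, phi; split=> // X.
have h := (@proj_continuous _ (fun _ => C) X phi).
exact: (cvg_comp _ _ psiphi h).
Qed.

End PositiveFunctionals.

(** * Dense spans, and extension of equality and convergence from them *)

Section DenseSpan.
Variables (R : realType) (A : cstarAlgType R).
Local Notation C := R[i].
Implicit Types (X Y Z W : A) (z w : C) (E G : set A).

Inductive lspan E : A -> Prop :=
| lspan0 : lspan E 0
| lspanZD z X Y : E X -> lspan E Y -> lspan E (z *: X + Y).

Definition dense_span E : Prop :=
  forall X e, 0 < e -> exists2 Y, lspan E Y & `|X - Y| < e.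

Lemma lspan_gen E X : E X -> lspan E X.
Proof. by move=> EX; rewrite -[X]addr0 -[X]scale1r; apply: lspanZD => //; exact: lspan0. Qed.

Lemma lspanD E X Y : lspan E X -> lspan E Y -> lspan E (X + Y).
Proof.
move=> EX EY; elim: EX => [|z X' Y' EX' _ IH]; first by rewrite add0r.
by rewrite -addrA; exact: lspanZD.
Qed.

Lemma lspanZ E z X : lspan E X -> lspan E (z *: X).
Proof.
elim=> [|w X' Y' EX' _ IH]; first by rewrite scaler0; exact: lspan0.
by rewrite scalerDr scalerA; exact: lspanZD.
Qed.

Lemma lspanM E X Y : (forall U V, E U -> E V -> lspan E (U ** V)) ->
  lspan E X -> lspan E Y -> lspan E (X ** Y).
Proof.
move=> EM EX EY; elim: EX => [|z U X' EU _ IH]; first by rewrite cmul0r; exact: lspan0.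
rewrite cmulDl cmulZl; apply: lspanD => //; apply: lspanZ.
elim: EY => [|w V Y' EV _ IH']; first by rewrite cmulr0; exact: lspan0.
by rewrite cmulDr cmulZr; apply: lspanD => //; apply: lspanZ; exact: EM.
Qed.

Lemma lspan_adj E X : (forall U, E U -> E (adj U)) -> lspan E X -> lspan E (adj X).
Proof.
move=> EA; elim=> [|z U X' EU _ IH]; first by rewrite adj_zero; exact: lspan0.
by rewrite adjD adjZ; apply: lspanZD => //; exact: EA.
Qed.

(** The closure of the span of E is a unital C*-subalgebra containing the generators. *)
Lemma generates_dense_span G E : generates G -> G `<=` lspan E -> E cone ->
  (forall U V, E U -> E V -> lspan E (U ** V)) -> (forall U, E U -> E (adj U)) ->
  dense_span E.
Proof.
move=> gG GE E1 EM EA.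
pose B := [set X | forall e : C, 0 < e -> exists2 Y, lspan E Y & `|X - Y| < e].
have spanB X : lspan E X -> B X.
  by move=> EX e e0; exists X => //; rewrite subrr normr0.
suff -> : dense_span E = forall X, B X.
  move=> X0; suff -> : B = setT by [].
  apply: gG => [|Y /GE]; last exact: spanB.
  split.
  - by apply: spanB; exact: lspan_gen.
  - move=> z X1 X2 B1 B2 e e0.
    have z1 : 0 < `|z| + 1 by rewrite ltr_wpDl.
    have e2 : 0 < e / 2 by rewrite divr_gt0.
    have [Y1 EY1 d1] := B1 (e / 2 / (`|z| + 1)) (divr_gt0 e2 z1).
    have [Y2 EY2 d2] := B2 (e / 2) e2.
    exists (z *: Y1 + Y2); first by apply: lspanD => //; exact: lspanZ.
    rewrite opprD addrACA -scalerBr (le_lt_trans (ler_normD _ _))//.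
    rewrite [e]splitr ler_ltD// normrZ.
    rewrite (@le_trans _ _ ((`|z| + 1) * `|X1 - Y1|))//.
      by rewrite ler_wpM2r// lerDl.
    by rewrite mulrC -ler_pdivlMr// ltW.
  - move=> X1 X2 B1 B2 e e0.
    have x2 : 0 < `|X2| + 1 by rewrite ltr_wpDl.
    have e2 : 0 < e / 2 by rewrite divr_gt0.
    have [Y1 EY1 d1] := B1 (e / 2 / (`|X2| + 1)) (divr_gt0 e2 x2).
    have y1 : 0 < `|Y1| + 1 by rewrite ltr_wpDl.
    have [Y2 EY2 d2] := B2 (e / 2 / (`|Y1| + 1)) (divr_gt0 e2 y1).
    exists (Y1 ** Y2); first exact: lspanM.
    have -> : X1 ** X2 - Y1 ** Y2 = (X1 - Y1) ** X2 + Y1 ** (X2 - Y2).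
      by rewrite cmulBl cmulBr addrA subrK.
    rewrite (le_lt_trans (ler_normD _ _))// [e]splitr ler_ltD//.
      rewrite (le_trans (cstar_normM _ _))//.
      rewrite (@le_trans _ _ (`|X1 - Y1| * (`|X2| + 1)))//.
        by rewrite ler_wpM2l// lerDl.
      by rewrite -ler_pdivlMr// ltW.
    rewrite (le_lt_trans (cstar_normM _ _))//.
    rewrite (@le_lt_trans _ _ (`|X2 - Y2| * (`|Y1| + 1)))//.
      by rewrite mulrC ler_wpM2l// lerDl.
    by rewrite -ltr_pdivlMr.
  - move=> X BX e /BX[Y EY d]; exists (adj Y); first exact: lspan_adj.
    by rewrite -adjB norm_adj.
  - rewrite closedE => X /= nX e e0; apply: contrapT => noY; apply: nX.
    have e2 : 0 < e / 2 by rewrite divr_gt0.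
    have := nbhsx_ballx X _ e2; rewrite -ball_normE; apply: filterS => Z /= XZ BZ.
    have [Y EY ZY] := BZ _ e2; apply: noY; exists Y => //.
    by rewrite -(subrKA Z) (le_lt_trans (ler_normD _ _))// [e]splitr ltrD.
by apply/propext; split=> h X e; exact: h.
Qed.

Definition bounded_scalar (f : A -> C) : Prop :=
  scalar f /\ exists M : C, forall X, `|f X| <= M * `|X|.

Lemma bounded_scalar_ext E f g : dense_span E -> bounded_scalar f ->
  bounded_scalar g -> (forall X, E X -> f X = g X) -> forall X, f X = g X.
Proof.
move=> dE [fl [M fM]] [gl [N gN]] fg X.
have f0 : f 0 = 0 by have := fM 0; rewrite normr0 mulr0 normr_le0 => /eqP.
have g0 : g 0 = 0 by have := gN 0; rewrite normr0 mulr0 normr_le0 => /eqP.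
have fgs Y : lspan E Y -> f Y = g Y.
  by elim=> [|z U V EU _ IH]; rewrite ?f0 ?g0// fl gl IH fg.
have fB U V : f (U - V) = f U - f V.
  by rewrite addrC -scaleN1r fl mulN1r addrC.
have gB U V : g (U - V) = g U - g V.
  by rewrite addrC -scaleN1r gl mulN1r addrC.
have MN Y : 0 <= (M + N) * `|Y|.
  rewrite mulrDl addr_ge0//; first exact: le_trans (fM Y).
  exact: le_trans (gN Y).
apply/eqP; rewrite -subr_eq0 -normr_le0; apply/negPn/negP => fgX.
have fgX0 : 0 < `|f X - g X|.
  by rewrite normr_gt0; apply: contraNneq fgX => ->; rewrite normr0.
have [MN0|MN0] := eqVneq ((M + N) * `|X|) 0.
  move/negP: fgX; apply; rewrite -MN0 (le_trans (ler_normB _ _))//.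
  by rewrite mulrDl lerD.
have MNp : 0 < M + N.
  by rewrite -(pmulr_lgt0 _ (_ : 0 < `|X|)) ?normr_gt0 ?lt_neqAle ?(eq_sym 0) ?MN0 ?MN//;
    apply: contraNneq MN0 => ->; rewrite normr0 mulr0.
have [Y EY XY] := dE X _ (divr_gt0 fgX0 MNp).
have : `|f X - g X| < `|f X - g X|.
  have E' : f X - g X = f (X - Y) - g (X - Y) by rewrite fB gB (fgs Y EY); ring.
  rewrite {1}E' (le_lt_trans (ler_normB _ _))//.
  rewrite ltr_pdivlMr// in XY; apply: le_lt_trans XY.
  by rewrite mulrDr lerD// mulrC.
by rewrite ltxx.
Qed.

Lemma state_ext E phi psi : dense_span E -> is_state phi -> is_state psi ->
  (forall X, E X -> phi X = psi X) -> phi = psi.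
Proof.
have bs f : is_state f -> bounded_scalar f.
  by move=> fs; split; [case: fs|exists 1 => X; rewrite mul1r state_bounded].
by move=> dE /bs hphi /bs hpsi h; apply/funext; exact: bounded_scalar_ext h.
Qed.

(** States are uniformly bounded by the norm, so convergence spreads from the span to its closure by
    an e / 3 argument. *)
Lemma states_cvg T (F : set_system T) {FF : Filter F} (f : T -> A -> C)
    (phi : A -> C) E : dense_span E ->
  (\forall t \near F, is_state (f t)) -> is_state phi ->
  (forall X, E X -> (fun t => f t X) @ F --> phi X) ->
  forall X, (fun t => f t X) @ F --> phi X.
Proof.
move=> dE fs phis fphi X.
have fspan Y : lspan E Y -> (fun t => f t Y) @ F --> phi Y.
  elim=> [|z U V EU _ IH].
    rewrite (pfun0 (state_positive phis)).
    have h : (fun=> 0 : C) @ F --> (0 : C) by exact: cvg_cst.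
    apply: (cvg_trans _ h); apply: near_eq_cvg.
    by apply: filterS fs => t ft; rewrite (pfun0 (state_positive ft)).
  rewrite (pfunZD (state_positive phis)).
  have h : (fun t => z * f t U + f t V) @ F --> z * phi U + phi V.
    exact: (cvg_complexD (cvg_complexM (cvg_cst z) (fphi U EU)) IH).
  apply: (cvg_trans _ h); apply: near_eq_cvg.
  by apply: filterS fs => t ft; rewrite (pfunZD (state_positive ft)).
apply/cvgrPdist_lt => e e0.
have e3 : 0 < e / 3 by rewrite divr_gt0.
have [Y EY XY] := dE X _ e3.
move/cvgrPdist_lt: (fspan Y EY) => /(_ _ e3) fY.
apply: filterS2 fs fY => t ft fYt.
have -> : phi X - f t X = phi (X - Y) + (phi Y - f t Y) - f t (X - Y).
  by rewrite (pfunB (state_positive phis)) (pfunB (state_positive ft)); ring.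
have -> : e = e / 3 + e / 3 + e / 3 by field.
rewrite (le_lt_trans (ler_normB _ _))// ltrD//.
  rewrite (le_lt_trans (ler_normD _ _))// ltrD//.
  by rewrite (le_lt_trans (state_bounded _ phis)).
by rewrite (le_lt_trans (state_bounded _ ft)).
Qed.

Lemma mix_state (phi psi : A -> C) (s : R) : is_state phi -> is_state psi ->
  0 <= s <= 1 -> is_state (mix s phi psi).
Proof.
move=> [l1 p1 n1] [l2 p2 n2] /andP[s0 s1]; split.
- by move=> z X Y; rewrite /mix l1 l2; ring.
- by move=> X; rewrite /mix addr_ge0// mulr_ge0// ?lecR ?ler0c// subr_ge0.
- by rewrite /mix n1 n2 !mulr1 -rmorphD addrC subrK.
Qed.

End DenseSpan.

(** On E the value of [F omega] is an evaluation of omega, hence weak* continuous in omega. This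
    applies to the map from states to ground states and to its inverse alike. *)
Lemma transfer_continuous (R : realType) (A B : cstarAlgType R)
    (K : set {ptws A -> R[i]}) (F : {ptws A -> R[i]} -> {ptws B -> R[i]})
    (E : set B) : dense_span E ->
  (forall omega, K omega -> is_state (F omega)) ->
  (forall Y, E Y -> exists X, forall omega, K omega -> F omega Y = omega X) ->
  {within K, continuous F}.
Proof.
move=> dE FK EK; apply/subspace_continuousP => omega Komega.
have KK : (within K (nbhs omega)) K by exact: withinT.
apply/pointwise_cvgP => Y.
apply: (@states_cvg R B _ (within K (nbhs omega)) _ F (F omega) E dE) => //.
- by apply: filterS KK => f; exact: FK.
- exact: FK.
- move=> Z EZ; have [X KX] := EK Z EZ.
  have h : (fun f : {ptws A -> R[i]} => f X) @ within K (nbhs omega) --> omega X.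
    apply: cvg_within_filter.
    exact: (@proj_continuous _ (fun _ => R[i]) X omega).
  rewrite KX//; apply: (cvg_trans _ h); apply: near_eq_cvg.
  by apply: filterS KK => f Kf; rewrite KX.
Qed.

(** * The positive cone of BS(c, d) *)

Section Positives.
Variables c d : nat.
Hypotheses (c_gt0 : (0 < c)%N) (d_gt0 : (0 < d)%N).
Local Notation G := (BS c d).
Local Notation a := (bs_a c d).
Local Notation b := (bs_b c d).
Local Notation P := (@bs_pos c d).
Local Notation theta := (@bs_theta c d).
Implicit Types (x y p : G) (m n : nat).
Local Open Scope group_scope.

Lemma bs_pos_bX n : P (b ^+ n).
Proof.
by elim: n => [|n IH]; [exact: bs_pos1|rewrite expgS; apply: bs_posM => //; exact: bs_posb].
Qed.

Lemma bs_relX n : b ^+ (d * n) * a = a * b ^+ (c * n).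
Proof.
elim: n => [|n IH]; first by rewrite !muln0 expg0 mul1g mulg1.
by rewrite !mulnS !expgnDr -mulgA IH mulgA -bs_rel mulgA.
Qed.

Lemma bs_pos_letters (Q : G -> Prop) : Q 1 ->
  (forall p, P p -> Q p -> Q (a * p)) -> (forall p, P p -> Q p -> Q (b * p)) ->
  forall p, P p -> Q p.
Proof.
move=> Q1 Qa Qb p Pp.
suff h : forall y, P y -> Q y -> Q (p * y).
  by rewrite -[p]mulg1; apply: h => //; exact: bs_pos1.
elim: Pp => {p} [y|y|y|x x' _ IHx Px' IHx' y Py Qy]; rewrite ?mul1g//; try by auto.
by rewrite -mulgA; apply: IHx; [exact: bs_posM|exact: IHx'].
Qed.

Lemma bs_pos_cases p : P p -> (exists n, p = b ^+ n) \/
  (exists n p', P p' /\ p = b ^+ n * (a * p')).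
Proof.
elim/bs_pos_letters => [|{}p Pp _|{}p Pp].
- by left; exists 0; rewrite expg0.
- by right; exists 0, p; rewrite expg0 mul1g.
- case=> [[n ->]|[n [p' [Pp' ->]]]]; first by left; exists n.+1; rewrite expgS.
  by right; exists n.+1, p'; rewrite expgS mulgA.
Qed.

Lemma bs_theta1 : theta 1 = 0%R.
Proof. by apply: (@GRing.addrI _ (theta 1)); rewrite -bs_thetaM mulg1 GRing.addr0. Qed.

Lemma bs_theta_bX n : theta (b ^+ n) = 0%R.
Proof.
elim: n => [|n IH]; first exact: bs_theta1.
by rewrite expgS bs_thetaM bs_theta_b IH GRing.addr0.
Qed.

Lemma bs_theta_ge0 p : P p -> (0 <= theta p)%R.
Proof.
elim/bs_pos_letters => [|{}p _ IH|{}p _ IH]; first by rewrite bs_theta1.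
- by rewrite bs_thetaM bs_theta_a addr_ge0.
- by rewrite bs_thetaM bs_theta_b add0r.
Qed.

Lemma bs_theta_eq0 p : P p -> theta p = 0%R -> exists n, p = b ^+ n.
Proof.
case/bs_pos_cases => // -[n [p' [Pp' ->]]].
rewrite !bs_thetaM bs_theta_bX bs_theta_a add0r => h.
by have := bs_theta_ge0 Pp'; lia.
Qed.

(* A set with an action of the group: b translates the integer, and on the half
   with second coordinate inl the letter a acts as it does on normal forms
   b^s1 a b^s2 a ..., which makes the least power of b in front of an a readable
   modulo d; the half inr only serves to make a bijective. *)
Definition bs_set := (int * (nat + nat))%type.

(** Over a block of d integers, [act_a] maps the half [inl] onto residue 0 of that half. The d - 1
    other residues of [inl] and the d residues of [inr], together 2 d - 1, are left for the half
    [inr] to fill. *)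
Local Notation e := (d.*2.-1)%N.

Definition act_a (x : bs_set) : bs_set :=
  let q := (x.1 %/ c)%Z in let r := `|(x.1 %% c)%Z|%N in
  match x.2 with
  | inl j => ((q * d)%R, inl (j * c + r)%N)
  | inr w => let n := (w * c + r)%N in let s := (n %% e)%N in
    if (s < d)%N then ((q * d + s%:Z)%R, inr (n %/ e)%N)
    else ((q * d + (s - d).+1%:Z)%R, inl (n %/ e)%N)
  end.

Definition act_a' (x : bs_set) : bs_set :=
  let q := (x.1 %/ d)%Z in let r := `|(x.1 %% d)%Z|%N in
  match x.2 with
  | inl j => if r == 0%N then ((q * c + (j %% c)%N%:Z)%R, inl (j %/ c)%N)
    else let n := (j * e + (r + d).-1)%N in ((q * c + (n %% c)%N%:Z)%R, inr (n %/ c)%N)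
  | inr k => let n := (k * e + r)%N in ((q * c + (n %% c)%N%:Z)%R, inr (n %/ c)%N)
  end.

Lemma divmodz (q : int) (r n : nat) : (r < n)%N ->
  ((q * n + r%:Z)%R %/ n)%Z = q /\ `|((q * n + r%:Z)%R %% n)%Z|%N = r.
Proof.
move=> rn; have n0 : (n%:Z != 0)%R by lia.
rewrite divzMDl// modzMDl divz_small ?modz_small ?addr0//; lia.
Qed.

Lemma divmodzE (m : int) (n : nat) : (0 < n)%N ->
  exists (q : int) (r : nat), (r < n)%N /\ m = (q * n + r%:Z)%R.
Proof.
move=> n0; exists (m %/ n)%Z, `|(m %% n)%Z|%N; have nz : (n%:Z != 0)%R by lia.
have h := modz_ge0 m nz; have h' := @ltz_pmod m n n0.
by split; [lia|rewrite gez0_abs// -divz_eq].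
Qed.

Lemma act_aK : cancel act_a act_a'.
Proof.
move=> [m]; have [q [r [rc ->]]] := divmodzE m c_gt0.
have e0 : (0 < e)%N by lia.
have [h1 h2] := divmodz q rc.
case=> [j|w]; rewrite /act_a /= h1 h2.
  have [h3 h4] := divmodz q d_gt0; rewrite addr0 in h3 h4.
  rewrite /act_a' /= h3 h4 eqxx /=.
  by rewrite modnMDl modn_small// divnMDl// divn_small// addn0.
set n := (w * c + r)%N; have nE := divn_eq n e; have ne := ltn_pmod n e0.
have nc : (n %% c = r)%N by rewrite /n modnMDl modn_small.
have nw : (n %/ c = w)%N by rewrite /n divnMDl// divn_small// addn0.
case: ltnP => sd; rewrite /act_a' /=.
  have [-> ->] := divmodz q sd.
  by rewrite -nE nc nw.
have sd' : ((n %% e - d).+1 < d)%N by lia.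
have [-> ->] := divmodz q sd'.
rewrite (_ : (_ + ((n %% e - d).+1 + d).-1)%N = n); first by rewrite nc nw.
lia.
Qed.

Lemma act_a'K : cancel act_a' act_a.
Proof.
move=> [m]; have [q [r [rd ->]]] := divmodzE m d_gt0.
have e0 : (0 < e)%N by lia.
have [h1 h2] := divmodz q rd.
case=> [j|k]; rewrite /act_a' /= h1 h2.
  case: eqP => [r0|r0]; rewrite /act_a /=.
    have [-> ->] := divmodz q (ltn_pmod j c_gt0).
    by rewrite -divn_eq r0 addr0.
  set n := (_ + (r + d).-1)%N.
  have [-> ->] := divmodz q (ltn_pmod n c_gt0).
  have ne : (n %% e = (r + d).-1)%N by rewrite /n modnMDl modn_small//; lia.
  have nk : (n %/ e = j)%N by rewrite /n divnMDl// divn_small ?addn0//; lia.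
  rewrite -divn_eq ne nk ifN; last by lia.
  by congr ((_ + _)%R, _); lia.
rewrite /act_a /=; set n := (_ + r)%N.
have [-> ->] := divmodz q (ltn_pmod n c_gt0).
have ne : (n %% e = r)%N by rewrite /n modnMDl modn_small//; lia.
have nk : (n %/ e = k)%N by rewrite /n divnMDl// divn_small ?addn0//; lia.
by rewrite -divn_eq ne nk rd.
Qed.

Definition act_letter (l : bool * bool) (x : bs_set) : bs_set :=
  if l.1 then (if l.2 then act_a' x else act_a x)
  else ((x.1 + (if l.2 then -1 else 1))%R, x.2).

Definition act_word (w : bs_word) (x : bs_set) : bs_set := foldr act_letter x w.

Lemma act_word_nseq n (x : bs_set) : act_word (nseq n (false, false)) x = ((x.1 + n%:Z)%R, x.2).
Proof.
elim: n => [|n IH] /=; first by rewrite addr0; case: x.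
by rewrite IH /act_letter /=; congr (_, _); lia.
Qed.

Lemma act_word_cong u v : bs_cong c d u v -> forall x : bs_set, act_word u x = act_word v x.
Proof.
elim=> {u v} [//|u v _ IH x|v u w _ IH1 _ IH2 x|u u' v v' _ IH1 _ IH2 x|g s x|x].
- by rewrite IH.
- by rewrite IH1.
- by rewrite /act_word !foldr_cat -!/(act_word _ _) IH1 IH2.
- case: g s => -[] /=; rewrite /act_letter /= ?act_aK ?act_a'K//;
    by rewrite -addrA ?addNr ?subrr addr0; case: x.
(* Adding c to the first coordinate raises its quotient by 1 and keeps its remainder, so [act_a]
   then adds d. *)
- rewrite -cats1 /act_word foldr_cat /= -!/(act_word _ _) !act_word_nseq.
  have [q [r [rc xE]]] := divmodzE x.1 c_gt0.
  have [h1 h2] := divmodz q rc; have [h3 h4] := divmodz (q + 1)%R rc.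
  rewrite /act_letter /= /act_a /= xE h1 h2.
  have -> : (q * c + r%:Z + c%:Z = (q + 1) * c + r%:Z)%R by lia.
  rewrite h3 h4; case: x.2 => [j|w] /=; first by congr (_, _); lia.
  by case: ifP => _ /=; congr (_, _); lia.
Qed.

Definition bs_act (x : G) (t : bs_set) : bs_set := act_word (repr x) t.

Lemma bs_actM x y t : bs_act (x * y) t = bs_act x (bs_act y t).
Proof.
rewrite /bs_act (act_word_cong (bs_repr _ _ _)).
by rewrite /act_word foldr_cat.
Qed.

Lemma bs_act_bX n t : bs_act (b ^+ n) t = ((t.1 + n%:Z)%R, t.2).
Proof. by rewrite bs_bX /bs_act (act_word_cong (bs_repr _ _ _)) act_word_nseq. Qed.

Lemma bs_act_a t : bs_act a t = act_a t.
Proof. by rewrite /bs_act (act_word_cong (bs_repr _ _ _)). Qed.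

(** This invariant quarter is what makes membership in P visible in the action: the first coordinate
    stays nonnegative. *)
Lemma bs_act_pos p m j : P p -> exists m' j', bs_act p (m%:Z, inl j) = (m'%:Z, inl j').
Proof.
move=> Pp; elim: Pp m j => {p} [m j|m j|m j|x y _ IHx _ IHy m j].
- by exists m, j; rewrite -(expg0 b) bs_act_bX /= addr0.
- rewrite bs_act_a /act_a /=; exists (m %/ c * d)%N, (j * c + m %% c)%N.
  by rewrite divz_nat modz_nat /= PoszM.
- by exists m.+1, j; rewrite -(expg1 b) bs_act_bX /= ; congr (_, _); lia.
- by have [m' [j' E]] := IHy m j; rewrite bs_actM E; exact: IHx.
Qed.

Lemma bs_bX_le m n p : P p -> b ^+ m = b ^+ n * p -> (n <= m)%N.
Proof.
move=> Pp /(congr1 (bs_act^~ (0%:Z, inl 0%N))) /=.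
have [m' [j' E]] := bs_act_pos 0 0 Pp.
by rewrite bs_actM E !bs_act_bX /= => -[]; lia.
Qed.

Lemma bs_bX_inj : injective (fun n => b ^+ n).
Proof.
move=> m n mn; apply/eqP; rewrite eqn_leq.
by rewrite (bs_bX_le (p := 1)) ?mulg1 ?(bs_bX_le (p := 1)) ?mulg1//; exact: bs_pos1.
Qed.

(** On the invariant quarter a leading a makes the first coordinate a multiple of d, and b^n adds n
    to it. *)
Lemma bs_a_dvd n p p' : P p -> P p' -> a * p = b ^+ n * (a * p') -> (d %| n)%N.
Proof.
move=> Pp Pp' /(congr1 (bs_act^~ (0%:Z, inl 0%N))) /=.
have [m [j E]] := bs_act_pos 0 0 Pp; have [m' [j' E']] := bs_act_pos 0 0 Pp'.
rewrite !bs_actM E E' bs_act_bX !bs_act_a /act_a /= !divz_nat => -[h _].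
have : (m %/ c * d = m' %/ c * d + n)%N by lia.
by move=> /(congr1 (dvdn d)); rewrite dvdn_mull// dvdn_addr ?dvdn_mull.
Qed.

(** An upper bound of both can be written a p and also b^n a q with n > 0. By [bs_a_dvd] n is a
    multiple of d, so b^d a splits off on the left, and the rest of b^n passes a as a power of
    b^c. *)
Lemma bs_join_ba : is_join P b a (b ^+ d * a).
Proof.
split.
  split; first by apply: bs_posM; [exact: bs_pos_bX|exact: bs_posa].
    have -> : b ^+ d = b * b ^+ d.-1 by rewrite -expgS prednK.
    rewrite /qle -mulgA mulKg.
    by apply: bs_posM; [exact: bs_pos_bX|exact: bs_posa].
  by rewrite /qle -bs_rel mulKg; exact: bs_pos_bX.
move=> w [_ bw aw]; rewrite /qle in bw aw *.
have [p wa Pp] : exists2 p, w = a * p & P p by exists (a^-1 * w); rewrite ?mulVKg.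
have [p' wb Pp'] : exists2 p, w = b * p & P p by exists (b^-1 * w); rewrite ?mulVKg.
case/bs_pos_cases: Pp' => [[n pE]|[n [q [Pq pE]]]].
  have := congr1 theta (etrans (esym wa) wb).
  rewrite pE !bs_thetaM bs_theta_a bs_theta_b bs_theta_bX => h.
  by have := bs_theta_ge0 Pp; lia.
rewrite pE mulgA -expgS in wb.
have := bs_a_dvd Pp Pq (etrans (esym wa) wb).
move=> /dvdnP[k]; rewrite mulnC => nk.
have k0 : (0 < k)%N by case: k nk => //; rewrite muln0.
have -> : w = b ^+ d * a * (b ^+ (c * k.-1) * q).
  rewrite wb nk mulgA bs_relX -{1}(prednK k0) mulnS expgnDr -bs_rel.
  by rewrite !mulgA.
by rewrite mulKg; apply: bs_posM => //; exact: bs_pos_bX.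
Qed.

Lemma bs_disjoint_a_ba s z : (0 < s < d)%N -> ~ common_ub P a (b ^+ s * a) z.
Proof.
move=> /andP[s0 sd] [_ az bz]; rewrite /qle in az bz.
have : a * (a^-1 * z) = b ^+ s * (a * ((b ^+ s * a)^-1 * z)).
  by rewrite [RHS]mulgA !mulVKg.
by move=> /(bs_a_dvd az bz) /(dvdn_leq s0); rewrite leqNgt sd.
Qed.

(** Matrices are indexed by natural numbers, so the basis of the regular representation has to be
    enumerated without repetition. P is infinite because the powers of b are distinct. *)
Lemma bs_pos_enum : exists f : nat -> G, injective f /\ forall p, P p <-> exists n, p = f n.
Proof.
have injr : injective (repr : G -> bs_word) by exact: can_inj (@reprK _ _).
have ctP : countable P.
  apply/countable_injP; exists (fun p => pickle (repr p)) => p p' _ _.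
  by move=> /(pcan_inj (@pickleK _)) /injr.
have infP : infinite_set P.
  move=> finP; apply: infinite_nat.
  have -> : [set: nat] = (fun n => b ^+ n) @^-1` P.
    by apply/seteqP; split=> // n _; exact: bs_pos_bX.
  by apply: finite_preimage => // m n _ _; exact: bs_bX_inj.
have /card_set_bijP[g [gP ginj gsurj]] := eq_card_nat ctP infP.
have gex n : exists p, P p /\ g p = n.
  by have [p Pp <-] := gsurj n I; exists p.
have [f fP] := choice gex.
exists f; split=> [m n|p]; first by move=> /(congr1 g); rewrite !(fP _).2.
split=> [Pp|[n ->]]; last exact: (fP n).1.
exists (g p); apply: ginj; rewrite ?inE//; first exact: (fP _).1.
by rewrite (fP _).2.
Qed.

End Positives.

(** * Bounded matrices *)

Section BoundedMatrices.
Variable R : realType.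
Local Notation C := R[i].
Implicit Types (m n : nat -> nat -> C) (x y r : nat -> C) (M : R).

Definition sqsum N x : C := \sum_(i < N) `|x i| ^+ 2.

Definition mform m N L y x : C := \sum_(i < N) \sum_(j < L) conjc (y i) * m i j * x j.

(** By rescaling x against y this is equivalent to |<y, m x>| <= M |x| |y|; the form with a sum of
    squares avoids square roots. *)
Definition mbound m M : Prop := forall N L y x,
  2 * `|mform m N L y x| <= M%:C * (sqsum L x + sqsum N y).

Lemma sqsum_ge0 N x : 0 <= sqsum N x.
Proof. by apply: sumr_ge0 => i _; rewrite exprn_ge0. Qed.

Lemma mformD m n N L y x : mform (m + n) N L y x = mform m N L y x + mform n N L y x.
Proof.
rewrite /mform -big_split; apply: eq_bigr => i _; rewrite -big_split /=.
by apply: eq_bigr => j _; rewrite !fctE; ring.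
Qed.

Lemma mformZ z m N L y x : mform (z *: m) N L y x = z * mform m N L y x.
Proof.
rewrite /mform mulr_sumr; apply: eq_bigr => i _; rewrite mulr_sumr.
by apply: eq_bigr => j _; rewrite !fctE /GRing.scale /=; ring.
Qed.

Lemma mboundD m n M M' : mbound m M -> mbound n M' -> mbound (m + n) (M + M').
Proof.
move=> mM nM N L y x; rewrite mformD real_complexD [leRHS]mulrDl.
rewrite (le_trans _ (lerD (mM N L y x) (nM N L y x)))// -mulrDr.
by rewrite ler_wpM2l// ler_normD.
Qed.

Lemma mboundZ z m M : mbound m M -> mbound (z *: m) (complex.Re `|z| * M).
Proof.
move=> mM N L y x; rewrite mformZ normrM real_complexM -ge0_complexE// mulrCA -mulrA.
by rewrite ler_wpM2l.
Qed.

Lemma mbound0 M : 0 <= M -> mbound 0 M.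
Proof.
move=> M0 N L y x; rewrite [mform _ _ _ _ _](_ : _ = 0).
  by rewrite normr0 mulr0 mulr_ge0 ?ler0c// addr_ge0// sqsum_ge0.
by rewrite /mform big1// => i _; rewrite big1// => j _; rewrite [X in _ * X * _](_ : _ = 0)// mulr0 mul0r.
Qed.

Definition bounded_mx : {pred nat -> nat -> C} := mem [set m | exists M, mbound m M].

Lemma bounded_mxP m : reflect (exists M, mbound m M) (m \in bounded_mx).
Proof. by apply: (iffP idP); rewrite /bounded_mx !inE. Qed.

Fact bounded_mx_submod : submod_closed bounded_mx.
Proof.
split; first by apply/bounded_mxP; exists 0; exact: mbound0.
move=> z m n /bounded_mxP[M mM] /bounded_mxP[M' nM]; apply/bounded_mxP.
by exists (complex.Re `|z| * M + M'); apply: mboundD => //; exact: mboundZ.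
Qed.

HB.instance Definition _ := GRing.isSubmodClosed.Build C (nat -> nat -> C) bounded_mx
  bounded_mx_submod.

Record bmx := Bmx { bmx_val :> nat -> nat -> C; _ : bmx_val \in bounded_mx }.
HB.instance Definition _ := [isSub for bmx_val].
HB.instance Definition _ := [Choice of bmx by <:].
HB.instance Definition _ := [SubChoice_isSubLmodule of bmx by <:].
Implicit Types (A B : bmx).

Lemma bmxP A B : (forall i j, A i j = B i j) -> A = B.
Proof. by move=> AB; apply/val_inj/funext => i; apply/funext => j; exact: AB. Qed.

Definition bmx_norm A : R := inf [set M | 0 <= M /\ mbound A M].

Lemma mbound_le m M M' : M <= M' -> mbound m M -> mbound m M'.
Proof.
move=> MM mM N L y x; rewrite (le_trans (mM N L y x))// ler_wpM2r ?lecR//.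
by rewrite addr_ge0// sqsum_ge0.
Qed.

Lemma bmx_norm_has_inf A : has_inf [set M | 0 <= M /\ mbound A M].
Proof.
split; last by exists 0 => M [].
case: A => m mP /=; move/bounded_mxP: (mP) => [M mM]; exists (Num.max 0 M); split.
  by rewrite le_max lexx.
by apply: mbound_le mM; rewrite le_max lexx orbT.
Qed.

Lemma bmx_norm_ge0 A : 0 <= bmx_norm A.
Proof. by apply: lb_le_inf; [case: (bmx_norm_has_inf A)|move=> M []]. Qed.

Lemma bmx_norm_le A M : 0 <= M -> mbound A M -> bmx_norm A <= M.
Proof. by move=> M0 AM; apply: ge_inf => //; case: (bmx_norm_has_inf A). Qed.

Lemma mbound_norm A : mbound A (bmx_norm A).
Proof.
move=> N L y x; set l := 2 * _; set s := _ + _.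
have s0 : 0 <= s by rewrite addr_ge0// sqsum_ge0.
have l0 : 0 <= l by rewrite mulr_ge0.
rewrite [l]ge0_complexE// [s]ge0_complexE// -real_complexM lecR.
have [s0'|s0'] := eqVneq (complex.Re s) 0.
  have [[M [M0 AM]] _] := bmx_norm_has_inf A.
  have := AM N L y x; rewrite -/l -/s [l]ge0_complexE// [s]ge0_complexE// -real_complexM lecR.
  by rewrite s0' !mulr0.
have sp : 0 < complex.Re s.
  by rewrite lt_neqAle eq_sym s0'/= -ler0c -ge0_complexE.
rewrite -ler_pdivrMr//; apply: lb_le_inf; first by case: (bmx_norm_has_inf A).
move=> M [_ /(_ N L y x)]; rewrite -/l -/s [l]ge0_complexE// [s]ge0_complexE// -real_complexM lecR.
by rewrite ler_pdivrMr.
Qed.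

Lemma mform_delta m i j : mform m i.+1 j.+1 (fun k => (k == i)%:R) (fun k => (k == j)%:R) = m i j.
Proof.
rewrite /mform (bigD1 ord_max)//= [X in _ + X]big1 ?addr0; last first.
  move=> k ki; rewrite big1// => l _.
  by rewrite [X in conjc X](_ : _ = 0) ?rmorph0 ?mul0r//; rewrite -val_eqE /= in ki; rewrite (negbTE ki).
rewrite (bigD1 ord_max)//= [X in _ + X]big1 ?addr0; last first.
  by move=> l lj; rewrite -val_eqE /= in lj; rewrite (negbTE lj) mulr0.
by rewrite !eqxx rmorph1 mul1r mulr1.
Qed.

Lemma sqsum_delta i : sqsum i.+1 (fun k => (k == i)%:R) = 1.
Proof.
rewrite /sqsum (bigD1 ord_max)//= [X in _ + X]big1 ?addr0 ?eqxx ?normr1 ?expr1n//.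
by move=> k ki; rewrite -val_eqE /= in ki; rewrite (negbTE ki) normr0 expr0n.
Qed.

Lemma bmx_entry_le A i j : `|A i j| <= (bmx_norm A)%:C.
Proof.
have := mbound_norm A i.+1 j.+1 (fun k => (k == i)%:R) (fun k => (k == j)%:R).
by rewrite mform_delta !sqsum_delta -[1 + 1]/2 [leRHS]mulrC ler_pM2l.
Qed.

Fact bmx_normD A B : (bmx_norm (A + B))%:C <= (bmx_norm A)%:C + (bmx_norm B)%:C.
Proof.
rewrite -real_complexD lecR bmx_norm_le ?addr_ge0 ?bmx_norm_ge0//.
exact: (mboundD (mbound_norm A) (mbound_norm B)).
Qed.

Fact bmx_norm0_eq0 A : (bmx_norm A)%:C = 0 -> A = 0.
Proof.
move=> A0; apply: bmxP => i j; have := bmx_entry_le A i j.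
by rewrite A0 normr_le0 => /eqP ->.
Qed.

Fact bmx_normZ (z : C) A : (bmx_norm (z *: A))%:C = `|z| * (bmx_norm A)%:C.
Proof.
have le w B : bmx_norm (w *: B) <= complex.Re `|w| * bmx_norm B.
  apply: bmx_norm_le; last exact: (mboundZ w (mbound_norm B)).
  by rewrite mulr_ge0 ?bmx_norm_ge0// -ler0c -ge0_complexE.
have [->|z0] := eqVneq z 0.
  have := le 0 A; rewrite normr0 !mul0r => h.
  by apply/le_anti; rewrite lecR h ler0c bmx_norm_ge0.
apply/le_anti/andP; split.
  by rewrite [`|z|]ge0_complexE// -real_complexM lecR le.
have := le z^-1 (z *: A); rewrite scalerA mulVf// scale1r -lecR real_complexM -ge0_complexE//.
by rewrite normfV ler_pdivlMl// normr_gt0.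
Qed.

HB.instance Definition _ := @Lmodule_isNormed.Build C bmx
  (fun A => (bmx_norm A)%:C) bmx_normD bmx_normZ bmx_norm0_eq0.

End BoundedMatrices.

Section BoundedMatricesComplete.
Variable R : realType.
Local Notation C := R[i].
Local Notation bmx := (bmx R).
Implicit Types (A B : bmx) (m n : nat -> nat -> C) (x y r : nat -> C) (M : R).

Lemma norm_bmxE A : `|A| = (bmx_norm A)%:C.
Proof. by []. Qed.

Lemma bmxBE A B i j : (A - B) i j = A i j - B i j.
Proof. by []. Qed.

Lemma norm_entry_le A i j : `|A i j| <= `|A|.
Proof. exact: bmx_entry_le. Qed.

Lemma mform_cvg T (F : set_system T) {FF : Filter F} (f : T -> nat -> nat -> C) m N L y x :
  (forall i j, (fun t => f t i j) @ F --> m i j) ->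
  (fun t => mform (f t) N L y x) @ F --> mform m N L y x.
Proof.
move=> fm; rewrite /mform.
have sumC (I : Type) (s : seq I) (g : I -> T -> C) (l : I -> C) :
    (forall i, g i @ F --> l i) ->
    (fun t => \sum_(i <- s) g i t) @ F --> \sum_(i <- s) l i.
  move=> gl; elim: s => [|i s IH].
    rewrite big_nil; under eq_fun do rewrite big_nil.
    exact: cvg_cst.
  rewrite big_cons; under eq_fun do rewrite big_cons.
  exact: (cvg_complexD (gl i) IH).
apply: (sumC) => i; apply: (sumC) => j.
exact: (cvg_complexM (cvg_complexM (cvg_cst _) (fm i j)) (cvg_cst _)).
Qed.

Lemma mbound_limit T (F : set_system T) {FF : ProperFilter F} (f : T -> nat -> nat -> C) m M :
  (forall i j, (fun t => f t i j) @ F --> m i j) ->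
  (\forall t \near F, mbound (f t) M) -> mbound m M.
Proof.
move=> fm fM N L y x.
have h : (fun t => 2 * `|mform (f t) N L y x|) @ F --> 2 * `|mform m N L y x|.
  have h1 : (fun t => mform (f t) N L y x) @ F --> mform m N L y x.
    exact: mform_cvg.
  exact: (cvg_complexM (cvg_cst (2 : C)) (cvg_complex_norm h1)).
by apply: (cvg_complex_le h (cvg_cst _)); apply: filterS fM => t; exact.
Qed.

(** Entries are dominated by the norm, so a Cauchy filter has an entrywise limit. Bounds pass to
    entrywise limits, which gives both the boundedness of the limit and convergence in norm. *)
Lemma bmx_complete (F : set_system bmx) : ProperFilter F -> cauchy F -> cvg F.
Proof.
move=> FF /cauchyP Fc.
have Fex (e : C) : 0 < e -> exists A, F (ball A e).
  by move=> e0; apply: Fc.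
have centry i j : cvg ((fun A => A i j) @ F).
  apply: cauchy_cvg; apply: cauchy_exP => e e0.
  have [A FA] := Fex e e0; exists (A i j).
  rewrite /fmap /=; apply: filterS FA => B; rewrite -!ball_normE /= -bmxBE.
  by apply: le_lt_trans; exact: norm_entry_le.
pose m i j : C := lim ((fun A => A i j) @ F).
have Fm i j : (fun A : bmx => A i j) @ F --> m i j by exact: centry.
have near_m (e : R) : 0 < e -> \forall A \near F, mbound (bmx_val A - m) e.
  move=> e0; have e20 : 0 < (e / 2)%:C by rewrite ltcR divr_gt0.
  have [A FA] := Fex _ e20; apply: filterS (FA) => B AB.
  apply: (@mbound_limit _ F _ (fun A1 : bmx => bmx_val B - bmx_val A1)) => [i j|].
    exact: (cvg_complexB (cvg_cst _) (Fm i j)).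
  apply: filterS (FA) => A' AA'; rewrite -ball_normE /= in AB AA'.
  have : bmx_norm (B - A') <= e.
    rewrite -lecR -norm_bmxE -(subrKA A) (le_trans (ler_normD _ _))//.
    rewrite [e]splitr real_complexD.
    by apply: lerD; apply: ltW => //; rewrite distrC.
  by move=> h; exact: mbound_le h (mbound_norm (B - A')).
have mb : m \in @bounded_mx R.
  have [A Am] := filter_ex (near_m 1 ltr01).
  apply/bounded_mxP; exists (bmx_norm A + complex.Re `|-1 : C| * 1).
  have -> : m = bmx_val A + (-1) *: (bmx_val A - m).
    by rewrite scaleN1r opprB addrC subrK.
  by apply: mboundD; [exact: mbound_norm|exact: mboundZ].
apply/cvg_ex; exists (Bmx mb).
suff : id @ F --> Bmx mb by [].
apply/cvgrPdist_le => e e0.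
have e0' : 0 < complex.Re e by rewrite -ltcR -ge0_complexE// ltW.
apply: filterS (near_m _ e0') => A Am.
by rewrite distrC (ge0_complexE (ltW e0)) norm_bmxE lecR bmx_norm_le// ltW.
Qed.

HB.instance Definition _ := Uniform_isComplete.Build bmx bmx_complete.

End BoundedMatricesComplete.

(** * Products and adjoints of bounded matrices *)

Section BoundedMatrixProduct.
Variable R : realType.
Local Notation C := R[i].
Local Notation mx := (nat -> nat -> C).
Implicit Types (m : mx) (x y r : nat -> C) (M : R).

Lemma conjcM (z w : C) : conjc (z * w) = conjc z * conjc w.
Proof. exact: rmorphM. Qed.

Lemma conjc_sum I (s : seq I) (P : pred I) (F : I -> C) :
  conjc (\sum_(i <- s | P i) F i) = \sum_(i <- s | P i) conjc (F i).
Proof. exact: rmorph_sum. Qed.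

Lemma dominated_cvg (u : nat -> C) (s : nat -> R) (B : R) :
  (forall n, `|u n.+1 - u n| <= (s n.+1 - s n)%:C) -> (forall n, s n <= B) ->
  cvg (u @ \oo).
Proof.
move=> us sB.
have sS n : s n <= s n.+1.
  by have := le_trans (normr_ge0 _) (us n); rewrite ler0c subr_ge0.
have su n k : `|u (n + k)%N - u n| <= (s (n + k)%N - s n)%:C.
  elim: k => [|k IH]; first by rewrite addn0 !subrr normr0.
  rewrite addnS -(subrKA (u (n + k)%N)) (le_trans (ler_normD _ _))//.
  rewrite -(subrKA (s (n + k)%N) (s _)) real_complexD lerD//.
have cs : cvg (s @ \oo).
  apply: nondecreasing_is_cvgn; first exact/nondecreasing_seqP.
  by exists B => _ [n _ <-].
apply: cauchy_seq_cvg => e e0.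
have e0' : 0 < complex.Re e / 2 by rewrite divr_gt0// -ltcR -ge0_complexE// ltW.
have /cvgrPdist_lt /(_ _ e0')[N _ NP] := cs.
exists N => p q Np Nq; wlog pq : p q Np Nq / (p <= q)%N.
  move=> h; case: (leqP p q) => [|/ltnW] pq; first exact: h.
  by rewrite distrC; exact: h.
rewrite distrC -(subnKC pq) (le_lt_trans (su _ _))// (ge0_complexE (ltW e0)) ltcR.
rewrite subnKC// (le_lt_trans (ler_norm _))//.
rewrite -(subrKA (limn s)) (le_lt_trans (ler_normD _ _))// [ltRHS]splitr ltrD//.
  by rewrite distrC; exact: NP.
exact: NP.
Qed.

(** The form is tested against y = t v, where v is the image of x; t = 1 / M gives the sharp
    estimate. *)
Lemma mbound_column m M N L x : 0 <= M -> mbound m M ->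
  sqsum N (fun i => \sum_(j < L) m i j * x j) <= (M ^+ 2)%:C * sqsum L x.
Proof.
move=> M0 mM; set v := fun i => _; set T := sqsum N v.
have T0 : 0 <= T by exact: sqsum_ge0.
have form (t : R) : mform m N L (fun i => t%:C * v i) x = t%:C * T.
  rewrite /mform /T /sqsum mulr_sumr; apply: eq_bigr => i _.
  rewrite -[LHS](_ : \sum_(j < L) (conjc (t%:C * v i)) * (m i j * x j) = _); last first.
    by apply: eq_bigr => j _; rewrite mulrA.
  by rewrite -mulr_sumr -/(v i) conjcM conjc_real sqr_normc; ring.
have sqt (t : R) : sqsum N (fun i => t%:C * v i) = (t ^+ 2)%:C * T.
  rewrite /T /sqsum mulr_sumr; apply: eq_bigr => i _.
  by rewrite normrM exprMn -normrX -rmorphXn /= ger0_norm// ler0c sqr_ge0.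
have E (t : R) : 0 <= t -> 2 * (t%:C * T) <= M%:C * (sqsum L x + (t ^+ 2)%:C * T).
  move=> t0; have := mM N L (fun i => t%:C * v i) x.
  by rewrite form sqt ger0_norm// mulr_ge0// ler0c.
have [M00|M00] := eqVneq M 0.
  have := E 1 ler01; rewrite M00 mul0r expr0n /= mul0r mul1r.
  by rewrite pmulr_rle0.
have Mp : 0 < M by rewrite lt_neqAle eq_sym M00.
have := E M^-1; rewrite invr_ge0 => /(_ M0).
have s0 := sqsum_ge0 L x.
rewrite (ge0_complexE T0) (ge0_complexE s0).
rewrite -(rmorph_nat (real_complex R) 2) -!rmorphM -rmorphD -!rmorphM !lecR => h.
have : M * (2 * (M^-1 * complex.Re T)) <= M * (M * (complex.Re (sqsum L x) + M^-1 ^+ 2 * complex.Re T)).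
  by rewrite ler_wpM2l.
have -> : M * (2 * (M^-1 * complex.Re T)) = 2 * complex.Re T by field.
have -> : M * (M * (complex.Re (sqsum L x) + M^-1 ^+ 2 * complex.Re T)) =
  M ^+ 2 * complex.Re (sqsum L x) + complex.Re T by field.
by rewrite mulr_natl mulr2n lerD2r.
Qed.

(** The converse of [mbound_column], from 2 p q <= M p^2 + q^2 / M. *)
Lemma column_mbound m M : 0 <= M ->
  (forall N L x, sqsum N (fun i => \sum_(j < L) m i j * x j) <= (M ^+ 2)%:C * sqsum L x) ->
  mbound m M.
Proof.
move=> M0 mM N L y x; set v := fun i => \sum_(j < L) m i j * x j.
have -> : mform m N L y x = \sum_(i < N) conjc (y i) * v i.
  by apply: eq_bigr => i _; rewrite mulr_sumr; apply: eq_bigr => j _; rewrite mulrA.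
have vM : sqsum N v <= (M ^+ 2)%:C * sqsum L x by exact: mM.
have [M00|M00] := eqVneq M 0.
  have v0 (i : 'I_N) : v i = 0.
    have : sqsum N v <= 0 by rewrite (le_trans vM)// M00 expr0n /= mul0r.
    move=> h; have /eqP : sqsum N v = 0 by apply/le_anti; rewrite h sqsum_ge0.
    rewrite psumr_eq0 => [/allP/(_ i (mem_index_enum i))|k _]; last by rewrite exprn_ge0.
    by rewrite expf_eq0 /= normr_eq0 => /eqP.
  by rewrite big1 ?normr0 ?mulr0 ?M00 ?mul0r// => i _; rewrite v0 mulr0.
have Mp : 0 < M by rewrite lt_neqAle eq_sym M00.
rewrite (@le_trans _ _ (\sum_(i < N) (M%:C * `|y i| ^+ 2 + (M^-1)%:C * `|v i| ^+ 2)))//.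
  rewrite (le_trans (ler_wpM2l _ (ler_norm_sum _ _ _)))// mulr_sumr ler_sum// => i _.
  rewrite normrM normcJ (ge0_complexE (normr_ge0 (y i))) (ge0_complexE (normr_ge0 (v i))).
  rewrite -(rmorph_nat (real_complex R) 2) -!rmorphXn -!rmorphM -rmorphD lecR.
  rewrite -subr_ge0; set p := complex.Re _; set q := complex.Re _.
  have -> : M * p ^+ 2 + M^-1 * q ^+ 2 - 2 * (p * q) = M * (p - M^-1 * q) ^+ 2 by field.
  by rewrite mulr_ge0// sqr_ge0.
rewrite big_split /= -!mulr_sumr mulrDr addrC lerD//.
rewrite -/(sqsum N v) -(ler_pM2l (_ : 0 < M%:C)) ?ltcR//.
rewrite [leLHS]mulrA -real_complexM divff// mul1r.
by rewrite [leRHS]mulrA -real_complexM -expr2.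
Qed.

Definition madj m : nat -> nat -> C := fun i j => conjc (m j i).

Lemma mform_adj m N L y x : mform (madj m) N L y x = conjc (mform m L N x y).
Proof.
rewrite /mform exchange_big conjc_sum; apply: eq_bigr => i _.
rewrite conjc_sum; apply: eq_bigr => j _.
by rewrite !conjcM conjcK /madj; ring.
Qed.

Lemma mbound_adj m M : mbound m M -> mbound (madj m) M.
Proof. by move=> mM N L y x; rewrite mform_adj normcJ addrC. Qed.

Lemma mbound_col m M N j : 0 <= M -> mbound m M -> sqsum N (m^~ j) <= (M ^+ 2)%:C.
Proof.
move=> M0 mM; have := @mbound_column m M N j.+1 (fun k => (k == j)%:R) M0 mM.
rewrite sqsum_delta mulr1; congr (_ <= _); apply: eq_bigr => i _.
rewrite (bigD1 ord_max)//= [X in _ + X]big1 ?addr0 ?eqxx ?mulr1//.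
by move=> k ki; rewrite -val_eqE /= in ki; rewrite (negbTE ki) mulr0.
Qed.

Lemma mbound_row m M N i : 0 <= M -> mbound m M -> sqsum N (m i) <= (M ^+ 2)%:C.
Proof.
move=> M0 /mbound_adj mM; have := @mbound_col _ _ N i M0 mM.
by congr (_ <= _); apply: eq_bigr => k _; rewrite /madj normcJ.
Qed.

(** For bounded matrices the limit exists, since their rows and columns are square summable; see
    [mmul_cvg]. *)
Definition mmul (m n : mx) : nat -> nat -> C := fun i j =>
  lim ((fun K => \sum_(k < K) m i k * n k j) @ \oo).

Lemma sqsumS N x : sqsum N.+1 x = sqsum N x + `|x N| ^+ 2.
Proof. exact: big_ord_recr. Qed.

Lemma l2_cvg x y (B : R) : (forall N, sqsum N x <= B%:C) -> (forall N, sqsum N y <= B%:C) ->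
  cvg ((fun K => \sum_(k < K) x k * y k) @ \oo).
Proof.
move=> xB yB.
pose s N := complex.Re (sqsum N x) + complex.Re (sqsum N y).
apply: (@dominated_cvg _ s (B + B)) => [N|N]; last first.
  by rewrite lerD// -lecR -ge0_complexE// sqsum_ge0.
rewrite big_ord_recr /= [X in `|X|]addrC addKr.
have -> : (s N.+1 - s N)%:C = `|x N| ^+ 2 + `|y N| ^+ 2.
  rewrite /s !sqsumS !ReD [X in X%:C](_ : _ = complex.Re (`|x N| ^+ 2) + complex.Re (`|y N| ^+ 2)); last by ring.
  by rewrite real_complexD -!ge0_complexE// exprn_ge0.
rewrite normrM; set p := `|x N|; set q := `|y N|.
have p0 : 0 <= p by exact: normr_ge0.
have q0 : 0 <= q by exact: normr_ge0.
rewrite (ge0_complexE p0) (ge0_complexE q0) -!rmorphXn -rmorphM -rmorphD lecR.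
by nra.
Qed.

Lemma mmul_cvg (m n : mx) M M' i j : 0 <= M -> 0 <= M' -> mbound m M -> mbound n M' ->
  (fun K => \sum_(k < K) m i k * n k j) @ \oo --> mmul m n i j.
Proof.
move=> M0 M0' mM nM.
suff : cvg ((fun K => \sum_(k < K) m i k * n k j) @ \oo) by [].
apply: (@l2_cvg (m i) (n^~ j) (M ^+ 2 + M' ^+ 2)) => N.
  by rewrite (le_trans (mbound_row _ _ M0 mM))// lecR lerDl sqr_ge0.
by rewrite (le_trans (mbound_col _ _ M0' nM))// lecR lerDr sqr_ge0.
Qed.

Lemma mform_mul_cvg (m n : mx) M M' N L y x : 0 <= M -> 0 <= M' -> mbound m M -> mbound n M' ->
  (fun K => \sum_(k < K) conjc (\sum_(i < N) madj m k i * y i) *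
     (\sum_(j < L) n k j * x j)) @ \oo --> mform (mmul m n) N L y x.
Proof.
move=> M0 M0' mM nM.
rewrite [X in X @ \oo](_ : _ =
    (fun K => mform (fun i j => \sum_(k < K) m i k * n k j) N L y x)).
  apply: (mform_cvg (f := fun K i j => \sum_(k < K) m i k * n k j)) => i j.
  exact: (mmul_cvg M0 M0' mM nM).
apply/funext => K; rewrite /mform.
under eq_bigr do rewrite conjc_sum mulr_suml.
rewrite exchange_big; apply: eq_bigr => i _.
under eq_bigr do rewrite mulr_sumr.
rewrite exchange_big; apply: eq_bigr => j _.
rewrite mulr_sumr mulr_suml; apply: eq_bigr => k _.
by rewrite conjcM /madj conjcK; ring.
Qed.

Lemma mbound_mul (m n : mx) M M' : 0 < M -> 0 < M' -> mbound m M -> mbound n M' ->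
  mbound (mmul m n) (M * M').
Proof.
move=> M0 M0' mM nM N L y x.
have h := @mform_mul_cvg m n M M' N L y x (ltW M0) (ltW M0') mM nM.
have h2 : (fun K => 2 * `|\sum_(k < K) conjc (\sum_(i < N) madj m k i * y i) *
     (\sum_(j < L) n k j * x j)|) @ \oo --> 2 * `|mform (mmul m n) N L y x|.
  exact: (cvg_complexM (cvg_cst (2 : C)) (cvg_complex_norm h)).
apply: (cvg_complex_le h2 (cvg_cst _)); apply: nearW => K.
pose p k := \sum_(i < N) madj m k i * y i; pose q k := \sum_(j < L) n k j * x j.
have pP : sqsum K p <= (M ^+ 2)%:C * sqsum N y.
  by apply: mbound_column; [exact: ltW|exact: mbound_adj].
have qP : sqsum K q <= (M' ^+ 2)%:C * sqsum L x.
  by apply: mbound_column; [exact: ltW|exact: nM].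
(* The weights balance the two column bounds: (M' / M) M^2 = M M' = (M / M') M'^2. *)
rewrite (@le_trans _ _ ((M' / M)%:C * sqsum K p + (M / M')%:C * sqsum K q))//.
  rewrite /sqsum !mulr_sumr -big_split /=.
  rewrite (le_trans (ler_wpM2l _ (ler_norm_sum _ _ _)))// mulr_sumr ler_sum// => k _.
  rewrite normrM normcJ -/(p k) -/(q k).
  rewrite (ge0_complexE (normr_ge0 (p k))) (ge0_complexE (normr_ge0 (q k))).
  rewrite -(rmorph_nat (real_complex R) 2) -!rmorphXn -!rmorphM -rmorphD lecR.
  rewrite -subr_ge0; set s := complex.Re _; set t := complex.Re _.
  have -> : M' / M * s ^+ 2 + M / M' * t ^+ 2 - 2 * (s * t) =
    M' / M * (s - M / M' * t) ^+ 2 by field; rewrite !gt_eqF.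
  by rewrite mulr_ge0 ?sqr_ge0// divr_ge0// ltW.
have hq : (M / M')%:C * sqsum K q <= (M * M')%:C * sqsum L x.
  have -> : (M * M')%:C = (M / M')%:C * (M' ^+ 2)%:C.
    by rewrite -real_complexM; congr _%:C; field; rewrite gt_eqF.
  by rewrite -mulrA ler_wpM2l// ler0c divr_ge0 ?ltW.
have hp : (M' / M)%:C * sqsum K p <= (M * M')%:C * sqsum N y.
  have -> : (M * M')%:C = (M' / M)%:C * (M ^+ 2)%:C.
    by rewrite -real_complexM; congr _%:C; field; rewrite gt_eqF.
  by rewrite -mulrA ler_wpM2l// ler0c divr_ge0 ?ltW.
by rewrite addrC mulrDr; exact: lerD.
Qed.

(** The nontrivial half of the C*-identity: |m x|^2 = <x, m^* m x> <= B^2 |x|^2. *)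
Lemma mbound_star m M B : 0 <= M -> mbound m M -> mbound (mmul (madj m) m) (B ^+ 2) ->
  0 <= B -> mbound m B.
Proof.
move=> M0 mM mB B0; apply: column_mbound => // N L x.
have h := @mform_mul_cvg (madj m) m M M L L x x M0 M0 (mbound_adj mM) mM.
have mm : madj (madj m) = m.
  by apply/funext => i; apply/funext => j; rewrite /madj conjcK.
rewrite mm in h.
have le2 : `|mform (mmul (madj m) m) L L x x| <= (B ^+ 2)%:C * sqsum L x.
  have := mB L L x x; set f := `|_|; set s := sqsum L x.
  have -> : (B ^+ 2)%:C * (s + s) = 2 * ((B ^+ 2)%:C * s) by ring.
  by rewrite ler_pM2l.
have {}h : (fun K => sqsum K (fun k => \sum_(j < L) m k j * x j)) @ \oo -->
    mform (mmul (madj m) m) L L x x.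
  suff -> : (fun K => sqsum K (fun k => \sum_(j < L) m k j * x j)) =
      (fun K => \sum_(k < K) conjc (\sum_(j < L) m k j * x j) *
        (\sum_(j < L) m k j * x j)) by exact: h.
  apply/funext => K; apply: eq_bigr => k _.
  by rewrite sqr_normc mulrC.
have h' := cvg_complex_norm h.
rewrite -[leLHS]ger0_norm ?sqsum_ge0// (le_trans _ le2)//.
apply: (cvg_complex_le (cvg_cst _) (h' _)).
exists N => // K /= NK; rewrite !ger0_norm ?sqsum_ge0//.
rewrite -(subnKC NK); elim: (K - N)%N => [|k IH]; first by rewrite addn0.
by rewrite addnS sqsumS (le_trans IH)// lerDl exprn_ge0.
Qed.

End BoundedMatrixProduct.

(** * Associativity of the product, and matrices of partial injections *)

Section BoundedMatrixAlgebra.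
Variable R : realType.
Local Notation C := R[i].
Local Notation mx := (nat -> nat -> C).
Local Notation bmx := (bmx R).
Implicit Types (m : mx) (x y r : nat -> C) (M : R) (A B : bmx).

(** The tail of D in the first index is small uniformly in the second, so the iterated limits
    agree. *)
Lemma exchange_limits (D : nat -> nat -> C) (a b : nat -> C) (alpha beta : C) :
  (forall K, D K @ \oo --> a K) -> (forall L, D^~ L @ \oo --> b L) ->
  a @ \oo --> alpha -> b @ \oo --> beta ->
  (forall e : C, 0 < e -> exists K0, forall K k L, (K0 <= K)%N ->
     `|D (K + k)%N L - D K L| <= e) -> alpha = beta.
Proof.
move=> Da Db aa bb Du; apply/eqP; rewrite -subr_eq0 -normr_le0.
have le (e : C) : 0 < e -> `|alpha - beta| <= e.
  move=> e0; have [K0 KP] := Du e e0.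
  have h1 K L : (K0 <= K)%N -> `|b L - D K L| <= e.
    move=> K0K.
    have h : (fun k => `|D k L - D K L|) @ \oo --> `|b L - D K L|.
      exact: (cvg_complex_norm (cvg_complexB (Db L) (cvg_cst (D K L)))).
    apply: (cvg_complex_le h (cvg_cst e)); exists K => // k /= Kk.
    by rewrite -(subnKC Kk) KP.
  have h2 K : (K0 <= K)%N -> `|beta - a K| <= e.
    move=> K0K.
    have h : (fun L => `|b L - D K L|) @ \oo --> `|beta - a K|.
      exact: (cvg_complex_norm (cvg_complexB bb (Da K))).
    by apply: (cvg_complex_le h (cvg_cst e)); apply: nearW => L; exact: h1.
  have h : (fun K => `|beta - a K|) @ \oo --> `|beta - alpha|.
    exact: (cvg_complex_norm (cvg_complexB (cvg_cst beta) aa)).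
  rewrite distrC.
  by apply: (cvg_complex_le h (cvg_cst e)); exists K0 => // K /= K0K; exact: h2.
have := normr_ge0 (alpha - beta); rewrite le_eqVlt => /orP[/eqP <-//|h].
have := le _ (divr_gt0 h (ltr0n _ 2)).
by rewrite ler_pdivlMr// ger_pMr// -[leRHS]/1 lern1.
Qed.

Lemma sqsum_tail x (B e : R) : (forall N, sqsum N x <= B%:C) -> 0 < e ->
  exists K0, forall K k, (K0 <= K)%N -> sqsum (K + k) x - sqsum K x <= e%:C.
Proof.
move=> xB e0; pose s N := complex.Re (sqsum N x).
have sE N : sqsum N x = (s N)%:C by exact/ge0_complexE/sqsum_ge0.
have cs : cvg (s @ \oo).
  apply: nondecreasing_is_cvgn.
    apply/nondecreasing_seqP => n.
    by rewrite -lecR -!sE sqsumS lerDl exprn_ge0.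
  by exists B => _ [n _ <-]; rewrite -lecR -sE.
have e20 : 0 < e / 2 by rewrite divr_gt0.
have /cvgrPdist_lt /(_ _ e20)[N _ NP] := cs.
exists N => K k NK; rewrite !sE -rmorphB lecR.
have h1 := NP _ NK; have h2 := NP _ (leq_trans NK (leq_addr k K)).
move: h1 h2 => /=; rewrite !ltr_norml => /andP[? ?] /andP[? ?].
by lra.
Qed.

(** Both entries are iterated limits of the same truncated double sums. Uniformity holds because row
    i of m has small tails, while the truncated columns of n p are bounded in the square norm
    independently of the truncation. *)
Lemma mmul_assoc (m n p : mx) M M' M'' : 0 < M -> 0 < M' -> 0 < M'' ->
  mbound m M -> mbound n M' -> mbound p M'' ->
  mmul m (mmul n p) = mmul (mmul m n) p.
Proof.
move=> M0 M0' M0'' mM nM pM; apply/funext => i; apply/funext => j.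
pose D K L := \sum_(k < K) \sum_(l < L) m i k * n k l * p l j.
have mn := mbound_mul M0 M0' mM nM; have np := mbound_mul M0' M0'' nM pM.
apply: (@exchange_limits D (fun K => \sum_(k < K) m i k * mmul n p k j)
   (fun L => \sum_(l < L) mmul m n i l * p l j)).
- move=> K; rewrite /D.
  have sumC (g : nat -> nat -> C) (l : nat -> C) (s : seq 'I_K) :
      (forall k, g k @ \oo --> l k) ->
      (fun t => \sum_(k <- s) g k t) @ \oo --> \sum_(k <- s) l k.
    move=> gl; elim: s => [|k s IH].
      by rewrite big_nil; under eq_fun do rewrite big_nil; exact: cvg_cst.
    rewrite big_cons; under eq_fun do rewrite big_cons.
    exact: (cvg_complexD (gl k) IH).
  apply: (sumC (fun k L => \sum_(l < L) m i k * n k l * p l j)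
    (fun k => m i k * mmul n p k j)) => k.
  under eq_fun do (under eq_bigr do rewrite -mulrA; rewrite -mulr_sumr).
  exact: (cvg_complexM (cvg_cst (m i k)) (mmul_cvg (ltW M0') (ltW M0'') nM pM)).
- move=> L; rewrite /D.
  have sumC (g : nat -> nat -> C) (l : nat -> C) (s : seq 'I_L) :
      (forall k, g k @ \oo --> l k) ->
      (fun t => \sum_(k <- s) g k t) @ \oo --> \sum_(k <- s) l k.
    move=> gl; elim: s => [|k s IH].
      by rewrite big_nil; under eq_fun do rewrite big_nil; exact: cvg_cst.
    rewrite big_cons; under eq_fun do rewrite big_cons.
    exact: (cvg_complexD (gl k) IH).
  under eq_fun do rewrite exchange_big.
  apply: (sumC (fun l K => \sum_(k < K) m i k * n k l * p l j)
    (fun l => mmul m n i l * p l j)) => l.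
  under eq_fun do rewrite -mulr_suml.
  exact: (cvg_complexM (mmul_cvg (ltW M0) (ltW M0') mM nM) (cvg_cst (p l j))).
- exact: (mmul_cvg (ltW M0) (ltW (mulr_gt0 M0' M0'')) mM np).
- exact: (mmul_cvg (ltW (mulr_gt0 M0 M0')) (ltW M0'') mn pM).
move=> e e0; rewrite (ge0_complexE (ltW e0)); set e' := complex.Re e.
have e0' : 0 < e' by rewrite -ltcR -ge0_complexE// ltW.
(* Cauchy-Schwarz in the form 2 u v <= s u^2 + v^2 / s, with s chosen so that the
   second summand is at most e *)
pose Q := (M' * M'') ^+ 2; have Q0 : 0 < Q by rewrite exprn_gt0// mulr_gt0.
pose s := Q / e'; have s0 : 0 < s by rewrite divr_gt0.
have [K0 KP] := sqsum_tail (fun N => mbound_row N i (ltW M0) mM) (divr_gt0 e0' s0).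
exists K0 => K k L K0K; pose v t := \sum_(l < L) n t l * p l j.
have vP N : sqsum N v <= Q%:C.
  apply: le_trans (mbound_column N L (p^~ j) (ltW M0') nM) _.
  rewrite /Q exprMn [leRHS]real_complexM ler_wpM2l ?ler0c ?sqr_ge0//.
  exact: mbound_col (ltW M0'') pM.
have -> : D (K + k)%N L - D K L = \sum_(t < k) m i (K + t)%N * v (K + t)%N.
  rewrite /D big_split_ord /= addrAC subrr add0r; apply: eq_bigr => t _.
  by rewrite mulr_sumr; apply: eq_bigr => l _; rewrite mulrA.
have vtail : \sum_(t < k) `|v (K + t)%N| ^+ 2 <= Q%:C.
  apply: le_trans (vP (K + k)%N); rewrite /sqsum big_split_ord /= lerDr.
  by apply: sumr_ge0 => t _; rewrite exprn_ge0.
have mtail : \sum_(t < k) `|m i (K + t)%N| ^+ 2 <= (e' / s)%:C.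
  apply: le_trans (KP K k K0K); rewrite /sqsum big_split_ord /= addrAC subrr add0r.
  exact: lexx.
rewrite -(ler_pM2l (ltr0n _ 2)) (le_trans (ler_wpM2l _ (ler_norm_sum _ _ _)))//.
rewrite mulr_sumr (@le_trans _ _ (\sum_(t < k) (s%:C * `|m i (K + t)%N| ^+ 2 +
    (s^-1)%:C * `|v (K + t)%N| ^+ 2)))//.
  apply: ler_sum => t _; rewrite normrM.
  set u := `|m i _|; set w := `|v _|.
  have u0 : 0 <= u by exact: normr_ge0.
  have w0 : 0 <= w by exact: normr_ge0.
  rewrite (ge0_complexE u0) (ge0_complexE w0).
  rewrite -(rmorph_nat (real_complex R) 2) -!rmorphXn -!rmorphM -rmorphD lecR -subr_ge0.
  set u' := complex.Re u; set w' := complex.Re w.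
  have -> : s * u' ^+ 2 + s^-1 * w' ^+ 2 - 2 * (u' * w') = s * (u' - s^-1 * w') ^+ 2.
    by field; rewrite gt_eqF.
  by rewrite mulr_ge0 ?sqr_ge0// ltW.
rewrite big_split /= -!mulr_sumr.
have -> : 2 * e'%:C = s%:C * (e' / s)%:C + (s^-1)%:C * Q%:C.
  rewrite -!real_complexM -real_complexD -(rmorph_nat (real_complex R) 2) -real_complexM.
  congr _%:C; rewrite /s; field.
  by rewrite !gt_eqF//.
by apply: lerD; rewrite ler_wpM2l// ler0c ?invr_ge0 ltW.
Qed.

Definition pmx (rho : nat -> nat -> Prop) : mx := fun i j => (`[< rho i j >])%:R.

Definition partial_injection (rho : nat -> nat -> Prop) : Prop :=
  (forall i j j', rho i j -> rho i j' -> j = j') /\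
  (forall i i' j, rho i j -> rho i' j -> i = i').

Lemma sum_unique_le1 (p : nat -> Prop) L : (forall j j', p j -> p j' -> j = j') ->
  \sum_(j < L) (`[< p j >])%:R <= 1 :> C.
Proof.
move=> pu; have [[j pj]|nop] := pselect (exists j : 'I_L, p j).
  rewrite (bigD1 j)//= [X in _ + X]big1 ?addr0 ?lern1 ?leq_b1// => k kj.
  by case: asboolP => // pk; move: kj; rewrite -val_eqE /= (pu _ _ pk pj) eqxx.
rewrite big1 ?ler01// => j _; case: asboolP => // pj.
by exfalso; apply: nop; exists j.
Qed.

(** Every row and every column has at most one nonzero entry, and 2 |y_i| |x_j| <= |x_j|^2 +
    |y_i|^2. *)
Lemma pmx_bound rho : partial_injection rho -> mbound (pmx rho) 1.
Proof.
move=> [rhol rhor] N L y x; rewrite mul1r.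
rewrite (@le_trans _ _ (\sum_(i < N) \sum_(j < L)
    (pmx rho i j * `|x j| ^+ 2 + pmx rho i j * `|y i| ^+ 2)))//.
  rewrite (le_trans (ler_wpM2l _ (ler_norm_sum _ _ _)))// mulr_sumr ler_sum// => i _.
  rewrite (le_trans (ler_wpM2l _ (ler_norm_sum _ _ _)))// mulr_sumr ler_sum// => j _.
  rewrite !normrM normcJ /pmx normr_nat -mulrDr.
  rewrite [2 * _](_ : _ = (`[< rho i j >])%:R * (2 * `|y i| * `|x j|)); last by ring.
  rewrite ler_wpM2l//; set u := `|y i|; set w := `|x j|.
  have u0 : 0 <= u by exact: normr_ge0.
  have w0 : 0 <= w by exact: normr_ge0.
  rewrite (ge0_complexE u0) (ge0_complexE w0).
  rewrite -(rmorph_nat (real_complex R) 2) -!rmorphXn -!rmorphM -rmorphD lecR -subr_ge0.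
  set u' := complex.Re u; set w' := complex.Re w.
  by rewrite [X in 0 <= X](_ : _ = (w' - u') ^+ 2) ?sqr_ge0//; ring.
under eq_bigr do rewrite big_split.
rewrite big_split /= lerD//.
  rewrite exchange_big /= ler_sum// => j _; rewrite -mulr_suml.
  rewrite -[leRHS]mul1r ler_wpM2r ?exprn_ge0//.
  by apply: (sum_unique_le1 (p := rho^~ j)) => i i'; exact: rhor.
rewrite ler_sum// => i _; rewrite -mulr_suml.
rewrite -[leRHS]mul1r ler_wpM2r ?exprn_ge0//.
by apply: (sum_unique_le1 (p := rho i)) => j j'; exact: rhol.
Qed.

Lemma pmx_mul (rho sigma : nat -> nat -> Prop) :
  (forall i j j', rho i j -> rho i j' -> j = j') ->
  mmul (pmx rho) (pmx sigma) = pmx (fun i j => exists k, rho i k /\ sigma k j).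
Proof.
move=> rhol; apply/funext => i; apply/funext => j.
have sumE (c : C) K0 : (forall K, (K0 <= K)%N ->
    \sum_(k < K) pmx rho i k * pmx sigma k j = c) -> mmul (pmx rho) (pmx sigma) i j = c.
  move=> h; apply: (cvg_lim (@norm_hausdorff _ C)).
  have hc : (fun=> c : C) @ \oo --> c by exact: cvg_cst.
  apply: (cvg_trans _ hc); apply: near_eq_cvg.
  by exists K0 => // K /h ->.
rewrite [RHS]/pmx; case: asboolP => [[k [ik kj]]|nk].
  apply: (sumE _ k.+1) => K kK; rewrite (bigD1 (Ordinal kK))//= big1 ?addr0.
    by rewrite /pmx !asboolT// mulr1.
  move=> l lk; rewrite /pmx; case: asboolP => il; last by rewrite mul0r.
  by move: lk; rewrite -val_eqE /= (rhol _ _ _ il ik) eqxx.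
apply: (sumE _ 0) => K _; rewrite big1// => l _; rewrite /pmx.
case: asboolP => il; last by rewrite mul0r.
case: asboolP => lj; last by rewrite mulr0.
by exfalso; apply: nk; exists l.
Qed.

Lemma pmx_adj rho : madj (pmx rho) = pmx (fun i j => rho j i).
Proof. by apply/funext => i; apply/funext => j; rewrite /madj /pmx conjc_nat. Qed.

End BoundedMatrixAlgebra.

(** * The C*-algebra of bounded matrices *)

Section BoundedMatrixCStar.
Variable R : realType.
Local Notation C := R[i].
Local Notation mx := (nat -> nat -> C).
Local Notation bmx := (bmx R).
Implicit Types (A B : bmx).

Lemma bmx_norm1_gt0 A : 0 < bmx_norm A + 1.
Proof. by rewrite ltr_wpDl// bmx_norm_ge0. Qed.

Lemma mbound_norm1 A : mbound A (bmx_norm A + 1).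
Proof. by apply: mbound_le (mbound_norm A); rewrite lerDl. Qed.

Fact bmx_mul_subproof A B : mmul A B \in @bounded_mx R.
Proof.
apply/bounded_mxP; exists ((bmx_norm A + 1) * (bmx_norm B + 1)).
by apply: mbound_mul; rewrite ?bmx_norm1_gt0//; exact: mbound_norm1.
Qed.

Definition bmx_mul A B : bmx := Bmx (bmx_mul_subproof A B).

Fact bmx_adj_subproof A : madj A \in @bounded_mx R.
Proof.
by apply/bounded_mxP; exists (bmx_norm A); apply: mbound_adj; exact: mbound_norm.
Qed.

Definition bmx_adj A : bmx := Bmx (bmx_adj_subproof A).

Fact pmx_subproof rho : partial_injection rho -> pmx R rho \in @bounded_mx R.
Proof. by move=> rhoP; apply/bounded_mxP; exists 1; exact: pmx_bound. Qed.

Definition bmx_pinj rho (rhoP : partial_injection rho) : bmx := Bmx (pmx_subproof rhoP).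

Fact partial_injection_id : partial_injection (fun i j : nat => i = j).
Proof. by split=> [i j j' <-|i i' j ->]. Qed.

Definition bmx_one : bmx := bmx_pinj partial_injection_id.

Lemma bmx_mul_cvg A B i j :
  (fun K => \sum_(k < K) A i k * B k j) @ \oo --> bmx_mul A B i j.
Proof. exact: (mmul_cvg (bmx_norm_ge0 A) (bmx_norm_ge0 B) (mbound_norm A) (mbound_norm B)). Qed.

Lemma bmx_mulE A B i j (c : C) :
  (fun K => \sum_(k < K) A i k * B k j) @ \oo --> c -> bmx_mul A B i j = c.
Proof. by move=> h; exact: (cvg_unique (@norm_hausdorff _ C) (bmx_mul_cvg (i := i) (j := j)) h). Qed.

Fact bmx_mulA : associative bmx_mul.
Proof.
move=> A B D; apply/val_inj.
exact: (mmul_assoc (bmx_norm1_gt0 A) (bmx_norm1_gt0 B) (bmx_norm1_gt0 D)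
  (mbound_norm1 A) (mbound_norm1 B) (mbound_norm1 D)).
Qed.

Fact bmx_mul1l : left_id bmx_one bmx_mul.
Proof.
move=> A; apply: bmxP => i j; apply: bmx_mulE.
have hc : (fun=> A i j : C) @ \oo --> A i j by exact: cvg_cst.
apply: (cvg_trans _ hc); apply: near_eq_cvg; exists i.+1 => // K /= iK.
rewrite (bigD1 (Ordinal iK))//= big1 ?addr0.
  by rewrite /pmx asboolT// mul1r.
move=> k ki; rewrite /pmx; case: asboolP => ik; last by rewrite mul0r.
by move: ki; rewrite -val_eqE /= -ik eqxx.
Qed.

Lemma bmx_adjK : involutive bmx_adj.
Proof. by move=> A; apply: bmxP => i j; rewrite /= /madj conjcK. Qed.

Fact bmx_adjM A B : bmx_adj (bmx_mul A B) = bmx_mul (bmx_adj B) (bmx_adj A).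
Proof.
apply: bmxP => i j; apply/esym/bmx_mulE.
suff -> : (fun K => \sum_(k < K) bmx_adj B i k * bmx_adj A k j) =
  (fun K => conjc (\sum_(k < K) A j k * B k i)).
  exact: (cvg_complex_conj (bmx_mul_cvg (i := j) (j := i))).
apply/funext => K; rewrite conjc_sum; apply: eq_bigr => k _.
by rewrite conjcM mulrC.
Qed.

Lemma bmx_adj1 : bmx_adj bmx_one = bmx_one.
Proof. by apply: bmxP => i j; rewrite /= pmx_adj /pmx; congr (nat_of_bool _)%:R; apply/asbool_equiv_eq; split. Qed.

Fact bmx_mul1r : right_id bmx_one bmx_mul.
Proof.
move=> A; rewrite -[LHS]bmx_adjK bmx_adjM bmx_adj1 bmx_mul1l; exact: bmx_adjK.
Qed.

Lemma bmx0E i j : (0 : bmx) i j = 0.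
Proof. by []. Qed.

Lemma bmxZDE (z : C) A B i j : (z *: A + B) i j = z * A i j + B i j.
Proof. by []. Qed.

Fact bmx_mul_linearl B : linear (bmx_mul^~ B).
Proof.
move=> z A A'; apply: bmxP => i j; apply: bmx_mulE.
have -> : (fun K => \sum_(k < K) (z *: A + A') i k * B k j) =
  (fun K => z * (\sum_(k < K) A i k * B k j) + \sum_(k < K) A' i k * B k j).
  apply/funext => K; rewrite mulr_sumr -big_split; apply: eq_bigr => k _.
  by rewrite bmxZDE mulrDl mulrA.
exact: (cvg_complexD (cvg_complexM (cvg_cst z) (bmx_mul_cvg (i := i) (j := j)))
  (bmx_mul_cvg (i := i) (j := j))).
Qed.

Fact bmx_adj_antilinear (z : C) A B :
  bmx_adj (z *: A + B) = z^*%R *: bmx_adj A + bmx_adj B.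
Proof.
apply: bmxP => i j; rewrite bmxZDE -[LHS]/(conjc ((z *: A + B) j i)) bmxZDE.
by rewrite -[RHS]/(conjc z * conjc (A j i) + conjc (B j i)) -conjcM -[RHS]rmorphD.
Qed.

Fact bmx_mul_linearr B : linear (bmx_mul B).
Proof.
move=> z A A'; rewrite -[LHS]bmx_adjK bmx_adjM bmx_adj_antilinear bmx_mul_linearl.
rewrite bmx_adj_antilinear !bmx_adjM !bmx_adjK; congr (_ *: _ + _).
exact: conjcK.
Qed.

Lemma norm_bmx_adj A : `|bmx_adj A| = `|A|.
Proof.
have le B : `|bmx_adj B| <= `|B|.
  rewrite !norm_bmxE lecR; apply: bmx_norm_le; first exact: bmx_norm_ge0.
  exact/mbound_adj/mbound_norm.
by apply/le_anti; rewrite le -{1}(bmx_adjK A) le.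
Qed.

Fact norm_bmx_mul A B : `|bmx_mul A B| <= `|A| * `|B|.
Proof.
have zero D D' : (D = 0 \/ D' = 0) -> bmx_mul D D' = 0.
  move=> DD; apply: bmxP => i j; apply: bmx_mulE.
  have -> : (fun K => \sum_(k < K) D i k * D' k j) = fun=> 0.
    apply/funext => K; rewrite big1// => k _.
    by case: DD => ->; [rewrite bmx0E mul0r|rewrite bmx0E mulr0].
  exact: cvg_cst.
have [->|A0] := eqVneq A 0; first by rewrite zero ?normr0 ?mul0r//; left.
have [->|B0] := eqVneq B 0; first by rewrite zero ?normr0 ?mulr0//; right.
rewrite !norm_bmxE -real_complexM lecR.
have pos D : D != 0 -> 0 < bmx_norm D.
  by rewrite -normr_gt0 norm_bmxE ltcR.
apply: bmx_norm_le; first by rewrite mulr_ge0// bmx_norm_ge0.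
by apply: mbound_mul; rewrite ?pos//; exact: mbound_norm.
Qed.

Fact norm_bmx_star A : `|bmx_mul (bmx_adj A) A| = `|A| ^+ 2.
Proof.
apply/le_anti/andP; split.
  by rewrite (le_trans (norm_bmx_mul _ _))// norm_bmx_adj expr2.
rewrite !norm_bmxE -rmorphXn lecR.
set B := bmx_norm (bmx_mul _ _).
have B0 : 0 <= B by exact: bmx_norm_ge0.
rewrite -(sqr_sqrtr B0) ler_sqr ?nnegrE ?bmx_norm_ge0 ?sqrtr_ge0//.
apply: bmx_norm_le; first exact: sqrtr_ge0.
apply: (mbound_star (bmx_norm_ge0 A) (mbound_norm A)); last exact: sqrtr_ge0.
by rewrite sqr_sqrtr//; exact: (mbound_norm (bmx_mul (bmx_adj A) A)).
Qed.

HB.instance Definition _ := isCStarAlgebra.Build R bmx bmx_mulA bmx_mul1l bmx_mul1r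
  bmx_mul_linearl bmx_mul_linearr bmx_adj_antilinear bmx_adjM bmx_adjK
  norm_bmx_mul norm_bmx_star.


Lemma bmx_pinj_adj rho (rhoP : partial_injection rho)
    (rhoP' : partial_injection (fun i j => rho j i)) :
  adj (bmx_pinj rhoP) = bmx_pinj rhoP'.
Proof. by apply/val_inj; exact: pmx_adj. Qed.

Lemma bmx_pinj_mul rho sigma tau (rhoP : partial_injection rho)
    (sigmaP : partial_injection sigma) (tauP : partial_injection tau) :
  (forall i j, tau i j <-> exists k, rho i k /\ sigma k j) ->
  bmx_pinj rhoP ** bmx_pinj sigmaP = bmx_pinj tauP.
Proof.
move=> h; apply/val_inj; rewrite /= pmx_mul; last by case: rhoP.
by apply/funext => i; apply/funext => j; rewrite /pmx; congr (nat_of_bool _)%:R;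
  apply/asbool_equiv_eq; split=> /h.
Qed.

Lemma bmx_pinj0 rho (rhoP : partial_injection rho) :
  (forall i j, ~ rho i j) -> bmx_pinj rhoP = 0.
Proof. by move=> h; apply: bmxP => i j; rewrite /= /pmx asboolF. Qed.

Lemma bmx_pinj_eq rho sigma (rhoP : partial_injection rho)
    (sigmaP : partial_injection sigma) :
  (forall i j, rho i j <-> sigma i j) -> bmx_pinj rhoP = bmx_pinj sigmaP.
Proof.
move=> h; apply: bmxP => i j; rewrite /= /pmx; congr (nat_of_bool _)%:R.
exact/asbool_equiv_eq.
Qed.

End BoundedMatrixCStar.

(** * Matrix coefficients *)

Section RegularRepresentation.
Variables (R : realType) (G : groupType) (P : set G) (f : nat -> G).
Hypotheses (f_inj : injective f) (fP : forall p, P p <-> exists n, p = f n).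
Hypothesis PM : forall x y, P x -> P y -> P (x * y)%g.
Implicit Types x y z : G.
Local Open Scope group_scope.

Fact translation_partial_injection x : partial_injection (fun i j => f i = x * f j).
Proof.
split=> [i j j' -> /mulgI /f_inj//|i i' j fi fi'].
by apply: f_inj; rewrite fi fi'.
Qed.

(** Left translation by x, compressed to the square-summable functions on P, in the basis enumerated
    by f. *)
Definition regular_rep x : bmx R := bmx_pinj R (translation_partial_injection x).

Lemma f_pos n : P (f n).
Proof. by apply/fP; exists n. Qed.

Fact left_quotient_partial_injection x y :
  partial_injection (fun i j => exists k, f i = x * f k /\ f j = y * f k).
Proof.
split=> [i j j' [k [ik jk]] [k' [ik' jk']]|i i' j [k [ik jk]] [k' [ik' jk']]].
  by apply: f_inj; rewrite jk jk'; congr (y * _); apply: (@mulgI _ x); rewrite -ik -ik'.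
by apply: f_inj; rewrite ik ik'; congr (x * _); apply: (@mulgI _ y); rewrite -jk -jk'.
Qed.

Fact translation_adj_partial_injection x : partial_injection (fun j i => f i = x * f j).
Proof. by have [h1 h2] := translation_partial_injection x; split=> [i j j'|i i' j]; [exact: h2|exact: h1]. Qed.

Lemma regular_rep_adj x : adj (regular_rep x) = bmx_pinj R (translation_adj_partial_injection x).
Proof. exact: bmx_pinj_adj. Qed.

Lemma regular_rep_quotient x y :
  regular_rep x ** adj (regular_rep y) = bmx_pinj R (left_quotient_partial_injection x y).
Proof. by rewrite regular_rep_adj; apply: bmx_pinj_mul. Qed.

Lemma regular_rep_range x i j :
  (exists k, f i = x * f k /\ f j = x * f k) <-> i = j /\ qle P x (f i).
Proof.
split=> [[k [ik jk]]|[<- /fP[k xk]]].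
  by split; [apply: f_inj; rewrite ik jk|rewrite /qle ik mulKg; exact: f_pos].
by exists k; rewrite -xk mulVKg.
Qed.

(** The range projection of x is diagonal and projects onto the upper bounds of x in P, so products
    of range projections correspond to intersections of such sets. *)
Lemma regular_rep_nica : nica_covariant P regular_rep.
Proof.
have ranges x y i j : (exists k, (exists l, f i = x * f l /\ f k = x * f l) /\
    (exists l, f k = y * f l /\ f j = y * f l)) <->
    [/\ i = j, qle P x (f i) & qle P y (f i)].
  split=> [[k [/regular_rep_range[<- xi] /regular_rep_range[<- yi]]]//|[<- xi yi]].
  by exists i; split; apply/regular_rep_range.
split.
- move=> x Px; rewrite regular_rep_adj; apply: bmx_pinj_mul => i j.
  split=> [<-|[k [-> /mulgI/f_inj//]]].
  have /fP[k xk] := PM Px (f_pos i); by exists k.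
- by apply: bmx_pinj_eq => i j; rewrite mul1g; split=> [/f_inj|->].
- move=> x y Px Py; apply/esym/bmx_pinj_mul => i j.
  split=> [fij|[k [-> ->]]]; last by rewrite mulgA.
  have /fP[k yk] := PM Py (f_pos j).
  by exists k; rewrite -yk fij mulgA.
- move=> x y z Px Py [[Pz xz yz] zmin]; rewrite !regular_rep_quotient.
  apply: bmx_pinj_mul => i j; rewrite ranges; split.
    move=> /regular_rep_range[<- zi]; split=> //; rewrite /qle.
      by have := PM xz zi; rewrite mulgA mulgK.
    by have := PM yz zi; rewrite mulgA mulgK.
  move=> [<- xi yi]; apply/regular_rep_range; split=> //.
  by apply: zmin; split=> //; exact: f_pos.
- move=> x y Px Py xy; rewrite !regular_rep_quotient.
  have e0 : partial_injection (fun _ _ : nat => False) by split.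
  transitivity (bmx_pinj R e0); last by apply: bmx_pinj0 => i j.
  apply: bmx_pinj_mul => i j; rewrite ranges; split=> // -[_ xi yi].
  by apply: (xy (f i)); split=> //; exact: f_pos.
Qed.

End RegularRepresentation.

(* F m n plays the role of the matrix coefficient <X e_n, e_m> of a
   representation on a space with an orthonormal sequence (e_n). *)
Record matrix_coefficients (R : realType) (E : cstarAlgType R)
    (F : nat -> nat -> E -> R[i]) : Prop := MatrixCoefficients {
  coef_scalar : forall m n, scalar (F m n);
  coef1 : forall m n, F m n cone = (m == n)%:R;
  coef_star : forall X, exists u : nat -> nat -> R[i], forall m n,
    (fun K => \sum_(k < K) conjc (u k m) * u k n) @ \oo --> F m n (adj X ** X)
}.

(** The regular representation is compressed to the basis vectors b^m. A nonzero coefficient of T_x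
    T_y^* requires b^m = x p and b^n = y p with p in P, which forces theta x = theta y = 0 since
    theta is nonnegative on P; for powers of b it is the coefficient of the shift. *)
Lemma bs_matrix_coefficients (R : realType) (c d : nat) (A : cstarAlgType R)
    (T : BS c d -> A) : (0 < c)%N -> (0 < d)%N ->
  is_semigroup_algebra (@bs_pos c d) T ->
  exists F, [/\ matrix_coefficients F,
    forall m n s t, F m n (T (bs_b c d ^+ s)%g ** adj (T (bs_b c d ^+ t)%g)) =
      (`[< exists j, m = (s + j)%N /\ n = (t + j)%N >])%:R
    & forall m n x y, bs_pos x -> bs_pos y -> bs_theta x != 0 \/ bs_theta y != 0 ->
      F m n (T x ** adj (T y)) = 0].
Proof.
move=> c0 d0 AT; have [f [f_inj fP]] := bs_pos_enum c0 d0.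
have [pi [piH piT]] := sgalg_univ AT (regular_rep_nica R f_inj fP (@bs_posM c d)).
have idx m : exists i, f i = (bs_b c d ^+ m)%g.
  by have /fP[i ->] := bs_pos_bX c d m; exists i.
have [e eP] := choice idx.
have e_inj : injective e.
  by move=> m n /(congr1 f); rewrite !eP => /(bs_bX_inj c0 d0).
have piE m n x y : bs_pos x -> bs_pos y -> pi (T x ** adj (T y)) (e m) (e n) =
    (`[< exists k, (bs_b c d ^+ m = x * f k)%g /\ (bs_b c d ^+ n = y * f k)%g >])%:R.
  move=> Px Py; rewrite (star_homM piH) (star_hom_adj piH) !piT//.
  by rewrite (regular_rep_quotient R f_inj) /= /pmx !eP.
exists (fun m n X => pi X (e m) (e n)); split.
- split.
  + by move=> m n z X Y; rewrite (star_hom_linear piH).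
  + move=> m n; rewrite (star_hom1 piH) /= /pmx.
    congr (nat_of_bool _)%:R; apply/asboolP/eqP => [/e_inj//|->//].
  + move=> X; exists (fun k m => pi X k (e m)) => m n.
    rewrite (star_homM piH) (star_hom_adj piH).
    exact: (bmx_mul_cvg (A := bmx_adj (pi X)) (B := pi X)).
- move=> m n s t; rewrite piE; [|exact: bs_pos_bX|exact: bs_pos_bX].
  congr (nat_of_bool _)%:R; apply/asbool_equiv_eq; split=> [[k [mk nk]]|[j [-> ->]]].
    have Pk : bs_pos (f k) by apply/fP; exists k.
    have sm := bs_bX_le c0 d0 Pk mk.
    have fk : f k = (bs_b c d ^+ (m - s))%g.
      by apply: (@mulgI _ (bs_b c d ^+ s)%g); rewrite -mk -expgnDr subnKC.
    exists (m - s)%N; split; first by rewrite subnKC.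
    by apply: (bs_bX_inj c0 d0); rewrite nk fk expgnDr.
  by exists (e j); rewrite !eP !expgnDr.
- move=> m n x y Px Py xy; rewrite piE//; case: asboolP => // -[k [mk nk]].
  have Pk : bs_pos (f k) by apply/fP; exists k.
  have := congr1 (@bs_theta c d) mk; have := congr1 (@bs_theta c d) nk.
  rewrite !bs_thetaM !bs_theta_bX => h1 h2.
  have := bs_theta_ge0 Px; have := bs_theta_ge0 Py; have := bs_theta_ge0 Pk.
  by case: xy => /eqP; lia.
Qed.

(** * Coefficients of the Toeplitz algebra in the standard basis *)

Section ToeplitzCoefficients.
Variable R : realType.
Local Notation C := R[i].
Implicit Types (x y : nat -> C).

Definition unit_vector n : nat -> C := fun k => (k == n)%:R.

Lemma eventually_const_cvg (u : nat -> C) N (c : C) :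
  (forall n, (N <= n)%N -> u n = c) -> u @ \oo --> c.
Proof.
move=> uc; have hc : (fun=> c : C) @ \oo --> c by exact: cvg_cst.
by apply: (cvg_trans _ hc); apply: near_eq_cvg; exists N => // n /uc ->.
Qed.

Lemma series_delta (u : nat -> C) n : (forall k, k != n -> u k = 0) ->
  series u @ \oo --> u n.
Proof.
move=> u0; apply: (@eventually_const_cvg _ n.+1) => N nN.
rewrite seriesEord /= (bigD1 (Ordinal nN))//= big1 ?addr0// => k kn.
by apply: u0; rewrite -val_eqE /= in kn.
Qed.

Lemma ell2_unit_vector n : ell2 (unit_vector n).
Proof.
suff : series (fun k => `|unit_vector n k| ^+ 2) @ \oo --> `|unit_vector n n| ^+ 2.
  by move/cvgP.
apply: (@series_delta (fun k => `|unit_vector n k| ^+ 2)) => k kn.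
by rewrite /unit_vector (negbTE kn) normr0 expr0n.
Qed.

Arguments ell2_unit_vector : clear implicits.

Lemma ell2_dot_unit_vector x n : ell2_dot x (unit_vector n) = x n.
Proof.
apply: (cvg_lim (@norm_hausdorff _ C)).
have -> : x n = x n * conjc (unit_vector n n).
  by rewrite /unit_vector eqxx conjc1 mulr1.
apply: (@series_delta (fun k => x k * conjc (unit_vector n k))) => k kn.
by rewrite /unit_vector (negbTE kn) conjc0 mulr0.
Qed.

Lemma ell2_sqsum x : ell2 x -> exists B : R, forall N, sqsum N x <= B%:C.
Proof.
move=> xl; pose s N := complex.Re (sqsum N x).
have sE N : sqsum N x = (s N)%:C by exact/ge0_complexE/sqsum_ge0.
have nd : nondecreasing_seq s.
  by apply/nondecreasing_seqP => n; rewrite -lecR -!sE sqsumS lerDl exprn_ge0.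
have cs : cvg (s @ \oo).
  have /cvg_ex[l xE] := xl.
  have /cvg_complexP[h _] : (fun N => sqsum N x) @ \oo --> l.
    by move: xE; rewrite seriesEord.
  by apply/cvg_ex; exists (complex.Re l).
by exists (limn s) => N; rewrite sE lecR; exact: nondecreasing_cvgn_le.
Qed.

Lemma ell2_dot_cvg x y : ell2 x -> ell2 y ->
  (fun K => \sum_(k < K) conjc (y k) * x k) @ \oo --> ell2_dot x y.
Proof.
move=> /ell2_sqsum[B xB] /ell2_sqsum[B' yB].
have B0 : 0 <= B by rewrite -ler0c (le_trans (sqsum_ge0 0 x) (xB 0)).
have B0' : 0 <= B' by rewrite -ler0c (le_trans (sqsum_ge0 0 y) (yB 0)).
have E : (fun K => \sum_(k < K) conjc (y k) * x k) = series (fun k => x k * conjc (y k)).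
  by rewrite seriesEord; apply/funext => K; apply: eq_bigr => k _; rewrite mulrC.
suff : cvg ((fun K => \sum_(k < K) conjc (y k) * x k) @ \oo) by rewrite E.
apply: (@l2_cvg _ (fun k => conjc (y k)) x (B + B')) => N.
  rewrite (@le_trans _ _ B'%:C)// ?lecR ?lerDr// (le_trans _ (yB N))//.
  by rewrite /sqsum; under eq_bigr do rewrite normcJ.
by rewrite (le_trans (xB N))// lecR lerDl.
Qed.

(** The relation S^* S = 1 holds for the operators and lifts to the algebra by faithfulness; the
    coefficients are those of the given representation. *)
Lemma toeplitz_coefficients (E : cstarAlgType R) (S : E) : is_toeplitz S ->
  adj S ** S = cone /\
  exists F, matrix_coefficients F /\
    forall m n s t, F m n (cpow S s ** cpow (adj S) t) =
      (`[< exists j, m = (s + j)%N /\ n = (t + j)%N >])%:R.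
Proof.
move=> [_ [pi [piP piS]]].
have eS n : unilateral_shift (unit_vector n) = unit_vector n.+1.
  by apply/funext => -[|k].
have piSa x k : ell2 x -> pi (adj S) x k = x k.+1.
  move=> xl; rewrite -(ell2_dot_unit_vector (pi (adj S) x)).
  rewrite (rep_adj piP (adj S) xl (ell2_unit_vector k)) adjK.
  by rewrite (piS _ (ell2_unit_vector k)) eS ell2_dot_unit_vector.
have piSt t x k : ell2 x -> pi (cpow (adj S) t) x k = x (k + t)%N.
  move=> xl; elim: t k => [|t IH] k; first by rewrite (rep1 piP)// addn0.
  rewrite cpowS (repM piP)// piSa; last exact: (rep_ell2 piP).
  by rewrite IH addSnnS.
have piSs s x k : ell2 x -> pi (cpow S s) x k = if (s <= k)%N then x (k - s)%N else 0.
  move=> xl; elim: s k => [|s IH] k; first by rewrite (rep1 piP)// subn0.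
  rewrite cpowS (repM piP)// piS; last exact: (rep_ell2 piP).
  by case: k => [|k] //=; rewrite IH.
split.
  apply/eqP; rewrite -subr_eq0; apply/eqP/(rep_faithful piP) => x xl.
  rewrite addrC -scaleN1r (repD piP)// (rep1 piP)// (repM piP)//.
  have Sx : ell2 (pi S x) by exact: (rep_ell2 piP).
  apply/funext => k; transitivity (-1 * x k + pi (adj S) (pi S x) k); first by [].
  by rewrite piSa// piS// mulN1r addNr.
exists (fun m n X => pi X (unit_vector n) m); split.
  split.
  - by move=> m n z X Y; rewrite (repD piP)//; exact: ell2_unit_vector.
  - by move=> m n; rewrite (rep1 piP)//; exact: ell2_unit_vector.
  - move=> X; exists (fun k m => pi X (unit_vector m) k) => m n.
    have lX k : ell2 (pi X (unit_vector k)).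
      exact: (rep_ell2 piP (ell2_unit_vector k)).
    rewrite (repM piP _ _ (ell2_unit_vector n)).
    rewrite -(ell2_dot_unit_vector (pi (adj X) _)).
    rewrite (rep_adj piP (adj X) (lX n) (ell2_unit_vector m)) adjK.
    exact: ell2_dot_cvg.
move=> m n s t; rewrite (repM piP _ _ (ell2_unit_vector n)).
rewrite piSs; last exact: (rep_ell2 piP (ell2_unit_vector n)).
case: leqP => sm.
  rewrite (piSt _ _ _ (ell2_unit_vector n)) /unit_vector; congr (nat_of_bool _)%:R.
  apply/eqP/asboolP => [<-|[j [-> ->]]]; last by rewrite addKn addnC.
  by exists (m - s)%N; rewrite subnKC// addnC.
by rewrite asboolF// => -[j [mE _]]; rewrite mE ltnNge leq_addr in sm.
Qed.

End ToeplitzCoefficients.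

(** * Transfer of states along an isometry *)

Section Isometry.
Variables (R : realType) (D : cstarAlgType R) (V : D).
Hypothesis Vi : adj V ** V = cone.
Local Notation Vn := (cpow V).
Local Notation Va := (cpow (adj V)).

Lemma isometry_cancel p : Va p ** Vn p = cone.
Proof.
elim: p => [|p IH]; first by rewrite cmul1l.
rewrite cpowSr cpowS -cmulA (cmulA (adj V) V) Vi cmul1l IH//.
Qed.

Lemma isometry_mul p q : Va p ** Vn q = Vn (q - p) ** Va (p - q).
Proof.
have [pq|/ltnW qp] := leqP p q.
  rewrite -{1}(subnKC pq) cpowD cmulA isometry_cancel cmul1l.
  by move/eqP: pq => ->; rewrite cmul1r.
rewrite -{1}(subnK qp) cpowD -cmulA isometry_cancel cmul1r.
by move/eqP: qp => ->; rewrite cmul1l.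
Qed.

Lemma isometry_telescope s t L :
  \sum_(j < L) (Vn (s + j) ** (cone - V ** adj V) ** Va (t + j)) =
  Vn s ** Va t - Vn (s + L) ** Va (t + L).
Proof.
elim: L => [|L IH]; first by rewrite big_ord0 !addn0 subrr.
rewrite big_ord_recr /= IH cmulBr cmul1r cmulBl addrA subrK; congr (_ - _).
by rewrite !addnS cpowSr cpowS !cmulA.
Qed.

Lemma range_projection_idem k :
  adj (cone - Vn k ** Va k) ** (cone - Vn k ** Va k) = cone - Vn k ** Va k.
Proof.
rewrite adjB adj_cone adjM !adj_cpow adjK cmulBl cmul1l cmulBr cmul1r.
rewrite cmulA -(cmulA (Vn k)) isometry_cancel cmul1r subrr subr0//.
Qed.

Lemma isometry_range_le1 (phi : D -> R[i]) k : is_state phi -> phi (Vn k ** Va k) <= 1.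
Proof.
move=> phis; have phiP := state_positive phis.
rewrite -subr_ge0; case: (phis) => _ _ <-.
by rewrite -(pfunB phiP) -range_projection_idem pfun_ge0.
Qed.

(* The moments phi (V^n V^*^n) decrease, hence are asymptotically constant; by
   Cauchy-Schwarz the other moments then are asymptotically constant along diagonals. *)
Lemma isometry_moments_cvg (phi : D -> R[i]) a b : is_state phi ->
  (fun N => phi (Vn (N - b) ** Va (N - a)) - phi (Vn (N + a) ** Va (N + b))) @ \oo --> 0.
Proof.
move=> phis; have phiP := state_positive phis.
pose k := (a + b)%N; pose Q := cone - Vn k ** Va k.
pose g n := phi (Vn n ** Va n).
have QE p : phi (adj (Q ** Va p) ** (Q ** Va p)) = g p - g (p + k)%N.
  rewrite adjM adj_cpow adjK cmulA -(cmulA (Vn p)) range_projection_idem.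
  by rewrite cmulBr cmulBl cmul1r (pfunB phiP) cmulA -cpowD -cmulA -cpowD (addnC k).
have gdec p : g (p + k)%N <= g p by rewrite -subr_ge0 -QE pfun_ge0.
have g0 p : 0 <= g p.
  by rewrite /g -[X in phi (X ** _)]adjK adj_cpow pfun_ge0.
have g1 p : g p <= 1 by exact: isometry_range_le1.
pose s n := complex.Re (g n).
have sE n : g n = (s n)%:C by exact: ge0_complexE.
have cs : cvg (s @ \oo).
  apply: nonincreasing_is_cvgn; last first.
    by exists 0 => _ [n _ <-]; rewrite -ler0c -sE.
  apply/nonincreasing_seqP => n; rewrite -lecR -!sE -subr_ge0.
  have -> : g n - g n.+1 = phi (adj ((cone - Vn 1 ** Va 1) ** Va n) **
      ((cone - Vn 1 ** Va 1) ** Va n)).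
    rewrite adjM adj_cpow adjK cmulA -(cmulA (Vn n)) range_projection_idem.
    by rewrite cmulBr cmulBl cmul1r (pfunB phiP) cmulA -cpowD -cmulA -cpowD addn1 add1n.
  exact: pfun_ge0.
apply/cvgrPdist_le => e e0.
have e0' : 0 < complex.Re e by rewrite -ltcR -ge0_complexE// ltW.
have e2 : 0 < (complex.Re e) ^+ 2 / 2 by rewrite divr_gt0// exprn_gt0.
have /cvgrPdist_lt /(_ _ e2)[M _ MP] := cs.
exists (M + k)%N => // N /= MN; rewrite sub0r normrN -(pfunB phiP).
have Nb : (b <= N)%N by rewrite (leq_trans _ MN)// /k addnA leq_addl.
have Na : (a <= N)%N by rewrite (leq_trans _ MN)// /k addnCA leq_addr.
(* The difference is V^(N-b) Q V^*^(N-a) with the projection Q = 1 - V^k V^*^k, so Cauchy-Schwarz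
   bounds it by differences g p - g (p + k). *)
have -> : Vn (N - b) ** Va (N - a) - Vn (N + a) ** Va (N + b) =
    adj (Q ** Va (N - b)) ** (Q ** Va (N - a)).
  rewrite adjM adj_cpow adjK cmulA -(cmulA (Vn _)) range_projection_idem.
  rewrite cmulBr cmulBl cmul1r cmulA -cpowD -cmulA -cpowD.
  by congr (_ - cpow _ _ ** cpow _ _); rewrite /k; lia.
have := pfun_cauchy_schwarz phiP (Q ** Va (N - a)) (Q ** Va (N - b)).
rewrite !QE => h.
rewrite -(@ler_pXn2r _ 2)// ?nnegrE ?(ltW e0)// (le_trans h)//.
have gN p : (M <= p)%N -> g p - g (p + k)%N <= e ^+ 2.
  move=> Mp; rewrite !sE -rmorphB (ge0_complexE (ltW e0)) -rmorphXn lecR.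
  have := MP p Mp; have := MP (p + k)%N (leq_trans Mp (leq_addr k p)).
  rewrite /= !ltr_norml => /andP[? ?] /andP[? ?].
  by lra.
rewrite -[leRHS]mul1r ler_pM ?subr_ge0//.
  by rewrite lerBlDr (le_trans (g1 _))// lerDl.
by apply: gN; rewrite /k in MN; lia.
Qed.

End Isometry.

Section Transfer.
Variables (R : realType) (E D : cstarAlgType R).
Local Notation C := R[i].
Variables (F : nat -> nat -> E -> C) (phi : D -> C) (V : D).
Hypotheses (FP : matrix_coefficients F) (phis : is_state phi) (Vi : adj V ** V = cone).
Local Notation Vn := (cpow V).
Local Notation Va := (cpow (adj V)).

(** The matrix of S^s S^*^t for the unilateral shift S. *)
Definition diagonal_coefficients (s t : nat) (Y : E) : Prop :=
  forall m n, F m n Y = (`[< exists j, m = (s + j)%N /\ n = (t + j)%N >])%:R.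

Definition coef_functional (x : nat -> D) M (Y : E) : C :=
  \sum_(m < M) \sum_(n < M) phi (adj (x m) ** x n) * F m n Y.

Let phiP := state_positive phis.

(** The coefficients of X^* X are limits of Gram sums of vectors u_k, and paired with phi (x_m^*
    x_n) the k-th term becomes phi (y^* y) with y the combination of the x_n with coefficients u_k
    n. *)
Lemma coef_functional_positive x M : positive_functional (coef_functional x M).
Proof.
split=> [z X Y|X].
  rewrite /coef_functional mulr_sumr -big_split; apply: eq_bigr => m _ /=.
  rewrite mulr_sumr -big_split; apply: eq_bigr => n _ /=.
  by rewrite (coef_scalar FP); ring.
have [u uP] := coef_star FP X.
have sumC M' (h : nat -> 'I_M' -> C) (l : 'I_M' -> C) :
    (forall k, (fun K => h K k) @ \oo --> l k) ->
    (fun K => \sum_(k < M') h K k) @ \oo --> \sum_(k < M') l k.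
  move=> hl; elim: (index_enum _) => [|k s IH].
    by rewrite big_nil; under eq_fun do rewrite big_nil; exact: cvg_cst.
  rewrite big_cons; under eq_fun do rewrite big_cons.
  exact: (cvg_complexD (hl k) IH).
have h : (fun K => \sum_(m < M) \sum_(n < M) phi (adj (x m) ** x n) *
    (\sum_(k < K) conjc (u k m) * u k n)) @ \oo --> coef_functional x M (adj X ** X).
  apply: (sumC M (fun K (m : 'I_M) => \sum_(n < M) phi (adj (x m) ** x n) *
    (\sum_(k < K) conjc (u k m) * u k n))) => m.
  apply: (sumC M (fun K (n : 'I_M) => phi (adj (x m) ** x n) *
    (\sum_(k < K) conjc (u k m) * u k n))) => n.
  exact: (cvg_complexM (cvg_cst (phi (adj (x m) ** x n))) (uP m n)).
apply: (cvg_complex_ge0 h); apply: nearW => K.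
under eq_bigr do under eq_bigr do rewrite mulr_sumr.
under eq_bigr do rewrite exchange_big.
rewrite exchange_big /=; apply: sumr_ge0 => k _.
have -> : \sum_(m < M) \sum_(n < M) phi (adj (x m) ** x n) * (conjc (u k m) * u k n) =
    phi (adj (\sum_(m < M) u k m *: x m) ** (\sum_(n < M) u k n *: x n)).
  rewrite adj_sum cmul_suml (pfun_sum phiP); apply: eq_bigr => m _.
  rewrite cmul_sumr (pfun_sum phiP); apply: eq_bigr => n _.
  by rewrite adjZ cmulZl cmulZr !(pfunZ phiP); ring.
exact: pfun_ge0.
Qed.

Lemma coef_functional1 x M :
  coef_functional x M cone = phi (\sum_(m < M) adj (x m) ** x m).
Proof.
rewrite (pfun_sum phiP); apply: eq_bigr => m _.
rewrite (bigD1 m)//= big1 ?addr0 ?(coef1 FP) ?eqxx ?mulr1// => n nm.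
by rewrite (coef1 FP) [_ == _](_ : _ = false) ?mulr0// eq_sym; exact: negbTE.
Qed.

Lemma coef_functional_diagonal x M s t Y : diagonal_coefficients s t Y ->
  coef_functional x M Y =
  \sum_(j < M - maxn s t) phi (adj (x (s + j)%N) ** x (t + j)%N).
Proof.
move=> Yst.
have -> : coef_functional x M Y = \sum_(m < M) \sum_(n < M) \sum_(j < M - maxn s t)
    phi (adj (x m) ** x n) * ((m == s + j :> nat) && (n == t + j :> nat))%N%:R.
  apply: eq_bigr => m _; apply: eq_bigr => n _; rewrite -mulr_sumr Yst; congr (_ * _).
  case: asboolP => [[j [mE nE]]|nj].
    have jM : (j < M - maxn s t)%N by have := ltn_ord m; have := ltn_ord n; lia.
    rewrite (bigD1 (Ordinal jM))//= big1 ?addr0; first by rewrite mE nE !eqxx.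
    move=> i; rewrite -val_eqE /= => ij; rewrite mE eqn_add2l eq_sym.
    by rewrite (negbTE ij).
  rewrite big1// => j _; case: eqP => //= mE; case: eqP => //= nE.
  by exfalso; apply: nj; exists j.
under eq_bigr do rewrite exchange_big.
rewrite exchange_big; apply: eq_bigr => j _ /=.
have sj : (s + j < M)%N by have := ltn_ord j; lia.
have tj : (t + j < M)%N by have := ltn_ord j; lia.
rewrite (bigD1 (Ordinal sj))//= [X in _ + X]big1 ?addr0; last first.
  move=> m; rewrite -val_eqE /= => mE; rewrite big1// => n _.
  by rewrite (negbTE mE) mulr0.
rewrite (bigD1 (Ordinal tj))//= big1 ?addr0 ?eqxx ?mulr1//.
by move=> n; rewrite -val_eqE /= => nE; rewrite (negbTE nE) mulr0.
Qed.

Definition defect_vector n := (cone - V ** adj V) ** Va n.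
(** Where V is unitary this is V^*^n, but unlike V^*^n it lives on the range of V^(N-n), so that its
    Gram matrix sees only high moments. *)
Definition tail_vector N n := Vn (N - n) ** Va N.

Definition transfer_functional N (Y : E) : C :=
  coef_functional defect_vector N Y + N%:R^-1 * coef_functional (tail_vector N) N Y.

Lemma defect_vector_mul m n :
  adj (defect_vector m) ** defect_vector n = Vn m ** (cone - V ** adj V) ** Va n.
Proof.
have h := range_projection_idem Vi 1; rewrite /cpow /= !cmul1r in h.
by rewrite adjM adj_cpow adjK cmulA -(cmulA (Vn m)) h.
Qed.

Lemma tail_vector_mul N m n : (m <= N)%N -> (n <= N)%N ->
  adj (tail_vector N m) ** tail_vector N n = Vn (N + (m - n)) ** Va (N + (n - m)).
Proof.
move=> mN nN; rewrite adjM !adj_cpow adjK cmulA -(cmulA (Vn N)) isometry_mul//.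
have -> : (N - n - (N - m) = m - n)%N by lia.
have -> : (N - m - (N - n) = n - m)%N by lia.
by rewrite cmulA -cpowD -cmulA -cpowD (addnC (n - m)%N).
Qed.

(** The mass of the defect part telescopes to phi (1 - V^N V^*^N), and the tail part supplies the
    missing phi (V^N V^*^N). For N = 0 both sums are empty, hence the successor. *)
Lemma transfer_functional_state N : is_state (transfer_functional N.+1).
Proof.
have [l1 p1] := coef_functional_positive defect_vector N.+1.
have [l2 p2] := coef_functional_positive (tail_vector N.+1) N.+1.
split.
- by move=> z X Y; rewrite /transfer_functional l1 l2; ring.
- by move=> X; rewrite addr_ge0// mulr_ge0// invr_ge0 ler0n.
rewrite /transfer_functional !coef_functional1.
under eq_bigr do rewrite defect_vector_mul.
under [X in _ + _ * phi X]eq_bigr => m _ do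
  rewrite tail_vector_mul ?subnn ?addn0 ?(ltnW (ltn_ord m))//.
rewrite big_const_ord iter_addr addr0 -(scaler_nat _ (cpow _ _ ** _)) (pfunZ phiP).
rewrite mulrA mulVf ?pnatr_eq0// mul1r.
have := isometry_telescope V 0 0 N.+1; rewrite !add0n => ->.
by rewrite (pfunB phiP) subrK cmul1l; case: phis.
Qed.

(** The defect part telescopes to the wanted moment minus a high moment on the same diagonal. The
    tail part restores a high moment with weight (N - max s t) / N, and the two high moments agree
    in the limit by [isometry_moments_cvg]. *)
Lemma transfer_functional_diagonal s t Y : diagonal_coefficients s t Y ->
  (fun N => transfer_functional N.+1 Y) @ \oo --> phi (Vn s ** Va t).
Proof.
move=> Yst; pose a := (s - t)%N; pose b := (t - s)%N.
have E1 N : (maxn s t < N)%N -> transfer_functional N Y =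
    phi (Vn s ** Va t) - (phi (Vn (N - b) ** Va (N - a)) - phi (Vn (N + a) ** Va (N + b)))
    - (maxn s t)%:R * N%:R^-1 * phi (Vn (N + a) ** Va (N + b)).
  move=> stN; rewrite /transfer_functional !(coef_functional_diagonal _ _ Yst).
  under eq_bigr do rewrite defect_vector_mul.
  rewrite -(pfun_sum phiP) isometry_telescope (pfunB phiP).
  under [X in _ + _ * X]eq_bigr => j _.
    rewrite tail_vector_mul; [|by have := ltn_ord j; lia..].
    rewrite !subnDr; over.
  rewrite big_const_ord iter_addr addr0 -(mulr_natl (phi _)) natrB; last exact: ltnW.
  have -> : (s + (N - maxn s t) = N - b)%N by lia.
  have -> : (t + (N - maxn s t) = N - a)%N by lia.
  by field; rewrite pnatr_eq0; lia.
have lim1 := isometry_moments_cvg Vi a b phis.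
have lim2 : (fun N => (maxn s t)%:R * N%:R^-1 * phi (Vn (N + a) ** Va (N + b))) @ \oo --> (0 : C).
  apply/cvgrPdist_le => e e0.
  have e0' : 0 < complex.Re e by rewrite -ltcR -ge0_complexE// ltW.
  pose q := (maxn s t)%:R / complex.Re e.
  have q0 : 0 <= q by rewrite divr_ge0// ltW.
  exists (Num.bound q).+1 => // N /= qN; rewrite sub0r normrN.
  have N0 : 0 < N%:R :> C by rewrite ltr0n; exact: leq_trans qN.
  rewrite !normrM normfV !normr_nat mulrAC ler_pdivrMr//.
  have [_ _ phi1] := phis.
  have p1 : `|phi (Vn (N + a) ** Va (N + b))| <= 1.
    rewrite -(@ler_pXn2r _ 2)// ?nnegrE// expr1n.
    have := pfun_cauchy_schwarz phiP (Va (N + b)) (Va (N + a)).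
    rewrite !adj_cpow !adjK => /le_trans; apply.
    rewrite -[leRHS]mulr1 ler_pM//; try exact: isometry_range_le1.
      by rewrite -[X in phi (X ** _)]adjK adj_cpow pfun_ge0.
    by rewrite -[X in phi (X ** _)]adjK adj_cpow pfun_ge0.
  rewrite (@le_trans _ _ ((maxn s t)%:R * 1))//; first by rewrite ler_wpM2l.
  rewrite mulr1 (ge0_complexE (ltW e0)) -(rmorph_nat (real_complex R)) -[N%:R](rmorph_nat (real_complex R)).
  rewrite -rmorphM lecR mulrC -ler_pdivrMr//.
  apply: le_trans (ltW (archi_boundP q0)) _.
  by rewrite ler_nat ltnW.
suff : (fun N => transfer_functional N Y) @ \oo --> phi (Vn s ** Va t).
  by rewrite -(cvg_shiftS (fun N => transfer_functional N Y)).
have h : (fun N => phi (Vn s ** Va t) - (phi (Vn (N - b) ** Va (N - a)) -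
    phi (Vn (N + a) ** Va (N + b))) - (maxn s t)%:R * N%:R^-1 *
    phi (Vn (N + a) ** Va (N + b))) @ \oo --> phi (Vn s ** Va t) - 0 - 0.
  exact: (cvg_complexB (cvg_complexB (cvg_cst (phi (Vn s ** Va t))) lim1) lim2).
rewrite !subr0 in h; apply: (cvg_trans _ h); apply: near_eq_cvg.
by exists (maxn s t).+1 => // N /E1 ->.
Qed.

(** The last clause is what makes the transferred state vanish on T_x T_y^* of nonzero degree. *)
Lemma exists_transfer : exists psi : E -> C, [/\ is_state psi,
  forall s t Y, diagonal_coefficients s t Y -> psi Y = phi (Vn s ** Va t)
  & forall Y, (forall m n, F m n Y = 0) -> psi Y = 0].
Proof.
have [G [psi [GP G_oo psis Gpsi]]] := states_cluster transfer_functional_state.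
exists psi; split=> // [s t Y Yst|Y Y0].
  apply: (cvg_unique (@norm_hausdorff _ C) (Gpsi Y)).
  by apply: (cvg_trans _ (transfer_functional_diagonal Yst)) => S /= ?; exact: G_oo.
apply: (cvg_unique (@norm_hausdorff _ C) (Gpsi Y)).
have -> : (fun n => transfer_functional n.+1 Y) = fun=> 0.
  apply/funext => n; rewrite /transfer_functional /coef_functional.
  rewrite !big1 ?mulr0 ?addr0// => i _; rewrite big1// => j _; rewrite Y0 mulr0//.
exact: cvg_cst.
Qed.

End Transfer.

(** * Spanning elements *)

Section SemigroupAlgebraBS.
Variables (R : realType) (c d : nat) (A : cstarAlgType R) (T : BS c d -> A).
Hypotheses (c_gt0 : (0 < c)%N) (d_gt0 : (0 < d)%N).
Hypothesis AT : is_semigroup_algebra (@bs_pos c d) T.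
Local Notation C := R[i].
Local Notation a := (bs_a c d).
Local Notation b := (bs_b c d).
Local Notation P := (@bs_pos c d).
Implicit Types (x y p u v : BS c d).

Lemma TM x y : P x -> P y -> T (x * y)%g = T x ** T y.
Proof. exact: (nicaM (sgalg_nica AT)). Qed.

Lemma T1 : T 1%g = cone.
Proof. exact: (nica1 (sgalg_nica AT)). Qed.

Lemma T_isometry x : P x -> adj (T x) ** T x = cone.
Proof. exact: (nica_isometry (sgalg_nica AT)). Qed.

Lemma T_adjM x y : P x -> P y -> adj (T (x * y)%g) = adj (T y) ** adj (T x).
Proof. by move=> Px Py; rewrite TM// adjM. Qed.

Lemma T_bX n : T (b ^+ n)%g = cpow (T b) n.
Proof.
elim: n => [|n IH]; first exact: T1.
by rewrite expgS TM ?IH//; [exact: bs_posb|exact: bs_pos_bX].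
Qed.

Lemma bs_pos_bXa n : P (b ^+ n * a)%g.
Proof. by apply: bs_posM; [exact: bs_pos_bX|exact: bs_posa]. Qed.
Hint Resolve bs_pos1 bs_posa bs_posb bs_pos_bX bs_pos_bXa bs_posM : core.

(** The Nica relation for the join b^d a = a b^c is multiplied by T_b^* on the left and by T_a on
    the right. *)
Lemma Tb_adj_Ta : adj (T b) ** T a = T (b ^+ d.-1 * a)%g ** adj (T (b ^+ c)%g).
Proof.
have /(nica_join (sgalg_nica AT)) := bs_join_ba c_gt0 d_gt0.
move=> /(_ (@bs_posb c d) (@bs_posa c d)) E.
have Eb : T (b ^+ d * a)%g = T b ** T (b ^+ d.-1 * a)%g.
  by rewrite -TM// mulgA -expgS prednK.
have Ea : T (b ^+ d * a)%g = T a ** T (b ^+ c)%g by rewrite -bs_rel TM.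
have := congr1 (fun Z => adj (T b) ** Z ** T a) E.
rewrite {1}Eb Ea adjM => E'.
transitivity (adj (T b) ** (T b ** adj (T b) ** (T a ** adj (T a))) ** T a).
  rewrite !cmulA T_isometry// cmul1l -[RHS]cmulA T_isometry// cmul1r //.
rewrite E' !cmulA T_isometry// cmul1l -[LHS]cmulA T_isometry// cmul1r //.
Qed.

(** Each further T_b^* lowers s by one; at s = 0 it wraps around to d - 1 and adds c to k. *)
Lemma Tb_adjX_Ta j : exists s k, (s < d)%N /\
  adj (T (b ^+ j)%g) ** T a = T (b ^+ s * a)%g ** adj (T (b ^+ k)%g).
Proof.
elim: j => [|j [s [k [sd E]]]].
  by exists 0, 0; rewrite d_gt0 !expg0 mul1g T1 adj_cone cmul1l cmul1r.
rewrite expgSr T_adjM// -cmulA E cmulA.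
case: s sd E => [|s] sd E.
  exists d.-1, (k + c)%N; rewrite prednK// leqnn; split=> //.
  by rewrite expg0 mul1g Tb_adj_Ta -cmulA -T_adjM// -expgnDr.
exists s, k; split; first exact: ltnW.
by rewrite expgS -mulgA TM// cmulA T_isometry// cmul1l.
Qed.

Lemma Ta_adj_TbXa s : (0 < s < d)%N -> adj (T a) ** T (b ^+ s * a)%g = 0.
Proof.
move=> sd; have := nica_disjoint (sgalg_nica AT) (@bs_posa c d) (bs_pos_bXa s).
move=> /(_ (fun z => bs_disjoint_a_ba c_gt0 d_gt0 sd)) E.
have := congr1 (fun Z => adj (T a) ** Z ** T (b ^+ s * a)%g) E.
rewrite cmulr0 cmul0r !cmulA T_isometry// cmul1l -!cmulA T_isometry// cmul1r.
exact.
Qed.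

Lemma TbX_adj_T p : P p -> forall j, exists u v, [/\ P u, P v &
  adj (T (b ^+ j)%g) ** T p = T u ** adj (T v)].
Proof.
elim/bs_pos_letters => [j|{}p Pp IH j|{}p Pp IH j].
- by exists 1%g, (b ^+ j)%g; rewrite T1 cmul1l cmul1r.
- have [s [k [_ E]]] := Tb_adjX_Ta j; have [u [v [Pu Pv E']]] := IH k.
  exists (b ^+ s * a * u)%g, v; split=> //; first by auto.
  by rewrite TM// cmulA E -cmulA E' cmulA -TM.
- case: j => [|j]; first by exists (b * p)%g, 1%g; split; rewrite ?expg0 ?T1 ?adj_cone ?cmul1l ?cmul1r; auto.
  have [u [v [Pu Pv E]]] := IH j; exists u, v; split=> //.
  by rewrite expgS T_adjM// TM// -cmulA (cmulA (adj (T b))) T_isometry// cmul1l.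
Qed.

Lemma Ta_adj_T p : P p -> adj (T a) ** T p = 0 \/ exists u v, [/\ P u, P v &
  adj (T a) ** T p = T u ** adj (T v)].
Proof.
case/bs_pos_cases => [[n ->]|[n [p' [Pp' ->]]]];
  have [s [k [sd E]]] := Tb_adjX_Ta n.
  right; exists (b ^+ k)%g, (b ^+ s * a)%g; split=> //.
  by rewrite -[LHS]adjK adjM adjK E adjM adjK.
have -> : adj (T a) ** T (b ^+ n * (a * p'))%g =
    T (b ^+ k)%g ** (adj (T (b ^+ s * a)%g) ** T a) ** T p'.
  rewrite TM//; last by auto.
  rewrite TM// !cmulA; congr (_ ** _ ** _).
  by rewrite -[LHS]adjK adjM adjK E adjM adjK.
case: s sd E => [|s] sd E.
  right; exists (b ^+ k * p')%g, 1%g; split=> //; first by auto.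
  by rewrite expg0 mul1g T_isometry// cmul1r T1 adj_cone cmul1r TM.
left; rewrite -[adj _ ** _]adjK adjM adjK Ta_adj_TbXa//.
by rewrite adj_zero cmulr0 cmul0r.
Qed.

(** The letters of y are moved past T_p one at a time by the two relations for a and b; this closes
    the spanning elements under products, up to 0. *)
Lemma T_adj_T y p : P y -> P p -> adj (T y) ** T p = 0 \/ exists u v, [/\ P u, P v &
  adj (T y) ** T p = T u ** adj (T v)].
Proof.
move=> Py; elim/bs_pos_letters: Py p => [p Pp|{}y Py IH p Pp|{}y Py IH p Pp].
- by right; exists p, 1%g; rewrite T1 adj_cone cmul1l cmul1r.
- rewrite T_adjM// -cmulA; have [->|[u [v [Pu Pv ->]]]] := Ta_adj_T Pp.
    by left; rewrite cmulr0.
  rewrite cmulA; have [->|[u' [v' [Pu' Pv' ->]]]] := IH u Pu; first by left; rewrite cmul0r.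
  by right; exists u', (v * v')%g; rewrite T_adjM// -cmulA; split; auto.
- have [u [v [Pu Pv E]]] := TbX_adj_T Pp 1; rewrite expg1 in E.
  rewrite T_adjM// -cmulA E.
  rewrite cmulA; have [->|[u' [v' [Pu' Pv' ->]]]] := IH u Pu; first by left; rewrite cmul0r.
  by right; exists u', (v * v')%g; rewrite T_adjM// -cmulA; split; auto.
Qed.

Definition spanning_elements : set A :=
  [set Z | exists x y, [/\ P x, P y & Z = T x ** adj (T y)]].

Lemma spanning_elements_dense : dense_span spanning_elements.
Proof.
apply: (generates_dense_span (sgalg_gen AT)).
- move=> _ [x Px <-]; apply: lspan_gen; exists x, 1%g.
  by rewrite T1 adj_cone cmul1r.
- by exists 1%g, 1%g; rewrite T1 adj_cone cmul1r.
- move=> _ _ [x [y [Px Py ->]]] [p [q [Pp Pq ->]]].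
  rewrite -cmulA (cmulA (adj _)); have [->|[u [v [Pu Pv ->]]]] := T_adj_T Py Pp.
    by rewrite cmul0r cmulr0; exact: lspan0.
  apply: lspan_gen; exists (x * u)%g, (q * v)%g.
  by rewrite TM// T_adjM// !cmulA; split; auto.
- move=> _ [x [y [Px Py ->]]]; exists y, x.
  by rewrite adjM adjK.
Qed.

End SemigroupAlgebraBS.

Section ToeplitzDense.
Variables (R : realType) (E : cstarAlgType R) (S : E).
Hypotheses (Sgen : generates [set S]) (Si : adj S ** S = cone).

Definition toeplitz_elements : set E :=
  [set Z | exists s t, Z = cpow S s ** cpow (adj S) t].

Lemma toeplitz_elements_dense : dense_span toeplitz_elements.
Proof.
apply: (generates_dense_span Sgen).
- by move=> _ ->; apply: lspan_gen; exists 1%N, 0%N; rewrite /cpow /= !cmul1r.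
- by exists 0%N, 0%N; rewrite /cpow /= cmul1r.
- move=> _ _ [s [t ->]] [s' [t' ->]]; apply: lspan_gen.
  exists (s + (s' - t))%N, ((t - s') + t')%N.
  by rewrite -cmulA (cmulA (cpow (adj S) t)) isometry_mul// !cpowD !cmulA.
- by move=> _ [s [t ->]]; exists t, s; rewrite adjM !adj_cpow adjK.
Qed.

End ToeplitzDense.

(** * Ground states *)

Lemma approx_derivable (K : numFieldType) (f : K -> K) p c :
  (forall e, 0 < e -> exists2 r, 0 < r & forall z, `|z - p| < r ->
    `|f z - f p - c * (z - p)| <= e * `|z - p|) -> derivable f p 1.
Proof.
move=> fP; apply/cvg_ex; exists c; apply/cvgrPdist_le => e /fP[r r0 rP].
rewrite near_withinE; exists r => // h /=; rewrite sub0r normrN => hr h0.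
have := rP (h + p); rewrite addrK => /(_ hr).
have -> : f (h + p) - f p - c * h = - (h * (c - h^-1 * (f (h + p) - f p))) by field.
rewrite normrN normrM mulrC ler_pM2r ?normr_gt0// => /(le_trans _); apply.
by rewrite le_eqVlt; apply/orP; left; rewrite /GRing.scale /= mulr1.
Qed.

Lemma derivable_linear (K : numFieldType) (U W : normedModType K) (L : U -> W)
    (M : K) (f : K -> U) p :
  linear L -> (forall u, `|L u| <= M * `|u|) -> derivable f p 1 ->
  derivable (L \o f) p 1.
Proof.
move=> Ll LM /cvg_ex[l fl]; apply/cvg_ex; exists (L l).
have LB u v : L (u - v) = L u - L v by rewrite addrC -scaleN1r Ll scaleN1r addrC.
have L0 : L 0 = 0 by rewrite -(subrr 0) LB subrr.
have LZ z u : L (z *: u) = z *: L u by have := Ll z u 0; rewrite L0 !addr0.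
have M0 : 0 < `|M| + 1 by rewrite ltr_wpDl.
apply/cvgrPdist_le => e e0.
have /cvgrPdist_le := fl; move=> /(_ (e / (`|M| + 1)) (divr_gt0 e0 M0)).
apply: filterS => h; rewrite -LB -LZ -LB => hle.
rewrite (le_trans (LM _))// (@le_trans _ _ ((`|M| + 1) * (e / (`|M| + 1))))//; last first.
  by rewrite mulrC divfK// gt_eqF.
apply: le_trans (_ : (`|M| + 1) * `|l - h^-1 *: ((f \o shift p) (h *: 1) - f p)| <= _); last by rewrite ler_pM2l.
have [->|u0] := eqVneq (l - h^-1 *: ((f \o shift p) (h *: 1) - f p)) 0.
  by rewrite normr0 !mulr0.
have := le_trans (normr_ge0 _) (LM (l - h^-1 *: ((f \o shift p) (h *: 1) - f p))).
rewrite pmulr_lge0 ?normr_gt0// => Mge0.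
by rewrite ler_wpM2r// ger0_norm// lerDl.
Qed.

(** * Differentiability of the exponential e^(i k z) *)

Section ComplexExponential.
Variable R : realType.
Local Notation C := R[i].
Implicit Types (k t : R) (z w h : C).

(* The function [z |-> e^(i k z)]. *)
Definition expi k z : C :=
  (expR (- k * complex.Im z))%:C * cis (k * complex.Re z).

Lemma cisD s t : cis (s + t) = cis s * cis t :> C.
Proof.
rewrite /cis cosD sinD; apply/eqP; rewrite eq_complex /=; apply/andP; split=> //.
by rewrite [X in _ == X]addrC.
Qed.

Lemma cis0 : cis 0 = 1 :> C.
Proof. by rewrite /cis cos0 sin0. Qed.

Lemma conj_cis t : conjc (cis t) = cis (- t) :> C.
Proof. by rewrite /cis cosN sinN. Qed.

Lemma norm_cis t : `|cis t| = 1 :> C.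
Proof. by rewrite normc_def /= cos2Dsin2 sqrtr1. Qed.

Lemma norm_expi k z : `|expi k z| = (expR (- k * complex.Im z))%:C.
Proof. by rewrite normrM norm_cis mulr1 ger0_norm// ler0c expR_ge0. Qed.

Lemma expi_real k t : expi k t%:C = cis (k * t).
Proof. by rewrite /expi /= mulr0 expR0 mul1r. Qed.

Lemma expiD k z w : expi k (z + w) = expi k z * expi k w.
Proof. by rewrite /expi ReD ImD !mulrDr expRD cisD real_complexM mulrACA. Qed.

(** The derivative at 0 is assembled from the real derivatives of exp, cos and sin; the errors add
    up to 5 e |x| + e |y|, whence the 6. *)
Lemma expi_approx0 k e : 0 < e -> exists2 r : R, 0 < r & forall h,
  `|h| < r%:C -> `|expi k h - 1 - ('i * k%:C) * h| <= (6 * e)%:C * `|h|.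
Proof.
move=> e0.
have dl c : is_derive (0 : R) 1 (fun y => c * y : R) c.
  by apply: is_derive_eq; rewrite /GRing.scale /= mulr1.
have [dE vE] : is_derive (0 : R) 1 (fun y => expR (- k * y) : R) (- k).
  by apply: is_derive_eq; rewrite /GRing.scale /= mulr0 expR0 mul1r.
have [dC vC] : is_derive (0 : R) 1 (fun y => cos (k * y) : R) 0.
  by apply: is_derive_eq; rewrite /GRing.scale /= mulr0 sin0 oppr0 mul0r.
have [dS vS] : is_derive (0 : R) 1 (fun y => sin (k * y) : R) k.
  by apply: is_derive_eq; rewrite /GRing.scale /= mulr0 cos0 mul1r.
have [r1 r10 h1] := derivable_approx dE e0.
have [r2 r20 h2] := derivable_approx dC e0.
have [r3 r30 h3] := derivable_approx dS e0.
(* This radius keeps |E - 1| (|k| + 1) below both 1 and e, which bounds |E| by 2 and the cross term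
   (E - 1) k x by e |x|. *)
pose r4 := Num.min 1 e / (e + `|k| + 1) / (`|k| + 1).
have k0 := normr_ge0 k.
have r40 : 0 < r4 by rewrite !divr_gt0// ?lt_min ?e0 ?ltr01//; lra.
exists (Num.min (Num.min r1 r2) (Num.min r3 r4)); first by rewrite !lt_min r10 r20 r30.
case=> x y hr.
have xr : `|x| < Num.min (Num.min r1 r2) (Num.min r3 r4).
  by rewrite -ltcR (le_lt_trans _ hr)// (normc_ge_Re (x +i* y)).
have yr : `|y| < Num.min (Num.min r1 r2) (Num.min r3 r4).
  by rewrite -ltcR (le_lt_trans _ hr)// (normc_ge_Im (x +i* y)).
move: xr yr; rewrite !lt_min => /andP[/andP[_ x2] /andP[x3 x4]] /andP[/andP[y1 _] /andP[_ y4]].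
have := h1 y; rewrite subr0 vE mulr0 expR0 => /(_ y1) E1.
have := h2 x; rewrite subr0 vC mulr0 cos0 mul0r subr0 => /(_ x2) E2.
have := h3 x; rewrite subr0 vS mulr0 sin0 subr0 => /(_ x3) E3.
set E := expR _ in E1.
have E4 : `|E - 1| <= (e + `|k|) * `|y|.
  have -> : E - 1 = (E - 1 - - k * y) + - k * y by ring.
  by rewrite (le_trans (ler_normD _ _))// mulrDl lerD// normrM normrN.
have E5 : `|E - 1| * (`|k| + 1) <= Num.min 1 e.
  rewrite -ler_pdivlMr ?ltr_wpDl// (le_trans E4)//.
  have : `|y| * (e + `|k| + 1) <= Num.min 1 e / (`|k| + 1).
    by rewrite -ler_pdivlMr ?ltr_wpDl ?addr_ge0// ?ltW// mulrAC.
  by have := normr_ge0 y; nra.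
move: E5; rewrite le_min => /andP[E5 E6].
have E7 : `|E| <= 2.
  rewrite -(subrK 1 E) (le_trans (ler_normD _ _))// normr1.
  by have := normr_ge0 (E - 1); nra.
have E8 : `|E - 1| * `|k| <= e by have := normr_ge0 (E - 1); nra.
apply: le_trans (normc_le_ReIm _) _.
have hx : `|x|%:C <= `|x +i* y| := normc_ge_Re (x +i* y).
have hy : `|y|%:C <= `|x +i* y| := normc_ge_Im (x +i* y).
apply: (@le_trans _ _ (5 * e * `|x| + e * `|y|)%:C); last first.
  rewrite real_complexD !real_complexM.
  have -> : 6%:C * e%:C * `|x +i* y| = 5%:C * e%:C * `|x +i* y| + e%:C * `|x +i* y|.
    have -> : 6%:C = 5%:C + 1 :> C by rewrite -(rmorph1 (real_complex R)) -real_complexD; congr (_%:C); ring.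
    by rewrite !mulrDl mul1r.
  have e0' : 0 <= e%:C by rewrite ler0c ltW.
  by rewrite lerD// ler_wpM2l// mulr_ge0// ler0c.
rewrite lecR.
have -> : complex.Re (expi k (x +i* y) - 1 - 'i * k%:C * (x +i* y)) =
    E * (cos (k * x) - 1) + (E - 1 - - k * y).
  by rewrite /expi /cis /= -/E; ring.
have -> : complex.Im (expi k (x +i* y) - 1 - 'i * k%:C * (x +i* y)) =
    E * (sin (k * x) - k * x) + (E - 1) * (k * x).
  by rewrite /expi /cis /= -/E; ring.
have B1 := ler_normD (E * (cos (k * x) - 1)) (E - 1 - - k * y).
have B2 := ler_normD (E * (sin (k * x) - k * x)) ((E - 1) * (k * x)).
have B3 : `|E * (cos (k * x) - 1)| <= 2 * (e * `|x|) by rewrite normrM ler_pM.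
have B4 : `|E * (sin (k * x) - k * x)| <= 2 * (e * `|x|) by rewrite normrM ler_pM.
have B5 : `|(E - 1) * (k * x)| <= e * `|x| by rewrite !normrM mulrA ler_wpM2r.
lra.
Qed.

Lemma derivable_expi k z : derivable (expi k) z 1.
Proof.
apply: (@approx_derivable _ _ _ ('i * k%:C * expi k z)) => e e0.
have N0 : 0 < `|expi k z| + 1 by rewrite ltr_wpDl.
have e60 : 0 < e / 6 / (`|expi k z| + 1) by rewrite !divr_gt0.
have [|r r0 rP] := @expi_approx0 k (complex.Re (e / 6 / (`|expi k z| + 1))).
  by rewrite -ltcR -gt0_complexE.
exists r%:C; first by rewrite ltcR.
move=> w wr; have := rP _ wr.
rewrite real_complexM -gt0_complexE// => h.
have -> : expi k w - expi k z - 'i * k%:C * expi k z * (w - z) =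
    expi k z * (expi k (w - z) - 1 - 'i * k%:C * (w - z)).
  by rewrite -[in expi k w](subrK z w) [w - z + z]addrC expiD; ring.
rewrite normrM (le_trans (ler_wpM2l _ h))// mulrA ler_wpM2r//.
have -> : `|expi k z| * (6%:C * (e / 6 / (`|expi k z| + 1))) = e * (`|expi k z| / (`|expi k z| + 1)).
  have -> : 6%:C = 6 :> C by rewrite -(rmorph_nat (real_complex R)).
  by field; rewrite gt_eqF.
by rewrite ger_pMr// ler_pdivrMr// mul1r lerDl.
Qed.

End ComplexExponential.

Section GroundStates.
Variables (R : realType) (c d : nat) (A : cstarAlgType R) (T : BS c d -> A).
Hypotheses (c_gt0 : (0 < c)%N) (d_gt0 : (0 < d)%N).
Hypothesis AT : is_semigroup_algebra (@bs_pos c d) T.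
Variable alpha : R -> A -> A.
Hypothesis Aalpha : is_dynamics (@bs_pos c d) (@bs_theta c d) T alpha.
Local Notation C := R[i].
Local Notation P := (@bs_pos c d).
Local Notation theta := (@bs_theta c d).
Implicit Types (x y : BS c d) (X Y Z : A) (k t : R) (phi psi : A -> C).

Definition theta_null phi := forall x y, P x -> P y ->
  theta x != 0 \/ theta y != 0 -> phi (T x ** adj (T y)) = 0.

Lemma alphaD t X Y : alpha t (X + Y) = alpha t X + alpha t Y.
Proof. by have := star_hom_linear (dyn_star_hom Aalpha t) 1 X Y; rewrite !scale1r. Qed.

Lemma alpha0r t : alpha t 0 = 0.
Proof. by apply: (@addrI _ (alpha t 0)); rewrite -alphaD !addr0. Qed.

Lemma alphaZ t z X : alpha t (z *: X) = z *: alpha t X.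
Proof.
by have := star_hom_linear (dyn_star_hom Aalpha t) z X 0; rewrite alpha0r !addr0.
Qed.

Lemma alphaM t X Y : alpha t (X ** Y) = alpha t X ** alpha t Y.
Proof. exact: (star_homM (dyn_star_hom Aalpha t)). Qed.

Lemma alpha_adj t X : alpha t (adj X) = adj (alpha t X).
Proof. exact: (star_hom_adj (dyn_star_hom Aalpha t)). Qed.

Definition homogeneous k X := forall t, alpha t X = cis (k * t) *: X.

Lemma homogeneous_T x : P x -> homogeneous (theta x)%:~R (T x).
Proof. by move=> Px t; rewrite (dyn_gen Aalpha)// mulrC. Qed.

Lemma homogeneous_adj k X : homogeneous k X -> homogeneous (- k) (adj X).
Proof. by move=> h t; rewrite alpha_adj h adjZ conj_cis mulNr. Qed.

Lemma homogeneousM k l X Y : homogeneous k X -> homogeneous l Y ->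
  homogeneous (k + l) (X ** Y).
Proof.
by move=> hX hY t; rewrite alphaM hX hY cmulZl cmulZr scalerA mulrDl cisD.
Qed.

Lemma homogeneousD k X Y : homogeneous k X -> homogeneous k Y ->
  homogeneous k (X + Y).
Proof. by move=> hX hY t; rewrite alphaD hX hY scalerDr. Qed.

Lemma homogeneousZ k z X : homogeneous k X -> homogeneous k (z *: X).
Proof. by move=> hX t; rewrite alphaZ hX !scalerA mulrC. Qed.

Lemma homogeneous_orbit k X : homogeneous k X ->
  entire_orbit alpha X (fun z => expi k z *: X).
Proof.
move=> hX; split=> [z|t]; last by rewrite expi_real hX.
have := @derivable_linear _ C A (fun w => w *: X) `|X| (expi k) z; apply.
- by move=> u v w; rewrite scalerDl scalerA.
- by move=> u; rewrite normrZ mulrC.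
- exact: derivable_expi.
Qed.

(* Along the positive imaginary axis the orbit of [adj (T y)] grows like
   [e^(theta y * Im z)]. *)
Lemma ground_theta_null phi : is_ground alpha phi -> theta_null phi.
Proof.
move=> [phis ground].
have phip := state_positive phis.
have h x y : P x -> P y -> theta y != 0 -> phi (T x ** adj (T y)) = 0.
  move=> Px Py y0.
  have n0 : 0 < (theta y)%:~R :> R by rewrite ltr0z lt_neqAle eq_sym y0 bs_theta_ge0.
  set n := _%:~R in n0.
  have hy := homogeneous_orbit (homogeneous_adj (homogeneous_T Py)).
  have [|M MP] := ground (T x) _ _ _ hy.
    by exists (fun z => expi (theta x)%:~R z *: T x); exact/homogeneous_orbit/homogeneous_T.
  apply/eqP; rewrite -normr_eq0; apply/negP => /negP phi0.
  have {}phi0 : 0 < complex.Re `|phi (T x ** adj (T y))|.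
    by rewrite -ltcR -ge0_complexE// normr_gt0 -normr_eq0.
  set r := complex.Re _ in phi0.
  have rE : `|phi (T x ** adj (T y))| = r%:C by apply: ge0_complexE.
  (* At this height y one has r e^(n y) >= r (1 + n y) = r + |M| + 1 > M. *)
  have := MP (0 +i* ((`|M| + 1) / (n * r))) _; rewrite /= cmulZr pfunZ// normrM norm_expi.
  rewrite rE -real_complexM lecR /= opprK -/n.
  have q0 : 0 < (`|M| + 1) / (n * r) by rewrite divr_gt0 ?mulr_gt0// ltr_wpDl.
  move=> /(_ q0).
  have := expR_ge1Dx (n * ((`|M| + 1) / (n * r))).
  have -> : n * ((`|M| + 1) / (n * r)) = (`|M| + 1) / r.
    by field; rewrite !gt_eqF.
  rewrite -(ler_pM2r phi0) mulrDl divfK ?gt_eqF// => a1 a2.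
  have := ler_norm M; lra.
move=> x y Px Py; have [y0 []//|y0 _] := boolP (theta y == 0); last exact: h.
move=> x0; rewrite -[_ ** _]adjK pfun_adj// adjM adjK h ?conjc0//.
Qed.

Section ThetaNullGround.
Variable psi : A -> C.
Hypotheses (psis : is_state psi) (psi0 : theta_null psi).
Let psip := state_positive psis.

(** Two states are compared on the T_x T_y^*: those with theta x = theta y = 0 are fixed by the
    dynamics, and psi kills the others. *)
Lemma theta_null_invariant t X : psi (alpha t X) = psi X.
Proof.
suff : psi \o alpha t = psi by move=> /(congr1 (@^~ X)).
apply: (state_ext (spanning_elements_dense c_gt0 d_gt0 AT)) => //.
  split=> [z Y Z|Y|] /=.
  - by rewrite alphaD alphaZ; case: psis => -> _ _.
  - by rewrite alphaM alpha_adj pfun_ge0.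
  - by rewrite (star_hom1 (dyn_star_hom Aalpha t)); case: psis.
move=> _ [x [y [Px Py ->]]] /=.
have := homogeneousM (homogeneous_T Px) (homogeneous_adj (homogeneous_T Py)).
move=> ->; rewrite pfunZ//.
have [/andP[/eqP -> /eqP ->]|] := boolP ((theta x == 0) && (theta y == 0)).
  by rewrite subrr mul0r cis0 mul1r.
by rewrite negb_and => /orP h; rewrite (psi0 Px Py h) mulr0.
Qed.

(** At time pi / k the dynamics multiplies X by -1, while psi is invariant. *)
Lemma theta_null_degree k X : homogeneous k X -> k != 0 -> psi X = 0.
Proof.
move=> hX k0; have := theta_null_invariant (pi / k) X.
rewrite hX [k * _]mulrC divfK// pfunZ// => /eqP.
rewrite -subr_eq0 -[X in _ - X]mul1r -mulrBl mulf_eq0 => /orP[|/eqP//].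
rewrite /cis cospi sinpi subr_eq0 eq_complex /= eqNr.
by rewrite oner_eq0.
Qed.

(** Both sides are entire in z, and on the real line the equality is the invariance of psi. *)
Lemma theta_null_orbit k X Y f z : homogeneous (- k) X -> entire_orbit alpha Y f ->
  psi (X ** f z) = expi k z * psi (X ** Y).
Proof.
move=> hX [df fr]; apply/eqP; rewrite -subr_eq0; apply/eqP.
apply: (@identity_theorem _ (fun w => psi (X ** f w) - expi k w * psi (X ** Y))).
  move=> w; apply: derivableB.
    have := @derivable_linear _ A C (fun Z => psi (X ** Z)) `|X| f w; apply=> //.
    - by move=> u v v'; rewrite cmulDr cmulZr pfunZD.
    - by move=> u; rewrite (le_trans (state_bounded _ psis))// cstar_normM.
  have := @derivable_linear _ C C (fun v : C => v * psi (X ** Y)) `|psi (X ** Y)| (expi k) w.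
  apply=> [u v v'|u|].
  - by rewrite mulrDl scalerAl.
  - by rewrite normrM mulrC.
  - exact: derivable_expi.
move=> t; rewrite fr expi_real; apply/eqP; rewrite subr_eq0; apply/eqP.
rewrite -[in RHS](theta_null_invariant t) alphaM hX cmulZl pfunZ// mulrA -cisD.
by rewrite mulNr subrr cis0 mul1r.
Qed.

Lemma theta_null_orthogonal N (U : nat -> A) (a : nat -> C) :
  (forall n, homogeneous (- n%:R) (U n)) ->
  psi ((\sum_(n < N) a n *: U n) ** adj (\sum_(n < N) a n *: U n)) =
  \sum_(n < N) `|a n| ^+ 2 * psi (U n ** adj (U n)).
Proof.
move=> hU; rewrite cmul_suml pfun_sum//; apply: eq_bigr => i _.
rewrite adj_sum cmul_sumr pfun_sum// (bigD1 i)//= big1 ?addr0 => [|j ji].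
  by rewrite adjZ cmulZl cmulZr !pfunZ// mulrA -sqr_normc.
rewrite adjZ cmulZl cmulZr !pfunZ//.
rewrite (@theta_null_degree (- i%:R - - j%:R)) ?mulr0//.
  exact/homogeneousM/homogeneous_adj.
by rewrite opprK addrC subr_eq0 eqr_nat.
Qed.

(** Elements T_x T_y^* with theta x nonzero go into W, and the others have degree - theta y <= 0.
    One equation for all large N makes decompositions of different lengths addable. *)
Definition graded X := exists (U : nat -> A) W N0,
  [/\ forall n, homogeneous (- n%:R) (U n), forall Y, psi (W ** Y) = 0 &
      forall N, (N0 <= N)%N -> X = \sum_(n < N) U n + W].

Lemma graded_lspan X : lspan (spanning_elements T) X -> graded X.
Proof.
elim=> [|z _ {}X [x [y [Px Py ->]]] _ [U [W [N0 [hU W0 XE]]]]].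
  exists (fun=> 0), 0, 0%N; split=> [n t|Y|N _].
  - by rewrite alpha0r scaler0.
  - by rewrite cmul0r pfun0.
  - by rewrite big1 ?addr0.
have [x0|x0] := eqVneq (theta x) 0; last first.
  exists U, (z *: (T x ** adj (T y)) + W), N0; split=> [//|Y|N /XE ->].
    rewrite cmulDl cmulZl pfunZD// W0 addr0 -cmulA -[T x]adjK.
    by rewrite pfun_null_adj ?mulr0// adjK psi0//; left.
  by rewrite addrCA.
have [n ny] : exists n : nat, theta y = n%:Z.
  by have := bs_theta_ge0 Py; case: (theta y) => // n _; exists n.
exists (fun j : nat => U j + (if j == n then z *: (T x ** adj (T y)) else 0)), W, (maxn N0 n.+1).
split=> [j|//|N].
  apply: homogeneousD => //; case: eqP => [->|_ t]; last by rewrite alpha0r scaler0.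
  apply: homogeneousZ; have := homogeneousM (homogeneous_T Px) (homogeneous_adj (homogeneous_T Py)).
  by rewrite x0 ny add0r.
rewrite geq_max => /andP[/XE -> nN].
rewrite big_split /= addrA; congr (_ + _); rewrite addrC; congr (_ + _).
by rewrite (bigD1 (Ordinal nN))//= eqxx big1 ?addr0// => i /negPf; rewrite -val_eqE /= => ->.
Qed.

(** Moving f z onto X multiplies the component of degree -n by e^(i n z), of modulus at most 1;
    orthogonality of the components then shows that psi (Q Q^* ) is at most psi (X X^* ). *)
Lemma theta_null_bounded X Y f z : lspan (spanning_elements T) X ->
  entire_orbit alpha Y f -> 0 < complex.Im z -> `|psi (X ** f z)| <= `|X| * `|Y|.
Proof.
move=> /graded_lspan[U [W [N [hU W0 /(_ N (leqnn N)) XE]]]] fY z0.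
set X0 := \sum_(n < N) U n in XE.
pose Q := \sum_(n < N) expi n%:R z *: U n.
have -> : psi (X ** f z) = psi (Q ** Y).
  rewrite XE cmulDl pfunD// W0 addr0 !cmul_suml !pfun_sum//.
  by apply: eq_bigr => i _; rewrite (theta_null_orbit _ (hU i) fY) cmulZl pfunZ.
rewrite -(@ler_pXn2r _ 2)// ?nnegrE ?mulr_ge0//.
have := pfun_cauchy_schwarz psip Y (adj Q); rewrite adjK => /le_trans; apply.
rewrite exprMn mulrC ler_pM ?pfun_ge0 ?pfun_ge0'//; last first.
  by rewrite (le_trans (pfun_sqr_le _ _))//; case: psis => _ _ ->; rewrite mul1r.
have X00 : psi (X0 ** adj X0) = psi (X ** adj X).
  rewrite XE adjD cmulDl (pfunD psip (X0 ** _)) W0 addr0 cmulDr pfunD//.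
  by rewrite -[X0 ** adj W]adjK (pfun_adj psip) adjM adjK W0 conjc0 addr0.
have XX : psi (X ** adj X) <= `|X| ^+ 2.
  rewrite -[X in X ** _]adjK (le_trans (pfun_sqr_le _ _))// norm_adj.
  by case: psis => _ _ ->; rewrite mul1r.
rewrite (le_trans _ XX)// -X00.
have -> : X0 = \sum_(n < N) (fun=> 1 : C) n *: U n by apply: eq_bigr => i _; rewrite scale1r.
rewrite (theta_null_orthogonal N (fun n => expi n%:R z) hU) (theta_null_orthogonal N (fun=> 1) hU).
apply: ler_sum => i _; rewrite ler_wpM2r ?pfun_ge0'// ler_pXn2r ?nnegrE//.
by rewrite norm_expi normr1 -(rmorph1 (real_complex R)) lecR -expR0 ler_expR mulNr oppr_le0 mulr_ge0// ltW.
Qed.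

Lemma theta_null_ground : is_ground alpha psi.
Proof.
split=> // X Y f _ fY; exists (complex.Re (`|X| * `|Y|)) => z z0.
rewrite -ge0_complexE ?mulr_ge0//; apply/ler_addgt0Pr => e e0.
have dE := spanning_elements_dense c_gt0 d_gt0 AT.
(* The approximant of X may depend on z, since the bound for elements of the span involves neither z
   nor f. *)
have D0 : 0 < `|f z| + `|Y| + 1 by rewrite ltr_wpDl// addr_ge0.
have [X' sX' XX'] := dE X (e / (`|f z| + `|Y| + 1)) (divr_gt0 e0 D0).
rewrite -[X](subrK X') cmulDl pfunD// (le_trans (ler_normD _ _))//.
have h1 : `|psi ((X - X') ** f z)| <= `|X - X'| * `|f z|.
  by rewrite (le_trans (state_bounded _ psis))// cstar_normM.
have h2 := theta_null_bounded sX' fY z0.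
have h3 : `|X'| <= `|X| + `|X - X'|.
  by rewrite -{1}[X'](subKr X) ler_normB.
rewrite subrK (le_trans (lerD h1 h2))//.
rewrite (le_trans (lerD (lexx _) (ler_wpM2r (normr_ge0 Y) h3)))//.
rewrite mulrDl addrCA lerD2l -mulrDr.
rewrite (@le_trans _ _ (`|X - X'| * (`|f z| + `|Y| + 1)))//.
  by rewrite ler_wpM2l// lerDl.
by rewrite -ler_pdivlMr// ltW.
Qed.

End ThetaNullGround.

End GroundStates.

(** * The correspondence between Toeplitz states and ground states *)

Section Parametrization.
Variables (R : realType) (c d : nat) (A : cstarAlgType R) (T : BS c d -> A).
Hypotheses (c_gt0 : (0 < c)%N) (d_gt0 : (0 < d)%N).
Hypothesis AT : is_semigroup_algebra (@bs_pos c d) T.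
Variables (TN : cstarAlgType R) (S : TN).
Hypothesis TNS : is_toeplitz S.
Local Notation C := R[i].
Local Notation P := (@bs_pos c d).
Local Notation b := (bs_b c d).
Implicit Types (omega : TN -> C) (psi phi : A -> C) (x y : BS c d).

(** A relation rather than a map: partners exist in both directions by compactness and are unique by
    density, and the map is chosen from it afterwards. *)
Definition corresponds omega psi := theta_null T psi /\ forall s t,
  psi (T (b ^+ s)%g ** adj (T (b ^+ t)%g)) = omega (cpow S s ** cpow (adj S) t).

Let S_isometry : adj S ** S = cone := (toeplitz_coefficients TNS).1.

Lemma corresponds_ground omega : is_state omega ->
  exists psi, is_state psi /\ corresponds omega psi.
Proof.
move=> omegas; have [F [FP Fb F0]] := bs_matrix_coefficients c_gt0 d_gt0 AT.
have [psi [psis psib psi0]] := exists_transfer FP omegas S_isometry.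
exists psi; split=> //; split=> [x y Px Py xy|s t].
  by apply: psi0 => m n; exact: F0.
by apply: psib => m n; exact: Fb.
Qed.

Lemma corresponds_toeplitz psi : is_state psi -> theta_null T psi ->
  exists omega, is_state omega /\ corresponds omega psi.
Proof.
move=> psis psi0; have [_ [F [FP FS]]] := toeplitz_coefficients TNS.
have [omega [omegas omegaS _]] :=
  exists_transfer FP psis (T_isometry AT (@bs_posb c d)).
exists omega; split=> //; split=> // s t.
rewrite (omegaS s t) => [|m n]; last exact: FS.
by rewrite !(T_bX AT) adj_cpow.
Qed.

Lemma corresponds_injl omega psi phi : is_state psi -> is_state phi ->
  corresponds omega psi -> corresponds omega phi -> psi = phi.
Proof.
move=> psis phis [psi0 psiS] [phi0 phiS].
apply: (state_ext (spanning_elements_dense c_gt0 d_gt0 AT)) => // _ [x [y [Px Py ->]]].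
have [x0|x0] := eqVneq (bs_theta x) 0; last by rewrite psi0 ?phi0//; left.
have [y0|y0] := eqVneq (bs_theta y) 0; last by rewrite psi0 ?phi0//; right.
have [s ->] := bs_theta_eq0 c_gt0 d_gt0 Px x0; have [t ->] := bs_theta_eq0 c_gt0 d_gt0 Py y0.
by rewrite psiS phiS.
Qed.

Lemma corresponds_injr omega omega' psi : is_state omega -> is_state omega' ->
  corresponds omega psi -> corresponds omega' psi -> omega = omega'.
Proof.
move=> os os' [_ h] [_ h'].
apply: (state_ext (toeplitz_elements_dense TNS.1 S_isometry)) => // _ [s [t ->]].
by rewrite -h -h'.
Qed.

Lemma corresponds_mix omega omega' psi psi' (s : R) :
  corresponds omega psi -> corresponds omega' psi' ->
  corresponds (mix s omega omega') (mix s psi psi').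
Proof.
move=> [n h] [n' h']; split=> [x y Px Py xy|k l]; rewrite /mix ?h ?h'//.
by rewrite n// n'// !mulr0 addr0.
Qed.

Variable alpha : R -> A -> A.
Hypothesis Aalpha : is_dynamics P (@bs_theta c d) T alpha.

Lemma groundP psi : is_ground alpha psi <-> is_state psi /\ theta_null T psi.
Proof.
split=> [gpsi|[psis psi0]]; last exact: (theta_null_ground c_gt0 d_gt0 AT Aalpha).
by split; [case: gpsi|exact: (ground_theta_null Aalpha gpsi)].
Qed.

Lemma parametrization : exists Psi : {ptws TN -> C} -> {ptws A -> C},
  (forall omega, is_state omega -> is_state (Psi omega) /\ corresponds omega (Psi omega)) /\
  affine_isomorphism (@states R TN) (ground_states alpha) Psi.
Proof.
have [Psi PsiP] : exists Psi : (TN -> C) -> (A -> C), forall omega, is_state omega ->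
    is_state (Psi omega) /\ corresponds omega (Psi omega).
  have h omega : exists psi, is_state omega -> is_state psi /\ corresponds omega psi.
    (* Choice produces a total function; its values outside the states are arbitrary. *)
    have [os|os] := pselect (is_state omega); last by exists (fun=> 0).
    by have [psi hpsi] := corresponds_ground os; exists psi.
  by have [f fP] := choice h; exists f.
have [H HP] : exists H : (A -> C) -> (TN -> C), forall psi, is_ground alpha psi ->
    is_state (H psi) /\ corresponds (H psi) psi.
  have h psi : exists omega, is_ground alpha psi -> is_state omega /\ corresponds omega psi.
    have [/groundP[psis psi0]|gpsi] := pselect (is_ground alpha psi); last by exists (fun=> 0).
    by have [omega homega] := corresponds_toeplitz psis psi0; exists omega.
  by have [f fP] := choice h; exists f.
have PsiG omega : is_state omega -> is_ground alpha (Psi omega).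
  by move=> /PsiP[psis [psi0 _]]; apply/groundP.
have HK omega : is_state omega -> H (Psi omega) = omega.
  move=> os; have [hs hc] := HP _ (PsiG _ os).
  by have [_ h] := PsiP _ os; exact: corresponds_injr hs os hc h.
exists Psi; split; [exact: PsiP|split].
- split=> [omega|omega omega'|psi gpsi].
  + exact: PsiG.
  + by rewrite !inE => os os' E; rewrite -(HK _ os) -(HK _ os') E.
  + have [hs hc] := HP _ gpsi; exists (H psi) => //.
    have [ps pc] := PsiP _ hs; case: gpsi => psis _.
    exact: corresponds_injl ps psis pc hc.
- move=> f g s fs gs s01; have ms := mix_state fs gs s01.
  have [ps pc] := PsiP _ ms; have [fs' fc] := PsiP _ fs; have [gs' gc] := PsiP _ gs.
  apply: corresponds_injl ps (mix_state fs' gs' s01) pc _.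
  exact: corresponds_mix.
- apply: (transfer_continuous (spanning_elements_dense c_gt0 d_gt0 AT)).
    by move=> omega /PsiP[].
  move=> _ [x [y [Px Py ->]]].
  have [xy|] := boolP ((bs_theta x == 0) && (bs_theta y == 0)).
    case/andP: xy => /eqP x0 /eqP y0.
    have [s ->] := bs_theta_eq0 c_gt0 d_gt0 Px x0; have [t ->] := bs_theta_eq0 c_gt0 d_gt0 Py y0.
    by exists (cpow S s ** cpow (adj S) t) => omega /PsiP[_ [_ ->]].
  rewrite negb_and => /orP xy; exists 0 => omega os.
  have [_ [h _]] := PsiP _ os.
  by rewrite h// pfun0//; exact: state_positive.
- exists H; split; last by move=> omega; rewrite inE; exact: HK.
  apply: (transfer_continuous (toeplitz_elements_dense TNS.1 S_isometry)).
    by move=> psi /HP[].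
  move=> _ [s [t ->]]; exists (T (b ^+ s)%g ** adj (T (b ^+ t)%g)) => psi.
  by move=> /HP[_ [_ ->]].
Qed.

(** The bound in the definition of a ground state may vary with the state, so closedness is read off
    [groundP], where the conditions are equations. *)
Lemma ground_compact : compact (ground_states alpha).
Proof.
apply: compact_set_of_states => [phi [//]|F FF phi FL Fphi].
apply/groundP; split.
  by apply: (state_limit _ Fphi); apply: filterS FL => f [].
move=> x y Px Py xy.
apply: (cvg_unique (@norm_hausdorff _ C) (Fphi _)).
apply: cvg_trans (@cvg_cst C 0 _ F _); apply: near_eq_cvg.
by apply: filterS FL => f /groundP[_ ->].
Qed.

Lemma ground_convex : functional_convex (ground_states alpha).
Proof.
move=> f g s /groundP[fs f0] /groundP[gs g0] s01; apply/groundP; split.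
  exact: mix_state.
by move=> x y Px Py xy; rewrite /mix f0// g0// !mulr0 addr0.
Qed.

End Parametrization.

(** * KMS states *)

Lemma sum_ord_recl (V : nmodType) n (G : nat -> V) : (0 < n)%N ->
  \sum_(i < n) G i = G 0%N + \sum_(i < n.-1) G i.+1.
Proof. by case: n => // n _; rewrite big_ord_recl. Qed.

Lemma sum_ord_recr (V : nmodType) n (G : nat -> V) : (0 < n)%N ->
  \sum_(i < n) G i = \sum_(i < n.-1) G i + G n.-1.
Proof. by case: n => // n _; rewrite big_ord_recr. Qed.

Section KMS.
Variables (R : realType) (c d : nat) (A : cstarAlgType R) (T : BS c d -> A).
Hypotheses (c_gt0 : (0 < c)%N) (d_gt0 : (0 < d)%N).
Hypothesis AT : is_semigroup_algebra (@bs_pos c d) T.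
Local Notation C := R[i].
Local Notation P := (@bs_pos c d).
Local Notation a := (bs_a c d).
Local Notation b := (bs_b c d).
Local Notation theta := (@bs_theta c d).
Implicit Types (x y : BS c d) (X Y : A).
Let TM := TM AT.
Let T_isometry := T_isometry AT.
Hint Resolve bs_pos1 bs_posa bs_posb bs_pos_bX bs_pos_bXa bs_posM : core.

(** The factor for moving T_x around is multiplicative in x, so the two letters determine it; taking
    adjoints gives the inverse factor for T_y^*. *)
Lemma kms_of_generators (beta : R) (psi : A -> C) : is_state psi ->
  (forall Y, psi (T b ** Y) = psi (Y ** T b)) ->
  (forall Y, psi (T a ** Y) = (expR (- beta))%:C * psi (Y ** T a)) ->
  is_kms P theta T beta psi.
Proof.
move=> psis hb ha; have psip := state_positive psis.
have hT x : P x -> forall Y, psi (T x ** Y) =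
    (expR (- beta * (theta x)%:~R))%:C * psi (Y ** T x).
  elim/bs_pos_letters=> [Y|{}x Px IH Y|{}x Px IH Y].
  - by rewrite (T1 AT) cmul1l cmul1r bs_theta1 mulr0 expR0 mul1r.
  - rewrite TM// -cmulA ha -cmulA IH mulrA -real_complexM -expRD -cmulA.
    by rewrite bs_thetaM bs_theta_a intrD mulrDr mulr1.
  - by rewrite TM// -cmulA hb -cmulA IH -cmulA bs_thetaM bs_theta_b add0r.
have hA y : P y -> forall Y, psi (adj (T y) ** Y) =
    (expR (beta * (theta y)%:~R))%:C * psi (Y ** adj (T y)).
  move=> Py Y; have := congr1 conjc (hT y Py (adj Y)).
  rewrite conjcM conjc_real -!(pfun_adj psip) !adjM adjK => ->.
  by rewrite mulrA -real_complexM -expRD mulNr subrr expR0 mul1r.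
split=> // x y p q Px Py _ _; set W := T p ** adj (T q).
rewrite -cmulA hT// -cmulA hA// mulrA -real_complexM -expRD -!cmulA.
by congr ((expR _)%:C * _); rewrite intrB; ring.
Qed.

Section Trace.
Variable chi : A -> C.
Hypotheses (chis : is_state chi) (chi0 : theta_null T chi).
Hypothesis chi_b : forall s t, chi (T (b ^+ s.+1)%g ** adj (T (b ^+ t.+1)%g)) =
  chi (T (b ^+ s)%g ** adj (T (b ^+ t)%g)).
Let chip := state_positive chis.

Lemma chi_conj_b : chi (T b ** adj (T b)) = 1.
Proof.
by have := chi_b 0 0; rewrite !expg1 !expg0 (T1 AT) adj_cone cmul1l; case: chis => _ _ ->.
Qed.

(** The projection 1 - T_b T_b^* has mass 0 under chi. *)
Lemma chi_absorb_b X : chi (X ** (T b ** adj (T b))) = chi X.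
Proof.
apply/eqP; rewrite eq_sym -subr_eq0 -pfunB// -{1}[X]cmul1r -cmulBr; apply/eqP.
apply: pfun_null => //; rewrite adjB adjM adjK adj_cone cmulBl !cmulBr !cmul1l cmul1r.
rewrite cmulA -[T b ** adj (T b) ** T b]cmulA T_isometry// cmul1r subrr subr0.
by rewrite pfunB// chi_conj_b; case: chis => _ _ ->; rewrite subrr.
Qed.

Lemma chi_conj_Tb X : chi (T b ** X ** adj (T b)) = chi X.
Proof.
have : is_state (fun X => chi (T b ** X ** adj (T b))).
  split=> [z Y Z|Y|].
  - by rewrite cmulDr cmulZr cmulDl cmulZl pfunZD.
  - have -> : T b ** (adj Y ** Y) ** adj (T b) = adj (Y ** adj (T b)) ** (Y ** adj (T b)).
      by rewrite adjM adjK !cmulA.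
    exact: pfun_ge0.
  - by rewrite cmul1r chi_conj_b.
move=> /(state_ext (spanning_elements_dense c_gt0 d_gt0 AT)) /(_ chis) h.
have {}h := congr1 (@^~ X) (h _); apply: h.
move=> _ [x [y [Px Py ->]]].
rewrite cmulA -TM// -cmulA -(T_adjM AT)//.
have [x0|x0] := eqVneq (theta x) 0; last first.
  by rewrite !chi0//; auto; left; rewrite ?bs_thetaM ?bs_theta_b ?add0r.
have [y0|y0] := eqVneq (theta y) 0; last first.
  by rewrite !chi0//; auto; right; rewrite ?bs_thetaM ?bs_theta_b ?add0r.
have [s ->] := bs_theta_eq0 c_gt0 d_gt0 Px x0.
have [t ->] := bs_theta_eq0 c_gt0 d_gt0 Py y0.
by rewrite -!expgS chi_b.
Qed.

(** Inserting T_b T_b^* on the right of T_b Y exhibits T_b (Y T_b) T_b^*, and conjugation by T_b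
    does not change chi. *)
Lemma chi_trace_b Y : chi (T b ** Y) = chi (Y ** T b).
Proof. by rewrite -chi_absorb_b cmulA -(cmulA (T b)) chi_conj_Tb. Qed.

Lemma chi_null_a Y : chi (T a ** Y) = 0.
Proof.
rewrite -[T a]adjK pfun_null_adj// adjK chi0//; left.
by rewrite bs_theta_a.
Qed.

Fixpoint kms_phi k X : C := if k is k'.+1 then
  \sum_(i < d) kms_phi k' (adj (T (b ^+ i * a)%g) ** X ** T (b ^+ i * a)%g)
  else chi X.

Lemma kms_phi_positive k : positive_functional (kms_phi k).
Proof.
elim: k => [//|k IH]; split=> [z X Y|X] /=.
  rewrite mulr_sumr -big_split; apply: eq_bigr => i _ /=.
  by rewrite cmulDr cmulZr cmulDl cmulZl pfunZD.
apply: sumr_ge0 => i _.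
by rewrite cmulA -cmulA -adjM pfun_ge0.
Qed.

Lemma kms_phi1 k : kms_phi k cone = (d ^ k)%:R.
Proof.
elim: k => [|k IH]; first by case: chis.
rewrite /= (eq_bigr (fun=> (d ^ k)%:R)) => [|i _]; last first.
  by rewrite cmul1r T_isometry.
by rewrite sumr_const card_ord expnS natrM mulr_natl.
Qed.

Lemma kms_phi_trace_bX k : (forall Y, kms_phi k (T b ** Y) = kms_phi k (Y ** T b)) ->
  forall n Y, kms_phi k (T (b ^+ n)%g ** Y) = kms_phi k (Y ** T (b ^+ n)%g).
Proof.
move=> h n Y; elim: n Y => [|n IH] Y; first by rewrite (T1 AT) cmul1l cmul1r.
rewrite expgS TM// -cmulA h -cmulA IH.
by rewrite !cmulA.
Qed.

(** Multiplication by b shifts the elements b^i a with i < d; the wrap-around b^d a = a b^c leaves a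
    power of b, which the trace property at level k carries to the other side. *)
Lemma kms_phi_trace_b k Y : kms_phi k (T b ** Y) = kms_phi k (Y ** T b).
Proof.
elim: k Y => [|k IH] Y; first exact: chi_trace_b.
pose G (Z Z' : A) i := kms_phi k
  (adj (T (b ^+ i * a)%g) ** (Z ** Y ** Z') ** T (b ^+ i * a)%g).
have GE Z Z' : kms_phi k.+1 (Z ** Y ** Z') = \sum_(i < d) G Z Z' i by [].
rewrite -[T b ** Y]cmul1r -[Y in RHS]cmul1l !GE (sum_ord_recl _ d_gt0).
rewrite (sum_ord_recr _ d_gt0) addrC /G; congr (_ + _).
  apply: eq_bigr => i _; rewrite cmul1l cmul1r expgS -mulgA TM//.
  by rewrite adjM !cmulA -(cmulA _ (adj (T b))) T_isometry// cmul1r.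
have Ta_adj_Tb : adj (T a) ** T b = T (b ^+ c)%g ** adj (T (b ^+ d.-1 * a)%g).
  by rewrite -[LHS]adjK adjM adjK (Tb_adj_Ta c_gt0 d_gt0 AT) adjM adjK.
rewrite cmul1l cmul1r expg0 mul1g cmulA Ta_adj_Tb -!cmulA (kms_phi_trace_bX IH) -!cmulA.
by rewrite -!TM// bs_rel mulgA -expgS prednK.
Qed.

(** Only i = 0 contributes, because the ranges of T_a and T_(b^i a) are orthogonal for 0 < i < d. *)
Lemma kms_phiS_a k Y : kms_phi k.+1 (T a ** Y) = kms_phi k (Y ** T a).
Proof.
rewrite /= (bigD1 (Ordinal d_gt0))//= big1 ?addr0 => [|i i0].
  by rewrite expg0 mul1g cmulA T_isometry// cmul1l.
have {}i0 : (0 < i < d)%N by rewrite lt0n ltn_ord andbT.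
rewrite cmulA -[adj _ ** T a]adjK adjM adjK Ta_adj_TbXa//.
by rewrite adj_zero !cmul0r pfun0//; exact: kms_phi_positive.
Qed.

Section GibbsState.
Variable r : C.
Hypotheses (r_gt0 : 0 < r) (r_le : r <= 2^-1).
(** Here rho stands for e^(- beta). As [kms_phi k] has mass d^k, r = d rho is the ratio of the
    partition series, and r <= 1 / 2 keeps the partition sums below 2. *)
Let rho : C := r / d%:R.

Definition kms_sum K X : C := \sum_(k < K) rho ^+ k * kms_phi k X.
Definition kms_partition K : C := \sum_(k < K) r ^+ k.

Let rho_ge0 : 0 <= rho. Proof. by rewrite divr_ge0 ?ler0n// ltW. Qed.
Let d0 : d%:R != 0 :> C. Proof. by rewrite pnatr_eq0 -lt0n. Qed.

Lemma kms_partition_ge1 K : 1 <= kms_partition K.+1.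
Proof.
rewrite /kms_partition big_ord_recl expr0 lerDl.
by apply: sumr_ge0 => i _; rewrite exprn_ge0// ltW.
Qed.

Lemma kms_partition_le2 K : kms_partition K <= 2.
Proof.
elim: K => [|K IH]; first by rewrite /kms_partition big_ord0.
rewrite /kms_partition big_ord_recl expr0.
under eq_bigr => i _ do rewrite lift0 exprS.
rewrite -mulr_sumr -[X in _ <= X]/(1 + 1) lerD2l.
have p0 : 0 <= kms_partition K by rewrite /kms_partition; apply: sumr_ge0 => i _; rewrite exprn_ge0// ltW.
by rewrite (le_trans (ler_pM _ p0 r_le IH))// ?mulVf// ltW.
Qed.

Let Z0 K : 0 < kms_partition K.+1.
Proof. by rewrite (lt_le_trans _ (kms_partition_ge1 K)). Qed.

Lemma kms_weight k X : `|rho ^+ k * kms_phi k X| <= r ^+ k * `|X|.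
Proof.
rewrite normrM ger0_norm ?exprn_ge0//.
rewrite (le_trans (ler_wpM2l _ (pfun_bounded (kms_phi_positive k) X))) ?exprn_ge0//.
by rewrite kms_phi1 mulrA natrX -exprMn divfK.
Qed.

Lemma kms_sum_state K : is_state (fun X => kms_sum K.+1 X / kms_partition K.+1).
Proof.
split=> [z X Y|X|].
- rewrite mulrA -mulrDl; congr (_ / _).
  rewrite mulr_sumr -big_split; apply: eq_bigr => k _ /=.
  by rewrite (pfunZD (kms_phi_positive k)); ring.
- rewrite divr_ge0 ?(ltW (Z0 K))//; rewrite /kms_sum; apply: sumr_ge0 => k _.
  by rewrite mulr_ge0 ?exprn_ge0// pfun_ge0//; exact: kms_phi_positive.
- rewrite [X in X / _](_ : _ = kms_partition K.+1) ?divff ?gt_eqF//.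
  by apply: eq_bigr => k _; rewrite kms_phi1 natrX -exprMn divfK.
Qed.

Lemma kms_sum_trace_b K Y : kms_sum K (T b ** Y) = kms_sum K (Y ** T b).
Proof. by apply: eq_bigr => k _; rewrite kms_phi_trace_b. Qed.

(** On the left the term k = 0 vanishes since chi (T_a Y) = 0; after the index shift only the last
    term of the right-hand sum has no partner. *)
Lemma kms_sum_a K Y :
  `|kms_sum K.+1 (T a ** Y) - rho * kms_sum K.+1 (Y ** T a)| <= r ^+ K.+1 * `|Y ** T a|.
Proof.
rewrite /kms_sum big_ord_recl /= chi_null_a mulr0 add0r.
rewrite [X in _ - rho * X]big_ord_recr /= mulrDr mulr_sumr opprD addrA.
rewrite [X in X - _](_ : _ = 0) ?sub0r ?normrN; last first.
  apply/eqP; rewrite subr_eq0; apply/eqP; apply: eq_bigr => i _.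
  by rewrite -/(kms_phi i.+1 (T a ** Y)) kms_phiS_a exprS mulrA.
rewrite normrM (ger0_norm rho_ge0) exprS -[leRHS]mulrA ler_pM ?kms_weight//.
by rewrite ler_pdivrMr ?lt0r ?d0 ?ler0n// ler_peMr ?(ltW r_gt0)// ler1n.
Qed.

(** The term k = 0 is chi itself; the term k >= 1 deviates by at most 2 r^k |X|, and these sum to at
    most 2 r |X| times the bound 2 of the partition sums. *)
Lemma kms_sum_chi K X :
  `|kms_sum K.+1 X / kms_partition K.+1 - chi X| <= 4 * r * `|X|.
Proof.
have Z1 := kms_partition_ge1 K; have ZK := Z0 K.
have -> : kms_sum K.+1 X / kms_partition K.+1 - chi X =
    (kms_sum K.+1 X - kms_partition K.+1 * chi X) / kms_partition K.+1.
  by rewrite mulrBl mulrAC divff ?gt_eqF// mul1r.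
rewrite normrM normfV (ger0_norm (ltW ZK)) ler_pdivrMr//.
apply: le_trans (ler_peMr _ Z1); last by rewrite !mulr_ge0// ltW.
rewrite /kms_sum /kms_partition mulr_suml -sumrB big_ord_recl !expr0 subrr add0r.
rewrite (le_trans (ler_norm_sum _ _ _))//.
apply: (@le_trans _ _ (\sum_(k < K) 2 * r * `|X| * r ^+ k)); last first.
  rewrite -mulr_sumr -/(kms_partition K).
  have -> : 4 * r * `|X| = 2 * r * `|X| * 2 by ring.
  by rewrite ler_wpM2l ?kms_partition_le2// !mulr_ge0// ltW.
apply: ler_sum => k _; rewrite lift0 (le_trans (ler_normB _ _))//.
have -> : 2 * r * `|X| * r ^+ k = r ^+ k.+1 * `|X| + r ^+ k.+1 * `|X|.
  by rewrite exprS; ring.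
rewrite lerD ?kms_weight// normrM ger0_norm ?exprn_ge0 ?(ltW r_gt0)//.
by rewrite ler_wpM2l ?state_bounded// exprn_ge0// ltW.
Qed.

(** The relation for b is exact for every partial sum, and the error r^(K+1) in the relation for a
    vanishes in the limit. *)
Lemma exists_kms_limit : exists psi, [/\ is_state psi,
  forall Y, psi (T b ** Y) = psi (Y ** T b),
  forall Y, psi (T a ** Y) = rho * psi (Y ** T a) &
  forall X, `|psi X - chi X| <= 4 * r * `|X|].
Proof.
have [F [psi [FF F_oo psis Fpsi]]] := states_cluster kms_sum_state.
exists psi; split=> // [Y|Y|X].
- apply: (cvg_unique (@norm_hausdorff _ C) (Fpsi _)).
  by have := Fpsi (Y ** T b); under eq_fun do rewrite -kms_sum_trace_b.
- apply/eqP; rewrite -subr_eq0 -normr_le0.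
  have rX : (fun K => r ^+ K.+1 * `|Y ** T a|) @ F --> (0 : C).
    rewrite -[X in _ --> X](mul0r `|Y ** T a|); apply: cvg_complexM; last exact: cvg_cst.
    have : (fun K => r ^+ K) @ \oo --> (0 : C).
      have r1 : r < 1 by rewrite (le_lt_trans r_le)// invf_lt1// ltr1n.
      move: r_gt0 r1; rewrite (gt0_complexE r_gt0); move: (complex.Re r) => s.
      rewrite -(rmorph1 (real_complex R)) !ltcR => s0 s1.
      have -> : (fun K => s%:C ^+ K) = (fun K => (s ^+ K)%:C).
        by apply/funext => K; rewrite rmorphXn.
      apply/cvg_complexP; split; last exact: cvg_cst.
      by apply: cvg_expr; rewrite ger0_norm ?ltW.
    move=> /(cvg_trans _) h; apply: h => S /= hS; apply: F_oo.
    by case: hS => N _ hN; exists N => // n /= Nn; apply: hN; exact: leqW.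
  have hl : (fun K => `|kms_sum K.+1 (T a ** Y) / kms_partition K.+1 -
      rho * (kms_sum K.+1 (Y ** T a) / kms_partition K.+1)|) @ F -->
      `|psi (T a ** Y) - rho * psi (Y ** T a)|.
    apply: cvg_complex_norm; apply: cvg_complexB; first exact: Fpsi.
    by apply: cvg_complexM; [exact: cvg_cst|exact: Fpsi].
  apply: (cvg_complex_le hl rX); apply: nearW => K.
  rewrite mulrA -mulrBl normrM normfV (ger0_norm (ltW (Z0 K))) ler_pdivrMr//.
  apply: le_trans (kms_sum_a K Y) _; apply: (ler_peMr _ (kms_partition_ge1 K)).
  by rewrite mulr_ge0// exprn_ge0// ltW.
- have hl : (fun K => `|kms_sum K.+1 X / kms_partition K.+1 - chi X|) @ F -->
      `|psi X - chi X|.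
    by apply: cvg_complex_norm; apply: cvg_complexB; [exact: Fpsi|exact: cvg_cst].
  apply: (cvg_complex_le hl (@cvg_cst C (4 * r * `|X|) _ F _)).
  by apply: nearW => K; exact: kms_sum_chi.
Qed.

End GibbsState.

Lemma trace_kms_infty : is_kms_infty P theta T chi.
Proof.
(* This makes r = d e^(- beta n) equal to 1 / (n + 2), which is at most 1 / 2 and tends to 0. *)
pose beta n : R := ln (d%:R * n.+2%:R).
have d1 : 1 <= d%:R :> R by rewrite ler1n.
have b1 n : n.+2%:R <= d%:R * n.+2%:R :> R by rewrite ler_peMl.
have b2 n : 1 < d%:R * n.+2%:R :> R by rewrite (lt_le_trans _ (b1 n))// ltr1n.
have ex n : exists psi : A -> C, is_kms P theta T (beta n) psi /\
    forall X, `|psi X - chi X| <= 4 * n.+2%:R^-1 * `|X|.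
  have r0 : 0 < n.+2%:R^-1 :> C by rewrite invr_gt0 ltr0n.
  have r2 : n.+2%:R^-1 <= 2^-1 :> C by rewrite lef_pV2 ?posrE ?ltr0n// ler_nat.
  have [psi [psis psib psia psichi]] := exists_kms_limit r0 r2.
  exists psi; split=> //; apply: kms_of_generators => // Y.
  rewrite psia; congr (_ * _); rewrite expRN lnK ?posrE ?(lt_trans ltr01 (b2 n))//.
  by rewrite invfM mulrC real_complexM !fmorphV !rmorph_nat.
have [psi psiP] := choice ex.
exists beta, psi; split=> [n|n||].
- by rewrite gt_eqF// ln_gt0.
- exact: (psiP n).1.
- apply/cvgryPge => M; exists (Num.truncn (expR M)).+1 => // n /= Mn.
  rewrite -(expRK M) ler_ln ?posrE ?expR_gt0 ?(lt_trans ltr01 (b2 n))//.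
  rewrite (le_trans _ (b1 n))// ltW// (lt_trans (truncnS_gt _))// ltr_nat.
  by rewrite (leq_ltn_trans Mn)// ltnS leqnSn.
- apply/pointwise_cvgP => X; apply/cvgrPdist_le => e e0.
  have e0' : 0 < complex.Re e by rewrite -ltcR -gt0_complexE.
  exists (Num.truncn (complex.Re (4 * `|X| / e))).+1 => // n /= Mn.
  rewrite distrC (le_trans ((psiP n).2 X))//.
  rewrite mulrAC ler_pdivrMr ?ltr0n// -ler_pdivrMl// mulrC.
  have q0 : 0 <= 4 * `|X| / e by rewrite divr_ge0 ?mulr_ge0// ltW.
  have -> : n.+2%:R = (n.+2%:R)%:C :> C by rewrite rmorph_nat.
  rewrite (ge0_complexE q0) lecR.
  by rewrite ltW// (lt_trans (truncnS_gt _))// ltr_nat (leq_ltn_trans Mn)// ltnS leqnSn.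
Qed.

End Trace.

(** Since theta (b^n) = 0, beta drops out of the KMS condition, which exchanges T_(b^n) T_(b^n)^*
    with T_(b^n)^* T_(b^n) = 1. *)
Lemma kms_infty_conj_b (psi : A -> C) n : is_kms_infty P theta T psi ->
  psi (T (b ^+ n)%g ** adj (T (b ^+ n)%g)) = 1.
Proof.
move=> [beta [psi_ [_ kms _ cv]]].
set Z := T _ ** _.
have cZ : (fun m => psi_ m Z) @ \oo --> psi Z by have /pointwise_cvgP := cv; exact.
have h m : psi_ m Z = 1.
  have [[_ _ p1] /(_ (b ^+ n)%g 1%g 1%g (b ^+ n)%g)] := kms m.
  move=> /(_ (bs_pos_bX _ _ n) (@bs_pos1 c d) (@bs_pos1 c d) (bs_pos_bX _ _ n)).
  rewrite (T1 AT) adj_cone cmul1l cmul1r -/Z T_isometry// p1 => ->.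
  by rewrite bs_theta_bX bs_theta1 subrr mulr0 expR0 mul1r.
apply: (cvg_unique (@norm_hausdorff _ C) cZ).
have -> : (fun m => psi_ m Z) = fun=> 1 by apply/funext.
exact: cvg_cst.
Qed.

End KMS.

(** * Traces of the Toeplitz algebra *)

Section RootsOfUnity.
Variable R : realType.
Local Notation C := R[i].

(** The polynomial X^n - 1 splits and is separable, and n distinct n-th roots of unity force a
    primitive one. *)
Lemma complex_prim_root n : (0 < n)%N -> exists z : C, n.-primitive_root z.
Proof.
move=> n0; have [r E] := closed_field_poly_normal ('X^n - 1 : {poly C}).
rewrite (monicP _) ?monicXnsubC// scale1r in E.
have /hasP[z _ zP] : has n.-primitive_root r; last by exists z.
apply: has_prim_root => //.
- by apply/allP => z; rewrite -root_prod_XsubC -E.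
- by rewrite -separable_prod_XsubC -E separable_Xn_sub_1// pnatr_eq0 -lt0n.
- by rewrite -ltnS -(size_prod_XsubC r id) -E size_XnsubC.
Qed.

Lemma norm_prim_root n (z : C) : n.-primitive_root z -> `|z| = 1.
Proof.
move=> zP; have n0 := prim_order_gt0 zP.
by apply/eqP; rewrite -(@pexpr_eq1 _ _ n)// -normrX (prim_expr_order zP) normr1.
Qed.

Lemma sum_prim_root n (z : C) p q : n.-primitive_root z ->
  \sum_(j < n) (z ^+ j) ^+ p * conjc (z ^+ j) ^+ q =
  n%:R * (p == q %[mod n])%:R.
Proof.
move=> zP; have z1 := norm_prim_root zP.
have zc : z * conjc z = 1 by rewrite -sqr_normc z1 expr1n.
have z0 : z != 0 by rewrite -normr_eq0 z1 oner_eq0.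
have conjX m : conjc (z ^+ m) = z ^- m.
  have h : z ^+ m * conjc (z ^+ m) = 1 by rewrite -sqr_normc normrX z1 !expr1n.
  by apply: (mulfI (expf_neq0 m z0)); rewrite h divff ?expf_neq0.
pose w := z ^+ p * z ^- q.
have -> : \sum_(j < n) (z ^+ j) ^+ p * conjc (z ^+ j) ^+ q = \sum_(j < n) w ^+ j.
  apply: eq_bigr => j _; rewrite conjX exprVn /w exprMn exprVn.
  by rewrite -!exprM ![(j * _)%N]mulnC.
have w1 : (w == 1) = (p == q %[mod n]).
  rewrite -(eq_prim_root_expr zP) /w; have zq := expf_neq0 q z0.
  by apply/eqP/eqP => [h|->]; [rewrite -(divfK zq (z ^+ p)) h mul1r|rewrite divff].
have [e|ne] := boolP (p == q %[mod n]).
  rewrite e in w1; rewrite (eqP w1) mulr1.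
  under eq_bigr do rewrite expr1n.
  by rewrite sumr_const card_ord.
rewrite mulr0; rewrite (negPf ne) in w1.
have wn : w ^+ n = 1.
  by rewrite /w exprMn exprVn -!exprM ![(_ * n)%N]mulnC !exprM (prim_expr_order zP) !expr1n divr1.
have := subrX1 w n; rewrite wn subrr => /esym/eqP.
by rewrite mulf_eq0 subr_eq0 w1 /= => /eqP.
Qed.

End RootsOfUnity.

(** * Fejer means and factorization through the symbol map *)

Section Fejer.
Variables (R : realType) (TN : cstarAlgType R) (S : TN).
Hypothesis S_isometry : adj S ** S = cone.
Local Notation C := R[i].
Local Notation Vn := (cpow S).
Local Notation Va := (cpow (adj S)).
Implicit Types (X Y : TN) (z : C).
Variable omega : TN -> C.
Hypotheses (omegas : is_state omega) (omega_conj : forall n, omega (Vn n ** Va n) = 1).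
Let omegap := state_positive omegas.

(** The difference is omega (S^s p S^*^t) with p = 1 - S S^*, and omega (S^s p S^*^s) = 1 - 1 = 0,
    so Cauchy-Schwarz applies. *)
Lemma omega_shift s t : omega (Vn s.+1 ** Va t.+1) = omega (Vn s ** Va t).
Proof.
pose p := cone - S ** adj S.
have padj : adj p = p by rewrite adjB adj_cone adjM adjK.
have pp : p ** p = p.
  rewrite /p cmulBl !cmulBr !cmul1l cmul1r cmulA -[S ** adj S ** S]cmulA.
  by rewrite S_isometry cmul1r subrr subr0.
have E k l : Vn k ** p ** Va l = Vn k ** Va l - Vn k.+1 ** Va l.+1.
  by rewrite /p cmulBr cmulBl cmul1r cpowSr (cpowS (adj S)) !cmulA.
apply/eqP; rewrite eq_sym -subr_eq0 -pfunB// -E -{1}pp; apply/eqP.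
have -> : Vn s ** (p ** p) ** Va t = adj (p ** Va s) ** (p ** Va t).
  by rewrite adjM adj_cpow adjK padj !cmulA.
apply: pfun_null_adj => //; rewrite adjM adj_cpow adjK padj !cmulA -[_ ** p ** p]cmulA.
by rewrite pp E pfunB// !omega_conj subrr.
Qed.

Lemma omega_toeplitz m n s t : (m + s = n + t)%N ->
  omega (Va m ** Vn n) = omega (Vn s ** Va t).
Proof.
have shift k s' t' : omega (Vn (s' + k) ** Va (t' + k)) = omega (Vn s' ** Va t').
  by elim: k => [|k IH]; rewrite ?addn0// !addnS omega_shift.
move=> E; rewrite isometry_mul//; have [mn|nm] := leqP m n.
  have -> : s = ((n - m) + t)%N by lia.
  have -> : (m - n = 0)%N by lia.
  by rewrite -[t in RHS]add0n shift.
have -> : t = ((m - n) + s)%N by lia.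
have -> : (n - m = 0)%N by lia.
by rewrite -[s in RHS]add0n shift.
Qed.

(** The length N - |s - t| of a diagonal of an N by N matrix, when |s - t| <= N; divided by N it is
    the Fejer multiplier. *)
Definition fejer_count N s t : nat := \sum_(m < N) \sum_(n < N) (m + s == n + t)%N.

Lemma fejer_countP N s t : (fejer_count N s t <= N <= fejer_count N s t + s + t)%N.
Proof.
have inner m : (\sum_(n < N) (m + s == n + t)%N = (t <= m + s < N + t))%N.
  have [/andP[tm mN]|h] := boolP (t <= m + s < N + t)%N.
    have nN : (m + s - t < N)%N by lia.
    rewrite (bigD1 (Ordinal nN))//= subnK// eqxx big1 ?addn0// => i.
    rewrite -val_eqE /= => /eqP ne; apply/eqP; rewrite eqb0; apply/eqP; lia.
  rewrite big1// => i _; apply/eqP; rewrite eqb0; apply/eqP => E.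
  by move: h; rewrite E leq_addl ltn_add2r ltn_ord.
have lt_sum k : (\sum_(m < N) (m < k) <= k)%N.
  suff -> : (\sum_(m < N) (m < k) = minn N k)%N by rewrite geq_minr.
  by elim: N {inner} => [|N IH]; rewrite ?big_ord0 ?min0n// big_ord_recr /= IH; case: ltnP; lia.
rewrite /fejer_count; under eq_bigr do rewrite inner.
apply/andP; split.
  rewrite -[leqRHS]card_ord -sum1_card; apply: leq_sum => i _; exact: leq_b1.
have gt_sum : (\sum_(m < N) (N <= m + s) <= s)%N.
  rewrite (reindex_inj rev_ord_inj) /= (leq_trans _ (lt_sum s))//.
  apply: leq_sum => i _; have iN := ltn_ord i; case: (leqP N (N - i.+1 + s)) => //= h.
  by have -> : (i < s)%N by lia.
rewrite -addnA (leq_trans _ (leq_add (leqnn _) (leq_add gt_sum (lt_sum t))))//.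
rewrite -!big_split -[leqLHS]card_ord -sum1_card; apply: leq_sum => i _ /=.
have iN := ltn_ord i.
by case: (leqP t (i + s)); case: (ltnP (i + s) (N + t)); case: (leqP N (i + s));
  case: (ltnP i t) => //=; lia.
Qed.

Variable q : TN -> circle_functions R.
Hypothesis TNq : is_symbol_map S q.

Lemma symbol_monomial s t (z : @circle R) : q (Vn s ** Va t) z = \val z ^+ s * conjc (\val z) ^+ t.
Proof.
rewrite (symbolM TNq); congr (_ * _).
  elim: s => [|s IH]; first by rewrite (symbol1 TNq).
  by rewrite cpowS (symbolM TNq) IH (symbol_gen TNq) exprS.
elim: t => [|t IH]; first by rewrite (symbol1 TNq).
by rewrite cpowS (symbolM TNq) IH (symbol_adj TNq) (symbol_gen TNq) exprS.
Qed.

Section FejerState.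
Variables (N : nat) (zeta : C) (pt : nat -> @circle R).
Hypotheses (N_gt0 : (0 < N)%N) (zetaP : (2 * N).-primitive_root zeta).
Hypothesis ptE : forall j, \val (pt j) = zeta ^+ j.

(** The number omega (v^* v) for this vector v is N times the Fejer mean of the moments of omega at
    zeta^j; in this form it is visibly nonnegative. *)
Definition fejer_vector j : TN := \sum_(n < N) conjc (zeta ^+ j) ^+ n *: Vn n.

Definition fejer X : C := ((2 * N) * N)%:R^-1 *
  \sum_(j < 2 * N) omega (adj (fejer_vector j) ** fejer_vector j) * q X (pt j).

Lemma fejer_weight j : omega (adj (fejer_vector j) ** fejer_vector j) =
  \sum_(m < N) \sum_(n < N)
    (zeta ^+ j) ^+ m * conjc (zeta ^+ j) ^+ n * omega (Va m ** Vn n).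
Proof.
rewrite adj_sum cmul_suml pfun_sum//; apply: eq_bigr => m _.
rewrite cmul_sumr pfun_sum//; apply: eq_bigr => n _.
rewrite adjZ cmulZl cmulZr !pfunZ// adj_cpow mulrA; congr (_ * _ * _).
by rewrite rmorphXn /= conjcK.
Qed.

Lemma fejer_monomial s t : (s + t <= N)%N ->
  fejer (Vn s ** Va t) = (fejer_count N s t)%:R / N%:R * omega (Vn s ** Va t).
Proof.
move=> stN; rewrite /fejer.
have -> : \sum_(j < 2 * N) omega (adj (fejer_vector j) ** fejer_vector j) *
      q (Vn s ** Va t) (pt j) =
    \sum_(m < N) \sum_(n < N) omega (Va m ** Vn n) *
      \sum_(j < 2 * N) (zeta ^+ j) ^+ (m + s) * conjc (zeta ^+ j) ^+ (n + t).
  under eq_bigr do rewrite fejer_weight symbol_monomial ptE mulr_suml.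
  rewrite exchange_big; apply: eq_bigr => m _ /=.
  under eq_bigr do rewrite mulr_suml.
  rewrite exchange_big; apply: eq_bigr => n _ /=.
  by rewrite mulr_sumr; apply: eq_bigr => j _; rewrite !exprD; ring.
have -> : \sum_(m < N) \sum_(n < N) omega (Va m ** Vn n) *
      \sum_(j < 2 * N) (zeta ^+ j) ^+ (m + s) * conjc (zeta ^+ j) ^+ (n + t) =
    (2 * N)%:R * (fejer_count N s t)%:R * omega (Vn s ** Va t).
  rewrite natr_sum mulr_sumr mulr_suml; apply: eq_bigr => m _.
  rewrite natr_sum mulr_sumr mulr_suml; apply: eq_bigr => n _.
  rewrite sum_prim_root//.
  (* As s + t <= N, both sides lie below 2 N; this is why the roots have order 2 N. *)
  have -> : (m + s == n + t %[mod 2 * N])%N = (m + s == n + t)%N.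
    have mN := ltn_ord m; have nN := ltn_ord n; rewrite !modn_small; [by []|lia|lia].
  case: eqP => [E|_]; last by rewrite !mulr0 mul0r.
  by rewrite (omega_toeplitz E) mulr1 mulrC.
have N0 : N%:R != 0 :> C by rewrite pnatr_eq0 -lt0n.
by rewrite !natrM; field.
Qed.

Lemma fejer_state : is_state fejer.
Proof.
split=> [z X Y|X|].
- rewrite /fejer mulrCA -mulrDr; congr (_ * _).
  rewrite [X in _ = X + _]mulr_sumr -big_split.
  by apply: eq_bigr => j _ /=; rewrite (symbol_linear TNq); ring.
- rewrite mulr_ge0 ?invr_ge0 ?ler0n//; apply: sumr_ge0 => j _.
  rewrite mulr_ge0 ?pfun_ge0// (symbolM TNq) (symbol_adj TNq) mulrC.
  by rewrite -[X in 0 <= X]/(_ * conjc _) -sqr_normc exprn_ge0.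
- have := @fejer_monomial 0 0 (leq0n N); rewrite cmul1l => ->.
  have := fejer_countP N 0 0; rewrite !addn0 -eqn_leq => /eqP ->.
  by rewrite divff ?pnatr_eq0 -?lt0n// mul1r; case: omegas.
Qed.

End FejerState.

(** The middle clause expresses factorization through q in a form that passes to pointwise
    limits. *)
Lemma exists_fejer n : exists psi : TN -> C, [/\ is_state psi,
  forall X Y, q X = q Y -> psi X = psi Y &
  forall s t, (s + t <= n.+1)%N ->
    `|psi (Vn s ** Va t) - omega (Vn s ** Va t)| <= (s + t)%:R / n.+1%:R].
Proof.
have [zeta zetaP] : exists z : C, (2 * n.+1).-primitive_root z.
  exact: complex_prim_root.
have z1 j : @circle R (zeta ^+ j).
  by rewrite /circle /= normrX (norm_prim_root zetaP) expr1n.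
pose pt j : @circle R := exist _ (zeta ^+ j) (mem_set (z1 j)).
exists (fejer n.+1 zeta pt); split=> [|X Y XY|s t stn].
- by apply: fejer_state.
- by rewrite /fejer XY.
rewrite fejer_monomial// -[X in _ - X]mul1r -mulrBl normrM.
have w1 : `|omega (Vn s ** Va t)| <= 1.
  rewrite (le_trans (state_bounded _ omegas))// (le_trans (cstar_normM _ _))//.
  have cpow_norm m : `|cpow S m| <= 1.
    have : `|cpow S m| ^+ 2 <= 1 ^+ 2.
      by rewrite -cstar_norm adj_cpow isometry_cancel// expr1n norm_cone.
    by rewrite ler_pXn2r ?nnegrE.
  by rewrite -adj_cpow norm_adj mulr_ile1.
rewrite (le_trans (ler_wpM2l _ w1))// mulr1.
have /andP[le ge] := fejer_countP n.+1 s t.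
have n0 : 0 < n.+1%:R :> C by rewrite ltr0n.
rewrite distrC -[X in X - _](divff (lt0r_neq0 n0)) -mulrBl normrM normfV.
rewrite (ger0_norm (ltW n0)) ler_pM2r ?invr_gt0// -natrB// normr_nat ler_nat.
by rewrite leq_subLR addnA.
Qed.

Lemma trace_factors : generates [set S] -> factors_through q omega.
Proof.
move=> Sgen; move: (@choice _ _ _ exists_fejer) => [psi psiP].
have psis n : is_state (psi n) by case: (psiP n).
have [F [phi [FF F_oo phis Fphi]]] := states_cluster psis.
have phiE : phi = omega.
  apply: (state_ext (toeplitz_elements_dense Sgen S_isometry)) => // _ [s [t ->]].
  apply: (cvg_unique (@norm_hausdorff _ C) (Fphi _)).
  suff : (fun n => psi n (Vn s ** Va t)) @ \oo --> omega (Vn s ** Va t).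
    by move=> /(cvg_trans _); apply => Q /= ?; exact: F_oo.
  apply/cvgrPdist_le => e e0.
  exists (s + t + Num.truncn (complex.Re ((s + t)%:R / e)))%N => // n /= hn.
  rewrite distrC; have [_ _ /(_ s t) h] := psiP n.
  rewrite (le_trans (h _))//; first by rewrite leqW// (leq_trans _ hn)// leq_addr.
  rewrite ler_pdivrMr ?ltr0n// mulrC -ler_pdivrMr//.
  have q0 : 0 <= (s + t)%:R / e by rewrite divr_ge0 ?ler0n// ltW.
  have -> : n.+1%:R = (n.+1%:R)%:C :> C by rewrite rmorph_nat.
  rewrite (ge0_complexE q0) lecR ltW// (lt_le_trans (truncnS_gt _))// ler_nat ltnS.
  by rewrite (leq_trans _ hn)// leq_addl.
have qomega X Y : q X = q Y -> omega X = omega Y.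
  move=> XY; rewrite -phiE; apply: (cvg_unique (@norm_hausdorff _ C) (Fphi X)).
  have -> : (fun n => psi n X) = (fun n => psi n Y); last exact: Fphi.
  by apply/funext => n; have [_ h _] := psiP n; exact: h.
(* A value of the factor g at f; it is arbitrary if f is outside the range of q. *)
have ex f : exists v, forall X, q X = f -> omega X = v.
  have [[X <-]|no] := pselect (exists X, q X = f); last by exists 0 => X /(ex_intro _ X)/no.
  by exists (omega X) => Y /qomega.
have [g gP] := choice ex.
by exists g; apply/funext => X; exact: gP.
Qed.

End Fejer.

(** On the circle the symbol of S^n S^*^n is |z|^(2 n) = 1, the symbol of the unit. *)
Lemma factors_conj (R : realType) (TN : cstarAlgType R) (S : TN)
    (q : TN -> circle_functions R) (omega : TN -> R[i]) n :
  is_symbol_map S q -> is_state omega -> factors_through q omega ->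
  omega (cpow S n ** cpow (adj S) n) = 1.
Proof.
move=> TNq [_ _ o1] [g E]; rewrite -o1 E /=; congr (g _); apply/continuousEP => z.
rewrite (symbol_monomial TNq) (symbol1 TNq) -exprMn -sqr_normc.
by have := set_valP z; rewrite /circle /= => ->; rewrite !expr1n.
Qed.

Theorem theorem8p1 (R : realType) (c d : nat) (c_gt0 : (0 < c)%N) (d_gt0 : (0 < d)%N)
    (A : cstarAlgType R) (T : BS c d -> A)
    (AT : is_semigroup_algebra (@bs_pos c d) T)
    (alpha : R -> A -> A)
    (Aalpha : is_dynamics (@bs_pos c d) (@bs_theta c d) T alpha)
    (TN : cstarAlgType R) (S : TN) (TNS : is_toeplitz S)
    (q : TN -> circle_functions R) (TNq : is_symbol_map S q) :
  exists Psi : {ptws TN -> R[i]} -> {ptws A -> R[i]},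
    [/\ forall omega : TN -> R[i], is_state omega ->
          [/\ is_ground alpha (Psi omega),
              forall x y : BS c d, bs_pos x -> bs_pos y ->
                bs_theta x != 0 \/ bs_theta y != 0 ->
                Psi omega (T x ** adj (T y)) = 0,
              forall (x y : BS c d) (s t : nat),
                x = (bs_b c d ^+ s)%g -> y = (bs_b c d ^+ t)%g ->
                Psi omega (T x ** adj (T y)) = omega (cpow S s ** cpow (adj S) t)
            & is_kms_infty (@bs_pos c d) (@bs_theta c d) T (Psi omega) <->
                factors_through q omega],
        compact (ground_states alpha),
        functional_convex (ground_states alpha)
      & affine_isomorphism (@states R TN) (ground_states alpha) Psi].
Proof.
have [Psi [PsiP aff]] := parametrization c_gt0 d_gt0 AT TNS Aalpha.
have Si : adj S ** S = cone := (toeplitz_coefficients TNS).1.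
exists Psi; split=> [omega os||//|//].
- have [ps [p0 pb]] := PsiP _ os; split=> //.
  + exact: (theta_null_ground c_gt0 d_gt0 AT Aalpha).
  + by move=> x y s t -> ->.
  + split=> [kms|fac].
      apply: (trace_factors Si os _ TNq TNS.1) => n.
      by rewrite -pb; exact: (kms_infty_conj_b AT).
    apply: (trace_kms_infty c_gt0 d_gt0 AT ps p0) => s t.
    rewrite !pb; apply: (omega_shift Si os) => n.
    exact: (factors_conj _ TNq os fac).
- exact: (ground_compact c_gt0 d_gt0 AT Aalpha).
- exact: (ground_convex c_gt0 d_gt0 AT Aalpha).
Qed.
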